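(* Suppose that the following assumptions hold. (i) For each element $\Omega^e\in\mathcal{M}$, there exists a constant $C_{\text{inv}}>0$, independent of the diameter $h_e$ of $\Omega^e$, such that $$\left(\nabla\cdot(2\nu\nabla^s\mathbf{v}^h),\nabla\cdot(2\nu\nabla^s\mathbf{v}^h)\right)_{\Omega^e}\le\frac{C_{\text{inv}}}{h_e^2}\left(\nu\nabla^s\mathbf{v}^h,\nu\nabla^s\mathbf{v}^h\right)_{\Omega^e}\qquad\text{for all }\mathbf{v}^h\in\mathcal{V}^h.$$ (ii) For each element $\Omega^e\in\mathcal{M}$, $\tau_{\text{M}}\le\dfrac{h_e^2}{C_{\text{inv}}\nu}$ on $\Omega^e$, with $C_{\text{inv}}$ the constant in (i). (iii) The coarse-scale spaces are divergence-conforming: $\nabla\cdot\mathcal{V}^h\subseteq\mathcal{Q}^h$. Let $(\mathbf{u},p)\in\mathcal{V}\times\mathcal{Q}$ be the exact solution of the Oseen problem and let $(\mathbf{u}^h,\tilde p)\in\mathring{\mathcal{V}}^h\times\tilde{\mathcal{Q}}$ be a solution of the reduced discrete formulation (both given in the context). If $(\mathbf{u},p)\in(H^2(\Omega))^d\times H^1(\Omega)$, then $$|||(\mathbf{u}-\mathbf{u}^h,p-\tilde p)|||\le 7\inf_{(\mathbf{w}^h,\tilde r)\in\mathring{\mathcal{V}}^h\times\tilde{\mathcal{Q}}}|||(\mathbf{u}-\mathbf{w}^h,p-\tilde r)|||_+ .$$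
   Context: Let $\Omega\subset\mathbb{R}^d$ be the spatial domain, $\nu>0$ the kinematic viscosity, $\mathbf{f}:\Omega\to\mathbb{R}^d$ a source term, $\mathcal{V}=(H^1_0(\Omega))^d$, $\mathcal{Q}=L^2_0(\Omega)$ (mean-zero $L^2$ functions), and let $\mathbf{a}\in\mathcal{V}$ be a fixed advection velocity with $\nabla\cdot\mathbf{a}=0$. $(\cdot,\cdot)$ is the $L^2(\Omega)$ inner product, $(\cdot,\cdot)_{\Omega^e}$ the $L^2(\Omega^e)$ inner product, $\nabla^s$ the symmetrized gradient, and $c(\mathbf{a},\mathbf{v}_1,\mathbf{v}_2)=\int_\Omega(\mathbf{a}\cdot\nabla\mathbf{v}_1)\cdot\mathbf{v}_2\,d\Omega$, $k(\mathbf{v}_1,\mathbf{v}_2)=\int_\Omega2\nu\nabla^s\mathbf{v}_1:\nabla^s\mathbf{v}_2\,d\Omega$, $b(\mathbf{v},q)=\int_\Omega(\nabla\cdot\mathbf{v})q\,d\Omega$. Oseen problem: find $(\mathbf{u},p)\in\mathcal{V}\times\mathcal{Q}$ with $c(\mathbf{a},\mathbf{u},\mathbf{v})+k(\mathbf{u},\mathbf{v})-b(\mathbf{v},p)+b(\mathbf{u},q)=(\mathbf{f},\mathbf{v})$ for all $(\mathbf{v},q)\in\mathcal{V}\times\mathcal{Q}$. Discrete spaces: $\mathcal{V}^h\subset\mathcal{V}$ and $\mathcal{Q}^h\subset\mathcal{Q}\cap H^1(\Omega)$ (the coarse-scale velocity and pressure spaces) are finite-dimensional, form an inf-sup stable pair,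 and are (mapped) piecewise-polynomial or piecewise-rational with respect to a mesh $\mathcal{M}$ of elements $\Omega^e$, $e=1,\dots,n_{el}$, with $\Omega=\text{int}(\cup_e\overline{\Omega^e})$. $\mathcal{Q}'\subset H^1(\Omega)$ (the fine-scale pressure space) is a finite-dimensional space with $\mathcal{Q}^h\subseteq\mathcal{Q}'$, and $\tilde{\mathcal{Q}}=\mathcal{Q}^h+\mathcal{Q}'=\mathcal{Q}'$. $\mathring{\mathcal{V}}^h=\{\mathbf{v}^h\in\mathcal{V}^h:b(\mathbf{v}^h,q^h)=0\ \text{for all }q^h\in\mathcal{Q}^h\}$. $\tau_{\text{C}}\ge0$ and $\tau_{\text{M}}>0$ are stabilization parameters. Convention: inner products involving $\nabla\cdot(2\nu\nabla^s\mathbf{v})$ when this is not square-integrable on $\Omega$ are understood as sums of the $L^2$ inner products over element interiors. Reduced discrete formulation: find $(\mathbf{u}^h,\tilde p)\in\mathring{\mathcal{V}}^h\times\tilde{\mathcal{Q}}$ such that for all $(\mathbf{v}^h,\tilde q)\in\mathring{\mathcal{V}}^h\times\tilde{\mathcal{Q}}$, $A_{\text{red}}((\mathbf{u}^h,\tilde p),(\mathbf{v}^h,\tilde q))=(\mathbf{f},\mathbf{v}^h)+(\mathbf{f},\tau_{\text{M}}(\mathbf{a}\cdot\nabla\mathbf{v}^h+\nabla\tilde q))$, where \begin{align*} A_{\text{red}}((\mathbf{w},r),(\mathbf{v},q))={}&c(\mathbf{a},\mathbf{w},\mathbf{v})+k(\mathbf{w},\mathbf{v})+(\tau_{\text{C}}\nabla\cdot\mathbf{w},\nabla\cdot\mathbf{v})\\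 &+\left(\mathbf{a}\cdot\nabla\mathbf{w}-\nabla\cdot(2\nu\nabla^s\mathbf{w})+\nabla r,\ \tau_{\text{M}}(\mathbf{a}\cdot\nabla\mathbf{v}+\nabla q)\right). \end{align*} Norms: $|||(\mathbf{v},q)|||^2=k(\mathbf{v},\mathbf{v})+(\mathbf{a}\cdot\nabla\mathbf{v}+\nabla q,\tau_{\text{M}}(\mathbf{a}\cdot\nabla\mathbf{v}+\nabla q))$ and $|||(\mathbf{v},q)|||_+^2=|||(\mathbf{v},q)|||^2+(\nabla\cdot(2\nu\nabla^s\mathbf{v}),\tau_{\text{M}}\nabla\cdot(2\nu\nabla^s\mathbf{v}))+(\mathbf{v},\tau_{\text{M}}^{-1}\mathbf{v})$. *)

(* Defs.v *)
From HB Require Import structures.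
From mathcomp Require Import all_boot all_order all_algebra.
From mathcomp Require Import all_classical all_reals all_analysis.
From mathcomp.multinomials Require mpoly.
Set Implicit Arguments.
Unset Strict Implicit.
Unset Printing Implicit Defensive.
Import Order.TTheory GRing.Theory Num.Theory.
Import numFieldNormedType.Exports.
Local Open Scope classical_set_scope.
Local Open Scope ring_scope.

(* Lebesgue measure on R^n, as a measure on row vectors.  The sigma-algebra is
   the one generated by the coordinates, i.e. the Borel one; the measure is the
   iterated product of the one-dimensional Lebesgue measure, and
   [lebesgue_rV_box] checks its value on boxes. *)

Definition rV_display : measure_display -> measure_display.
Proof. exact. Qed.

Section measurable_rV.
Context {R : realType} (n : nat).

Definition rV_coord (i : 'I_n) (x : 'rV[R]_n) : measurableTypeR R := x 0 i.

Let rV_set0 : g_sigma_preimage rV_coord set0.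
Proof. exact: sigma_algebra0. Qed.

Let rV_setC A : g_sigma_preimage rV_coord A -> g_sigma_preimage rV_coord (~` A).
Proof. exact: sigma_algebraC. Qed.

Let rV_bigcup (F : (set 'rV[R]_n)^nat) :
  (forall i, g_sigma_preimage rV_coord (F i)) ->
  g_sigma_preimage rV_coord (\bigcup_i (F i)).
Proof. exact: sigma_algebra_bigcup. Qed.

HB.instance Definition _ := @isMeasurable.Build
  (rV_display (measure_tuple_display R.-ocitv.-measurable.-sigma))
  'rV[R]_n (g_sigma_preimage rV_coord) rV_set0 rV_setC rV_bigcup.
End measurable_rV.

Section rV_cons.
Context {R : realType} (n : nat).

Definition rV_cons (p : measurableTypeR R * 'rV[R]_n) : 'rV[R]_n.+1 :=
  row_mx (p.1 : R)%:M p.2 : 'rV_(1 + n).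

Definition rV_uncons (x : 'rV[R]_n.+1) : measurableTypeR R * 'rV[R]_n :=
  (lsubmx (x : 'rV_(1 + n)) 0 0, rsubmx (x : 'rV_(1 + n))).

Lemma rV_consK : cancel rV_cons rV_uncons.
Proof.
by case=> a y; rewrite /rV_uncons /rV_cons row_mxKl row_mxKr !mxE eqxx mulr1n.
Qed.

Lemma rV_unconsK : cancel rV_uncons rV_cons.
Proof.
by move=> x; rewrite /rV_cons /rV_uncons /= -mx11_scalar hsubmxK.
Qed.

Lemma measurable_rV_coord m (i : 'I_m) :
  measurable_fun setT (@rV_coord R m i).
Proof.
move=> _ Y mY; rewrite setTI; apply: sub_sigma_algebra => /=.
rewrite -bigcup_seq/=; exists i => /=; first by rewrite mem_index_enum.
by exists Y => //; rewrite setTI.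
Qed.

Lemma measurable_fun_rVP d (T : measurableType d) m (f : T -> 'rV[R]_m) :
  (forall i, measurable_fun setT (@rV_coord R m i \o f)) ->
  measurable_fun setT f.
Proof.
move=> mf; apply: (@measurability _ _ _ _ _ _
    (\big[setU/set0]_(i < m) preimage_set_system setT (@rV_coord R m i) measurable)) => //.
move=> _ [B + <-]; rewrite -bigcup_seq => -[i /= _ [A mA <-]].
by rewrite !setTI -comp_preimage -[X in measurable X]setTI; exact: mf.
Qed.

Lemma measurable_rV_cons : measurable_fun setT rV_cons.
Proof.
apply: measurable_fun_rVP => i.
case: (@split_ordP 1 n i) => j -> /=.
  rewrite (_ : _ \o _ = fst) //; apply/funext => -[a y] /=.
  by rewrite /rV_coord [LHS](row_mxEl (a : R)%:M y 0 j) mxE ord1 mulr1n.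
rewrite (_ : _ \o _ = @rV_coord R n j \o snd); last first.
  by apply/funext => -[a y]; exact: (row_mxEr (a : R)%:M y 0 j).
exact: measurableT_comp (measurable_rV_coord j) measurable_snd.
Qed.

Lemma measurable_rV_uncons : measurable_fun setT rV_uncons.
Proof.
apply/measurable_fun_pairP; split.
  rewrite (_ : _ \o _ = @rV_coord R n.+1 (lshift n (0 : 'I_1))).
    exact: measurable_rV_coord.
  by apply/funext => x; rewrite /rV_coord /= mxE.
apply: measurable_fun_rVP => i.
rewrite (_ : _ \o _ = @rV_coord R n.+1 (rshift 1 i)).
  exact: measurable_rV_coord.
by apply/funext => x; rewrite /rV_coord /= mxE.
Qed.

End rV_cons.

Section lebesgue_step.
Local Open Scope ereal_scope.
Context {R : realType} (n : nat).
Variable m : {sigma_finite_measure set 'rV[R]_n -> \bar R}.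

Definition leb_step : set 'rV[R]_n.+1 -> \bar R :=
  pushforward (@lebesgue_measure R \x m) (@rV_cons R n).

Let leb_step0 : leb_step set0 = 0.
Proof. by rewrite /leb_step /pushforward preimage_set0 measure0. Qed.

Let leb_step_ge0 A : 0 <= leb_step A.
Proof. by rewrite /leb_step /pushforward; apply: measure_ge0. Qed.

Let leb_step_sigma_additive : semi_sigma_additive leb_step.
Proof.
exact: (@measure_semi_sigma_additive _ _ _
  (measure_function_pushforward__canonical__measure_function_Measure
     (@lebesgue_measure R \x m) (@measurable_rV_cons R n))).
Qed.

HB.instance Definition _ := isMeasure.Build _ _ _
  leb_step leb_step0 leb_step_ge0 leb_step_sigma_additive.

Let leb_step_sigma_finite : sigma_finite setT leb_step.
Proof.
have /sigma_finiteP[F [TF ndF Foo]] := sigma_finiteT (@lebesgue_measure R).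
have /sigma_finiteP[G [TG ndG Goo]] := sigma_finiteT m.
exists (fun k => @rV_uncons R n @^-1` (F k `*` G k)).
  apply/esym; rewrite -subTset => x _.
  have [k _ Fk] : (\bigcup_i F i) (rV_uncons x).1 by rewrite -TF.
  have [l _ Gl] : (\bigcup_i G i) (rV_uncons x).2 by rewrite -TG.
  exists (maxn k l) => //; split.
  - by move: Fk; exact/subsetPset/ndF/leq_maxl.
  - by move: Gl; exact/subsetPset/ndG/leq_maxr.
move=> k; have [mF Fk] := Foo k; have [mG Gk] := Goo k; split.
  rewrite -[X in measurable X]setTI.
  by apply: measurable_rV_uncons => //; exact: measurableX.
rewrite /leb_step /pushforward.
rewrite (_ : _ @^-1` _ = F k `*` G k); last first.
  by apply/funext => p; exact: (congr1 (F k `*` G k) (rV_consK p)).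
by rewrite product_measure1E// lte_mul_pinfty// ge0_fin_numE.
Qed.

HB.instance Definition _ := Measure_isSigmaFinite.Build _ _ _
  leb_step leb_step_sigma_finite.

End lebesgue_step.

Fixpoint lebesgue_rV (R : realType) (n : nat) :
    {sigma_finite_measure set 'rV[R]_n -> \bar R} :=
  match n with
  | 0 => \d_(0 : 'rV[R]_0)
  | k.+1 => leb_step (lebesgue_rV R k)
  end.


Lemma measurable_box (R : realType) (n : nat) (a b : 'I_n -> R) :
  measurable [set x : 'rV[R]_n | forall i, x 0 i \in `]a i, b i]].
Proof.
rewrite (_ : mkset _ = \bigcap_(i in [set: 'I_n])
    (@rV_coord R n i @^-1` [set` `]a i, b i]])); last first.
  by apply/seteqP; split => x /= h i => [_|]; [exact: h|exact: (h i)].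
apply: fin_bigcap_measurable => // i _.
rewrite -[X in measurable X]setTI.
by apply: measurable_rV_coord => //; exact: measurable_itv.
Qed.

Lemma lebesgue_rV_box (R : realType) (n : nat) (a b : 'I_n -> R) :
  (forall i, a i <= b i) ->
  lebesgue_rV R n [set x | forall i, x 0 i \in `]a i, b i]] =
  (\prod_(i < n) (b i - a i))%:E.
Proof.
elim: n a b => [|n IH] a b ab.
  by rewrite big_ord0 /= diracE mem_set // => -[].
set S := mkset _; pose B := [set x : 'rV[R]_n |
  forall i, x 0 i \in `]a (lift ord0 i), b (lift ord0 i)]].
have -> : lebesgue_rV R n.+1 S =
    (@lebesgue_measure R \x lebesgue_rV R n)%E (`]a ord0, b ord0] `*` B).
  rewrite [LHS](_ : _ = (@lebesgue_measure R \x lebesgue_rV R n)%E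
    (@rV_cons R n @^-1` S)) //; congr product_measure1.
  have E0 x y : @rV_cons R n (x, y) 0 ord0 = x.
    rewrite (_ : ord0 = lshift n (0 : 'I_1)); last exact/val_inj.
    by rewrite [LHS](row_mxEl (x : R)%:M y 0 _) mxE eqxx mulr1n.
  have E1 x y i : @rV_cons R n (x, y) 0 (lift ord0 i) = y 0 i.
    rewrite (_ : lift ord0 i = rshift 1 i); last exact/val_inj.
    exact: (row_mxEr (x : R)%:M y 0 i).
  apply/seteqP; split => -[x y] /= h.
    by split; [move: (h ord0); rewrite E0|move=> i /=; move: (h (lift ord0 i)); rewrite E1].
  move=> i; case: (unliftP ord0 i) => [j ->|->]; rewrite ?E0 ?E1; [exact: h.2|exact: h.1].
rewrite product_measure1E; [|exact: measurable_itv|exact: measurable_box].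
rewrite IH // big_ord_recl EFinM; congr (_ * _)%E.
rewrite [LHS](@lebesgue_measure_itv R `]a ord0, b ord0]) /= lte_fin.
by have := ab ord0; rewrite le_eqVlt => /predU1P[->|->] //; rewrite ltxx subrr.
Qed.

Section calculus.
Context {R : realType} {d : nat}.
Local Notation X := 'rV[R]_d.
Local Notation mu := (lebesgue_rV R d).
Implicit Types (U A : set X) (f g q phi : X -> R) (u v w : X -> X).

Definition basis_vec (i : 'I_d) : X := delta_mx 0 i.

Definition vcomp v (i : 'I_d) : X -> R := fun x => v x 0 i.

Definition dot (x y : X) : R := \sum_i x 0 i * y 0 i.

Definition ddot (S T : 'M[R]_d) : R := \sum_i \sum_j S i j * T i j.

(* The norm carried by ['rV[R]_d] is the max norm, hence this definition. *)
Definition euclid_dist (x y : X) : R := Num.sqrt (dot (x - y) (x - y)).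

Definition diam A : R :=
  sup [set euclid_dist p.1 p.2 | p in A `*` A].

Definition cpartial (i : 'I_d) f : X -> R := 'D_(basis_vec i) f.

(* C^oo on the open set U: all iterated partial derivatives exist and are
   continuous at every point of U. *)
Definition smooth_on U f : Prop :=
  forall (s : seq 'I_d) (x : X), U x ->
    {for x, continuous (foldr cpartial f s)} /\
    (forall i, derivable (foldr cpartial f s) x (basis_vec i)).

Definition smooth_near A f : Prop :=
  exists U, [/\ open U, A `<=` U & smooth_on U f].

Definition test_function U phi : Prop :=
  smooth_on setT phi /\
  (compact (closure [set x | phi x != 0]) /\ closure [set x | phi x != 0] `<=` U).

Definition L2 U f : Prop :=
  measurable_fun U f /\ mu.-integrable U (EFin \o (fun x => f x ^+ 2)).

Definition weak_partial U (i : 'I_d) f g : Prop :=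
  forall phi, test_function U phi ->
    \int[mu]_(x in U) (f x * cpartial i phi x) =
    - \int[mu]_(x in U) (g x * phi x).

(* A chosen representative of the weak derivative of f in L^2(U) when there is
   one (it is unique up to a null set), and the zero function otherwise. *)
Definition wpartial U (i : 'I_d) f : X -> R :=
  xget (cst 0) [set g | L2 U g /\ weak_partial U i f g].

Definition H1 U f : Prop :=
  L2 U f /\ (forall i, exists g, L2 U g /\ weak_partial U i f g).

Definition H2 U f : Prop := H1 U f /\ (forall i, H1 U (wpartial U i f)).

Definition L2norm U f : R := Num.sqrt (\int[mu]_(x in U) (f x ^+ 2)).

Definition H1norm U f : R :=
  Num.sqrt (L2norm U f ^+ 2 + \sum_i L2norm U (wpartial U i f) ^+ 2).

Definition H10 U f : Prop :=
  H1 U f /\ (forall eps : R, 0 < eps ->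
    exists phi, test_function U phi /\ H1norm U (f - phi) < eps).

Definition L20 U q : Prop := L2 U q /\ \int[mu]_(x in U) q x = 0.

Definition vL2 U v : Prop := forall i, L2 U (vcomp v i).
Definition vH10 U v : Prop := forall i, H10 U (vcomp v i).
Definition vH2 U v : Prop := forall i, H2 U (vcomp v i).
Definition vH1norm U v : R := Num.sqrt (\sum_i H1norm U (vcomp v i) ^+ 2).

Definition ip U f g : R := \int[mu]_(x in U) (f x * g x).
Definition vip U v w : R := \int[mu]_(x in U) dot (v x) (w x).
Definition mip U (S T : X -> 'M[R]_d) : R := \int[mu]_(x in U) ddot (S x) (T x).

Definition grad U q : X -> X := fun x => \row_i wpartial U i q x.

(* (vgrad v) i j = d_j v_i *)
Definition vgrad U v : X -> 'M[R]_d :=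
  fun x => \matrix_(i, j) wpartial U j (vcomp v i) x.

Definition symgrad U v : X -> 'M[R]_d :=
  fun x => 2^-1 *: (vgrad U v x + (vgrad U v x)^T).

Definition div U v : X -> R := fun x => \tr (vgrad U v x).

Definition mdiv U (S : X -> 'M[R]_d) : X -> X :=
  fun x => \row_i \sum_j wpartial U j (fun y => S y i j) x.

(* (a . grad v)_i = sum_j a_j d_j v_i *)
Definition advect U a v : X -> X := fun x => a x *m (vgrad U v x)^T.

(* S is a finite-dimensional subspace of the function space Y, functions being
   identified when they agree almost everywhere on U. *)
Definition findim_subspace (W : lmodType R) U (Y S : set (X -> W)) : Prop :=
  exists (n : nat) (b : 'I_n -> X -> W),
    (forall k, Y (b k)) /\
    (forall z : X -> W, S z <-> Y z /\ exists c : 'I_n -> R,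
       {ae mu, forall x, U x -> z x = \sum_k c k *: b k x}).

Definition rational_on A f : Prop :=
  exists P Q : mpoly.mpoly d R, forall y, A y ->
    mpoly.meval (fun i => y 0 i) Q != 0 /\
    f y = mpoly.meval (fun i => y 0 i) P / mpoly.meval (fun i => y 0 i) Q.

End calculus.

(* A mesh: elements [elem e], each the image of a reference element [ref e]
   under a map [emap e] with inverse [einv e]. *)
Record mesh (R : realType) (d : nat) := Mesh {
  nel : nat;
  elem : 'I_nel -> set 'rV[R]_d;
  ref : 'I_nel -> set 'rV[R]_d;
  emap : 'I_nel -> 'rV[R]_d -> 'rV[R]_d;
  einv : 'I_nel -> 'rV[R]_d -> 'rV[R]_d }.

Section mesh_theory.
Context {R : realType} {d : nat}.
Local Notation X := 'rV[R]_d.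
Local Notation mu := (lebesgue_rV R d).
Implicit Types (Omega : set X) (M : mesh R d).

(* The element map is a diffeomorphism, smooth up to the boundary. *)
Definition element_map (K E : set X) (F G : X -> X) : Prop :=
  [/\ open K /\ compact (closure K),
      F @` K = E /\ F @` (closure K) = closure E,
      forall i, smooth_near (closure K) (vcomp F i),
      forall i, smooth_near (closure E) (vcomp G i) &
      forall y, closure K y -> G (F y) = y].

Definition mesh_of Omega M : Prop :=
  [/\ forall e : 'I_(nel M), [/\ open (elem e), elem e !=set0,
        compact (closure (elem e)) &
        mu.-negligible (closure (elem e) `\` elem e)],
      forall e : 'I_(nel M), element_map (ref e) (elem e) (emap e) (einv e),
      forall e e' : 'I_(nel M), e != e' -> elem e `&` elem e' = set0 &
      Omega = interior (\bigcup_(e in [set: 'I_(nel M)]) closure (elem e))].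

(* Mapped piecewise polynomials or rational functions: on each element the
   pull-back of the field to the reference element is rational, the pull-back
   being composition with the element map or, for velocities, the Piola
   transform v = (det DF)^-1 (DF) r o F^-1 and, for pressures, the
   integral-preserving transform q = (det DF)^-1 r o F^-1.  The identity map
   gives unmapped functions.  [jacobian F y] is the transpose of DF(y). *)
Definition mapped_pw_rational M (q : X -> R) : Prop :=
  forall e : 'I_(nel M), exists r : X -> R,
    rational_on (closure (ref e)) r /\
    ({ae mu, forall x, elem e x -> q x = r (einv e x)} \/
     {ae mu, forall x, elem e x ->
        q x = (\det (jacobian (emap e) (einv e x)))^-1 * r (einv e x)}).

Definition vmapped_pw_rational M (v : X -> X) : Prop :=
  forall e : 'I_(nel M), exists r : X -> X,
    (forall i, rational_on (closure (ref e)) (vcomp r i)) /\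
    ({ae mu, forall x, elem e x -> v x = r (einv e x)} \/
     {ae mu, forall x, elem e x ->
        v x = (\det (jacobian (emap e) (einv e x)))^-1 *:
              (r (einv e x) *m jacobian (emap e) (einv e x))}).

End mesh_theory.

Section oseen.
Context {R : realType} {d : nat}.
Local Notation X := 'rV[R]_d.
Local Notation mu := (lebesgue_rV R d).
Variables (Omega : set X) (nu : R) (a f : X -> X).

Definition c_form (b v1 v2 : X -> X) : R := vip Omega (advect Omega b v1) v2.

Definition k_form (v1 v2 : X -> X) : R :=
  \int[mu]_(x in Omega) (2 * nu * ddot (symgrad Omega v1 x) (symgrad Omega v2 x)).

Definition b_form (v : X -> X) (q : X -> R) : R := ip Omega (div Omega v) q.

Definition oseen_solution (u : X -> X) (p : X -> R) : Prop :=
  [/\ vH10 Omega u, L20 Omega p &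
      forall v q, vH10 Omega v -> L20 Omega q ->
        c_form a u v + k_form u v - b_form v p + b_form u q = vip Omega f v].

(* For one fixed pair of spaces: the constant beta depends on the pair.  The
   supremum is extended-real valued, so that it is defined without further
   argument. *)
Definition inf_sup_stable (Vh : set (X -> X)) (Qh : set (X -> R)) : Prop :=
  exists2 beta : R, 0 < beta & forall q, Qh q -> 0 < L2norm Omega q ->
    ((beta * L2norm Omega q)%R%:E <=
     ereal_sup [set (b_form v q / vH1norm Omega v)%R%:E
                | v in [set v | Vh v /\ (0 < vH1norm Omega v)%R]])%E.

Definition div_free_subspace (Vh : set (X -> X)) (Qh : set (X -> R)) :
  set (X -> X) := [set v | Vh v /\ forall q, Qh q -> b_form v q = 0].

Definition sum_space (Q1 Q2 : set (X -> R)) : set (X -> R) :=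
  [set q1 + q2 | q1 in Q1 & q2 in Q2].

Variables (M : mesh R d) (tauC tauM : X -> R).

(* The restriction to the element interior of div (2 nu symgrad v). *)
Definition visc (e : 'I_(nel M)) (v : X -> X) : X -> X :=
  mdiv (elem e) (fun x => (2 * nu) *: symgrad Omega v x).

Definition streamline (v : X -> X) (q : X -> R) : X -> X :=
  fun x => advect Omega a v x + grad Omega q x.

Definition A_red (w : X -> X) (r : X -> R) (v : X -> X) (q : X -> R) : R :=
  c_form a w v + k_form w v
  + ip Omega (fun x => tauC x * div Omega w x) (div Omega v)
  + \sum_(e < nel M) vip (elem e)
      (fun x => advect Omega a w x - visc e w x + grad Omega r x)
      (fun x => tauM x *: streamline v q x).

Definition reduced_solution (Vh0 : set (X -> X)) (Qt : set (X -> R))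
    (uh : X -> X) (pt : X -> R) : Prop :=
  [/\ Vh0 uh, Qt pt &
      forall v q, Vh0 v -> Qt q ->
        A_red uh pt v q =
        vip Omega f v + vip Omega f (fun x => tauM x *: streamline v q x)].

(* The norms are extended-real valued, since the integrals of nonnegative
   functions in them need not be finite (tauM may tend to 0). *)
Local Open Scope ereal_scope.

Definition energy_norm2 (v : X -> X) (q : X -> R) : \bar R :=
  (k_form v v)%:E +
  \int[mu]_(x in Omega) (tauM x * dot (streamline v q x) (streamline v q x))%:E.

Definition energy_norm v q : \bar R := sqrte (energy_norm2 v q).

Definition energy_norm_plus (v : X -> X) (q : X -> R) : \bar R :=
  sqrte (energy_norm2 v q
    + \sum_(e < nel M) \int[mu]_(x in elem e)
        (tauM x * dot (visc e v x) (visc e v x))%:E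
    + \int[mu]_(x in Omega) ((tauM x)^-1 * dot (v x) (v x))%:E).

End oseen.

(* Main.v *)
Require Import Defs.
From HB Require Import structures.
From mathcomp Require Import all_boot all_order all_algebra.
From mathcomp Require Import all_classical all_reals all_analysis.
From mathcomp.multinomials Require mpoly.
From mathcomp Require Import measurable_realfun.
From mathcomp Require Import ring lra.
Set Implicit Arguments.
Unset Strict Implicit.
Unset Printing Implicit Defensive.
Import Order.TTheory GRing.Theory Num.Theory.
Import numFieldNormedType.Exports.
Local Open Scope classical_set_scope.
Local Open Scope ring_scope.

(* Since u is in H^2 and p in H^1, the Oseen equations hold almost everywhere, so
   that the stabilization terms are consistent and the error (u - uh, p - pt) is
   A_red-orthogonal to the divergence-free discrete velocities and the discrete
   pressures.  Split the error as eta + xi, with xi = (v, q) discrete.  As v is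
   bounded with bounded gradient (it is mapped rational on each element) and a is
   divergence free in H^1_0, the convective form is skew: c(a, v, v) = 0, and
   c(a, eta, v) = - (a . grad v + grad q, eta), where grad q comes for free because
   div eta = 0.  The inverse estimate and tauM <= h^2 / (Cinv nu) give
   |tauM^(1/2) div (2 nu symgrad v)|^2 <= k(v, v) / 2, which absorbs the viscous
   part of the residual.  Young's inequality then yields
   |||xi|||^2 <= 12 |||eta|||_+^2, hence |||error|||^2 <= 26 |||eta|||_+^2, and
   26 <= 7^2. *)


(** * Lebesgue measure on row vectors *)

Section boxes.
Context {R : realType} {n : nat}.
Local Notation X := 'rV[R]_n.
Local Notation mu := (lebesgue_rV R n).
Implicit Types (a b c : 'I_n -> R) (r : R) (U A : set X).

(** The advection field is only in H^1_0, so for a general w in H^1 the field a . grad w is merely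
    integrable, and c(a, w, v) need not be a convergent integral. This shapes the argument.
    Skew-symmetry is proved against bounded v with bounded gradient only, and the factor
    approximated by test functions is a itself: the product v eta is then square integrable with
    square integrable gradient, whereas a eta need not be. For the exact solution, a . grad u is
    square integrable because the strong equation expresses it through f, the viscous term and grad
    p. Weak derivatives are chosen representatives, hence linear almost everywhere only, and every
    splitting of an integral needs its own integrability; [regular_pair] collects what makes both
    possible. Nothing bounds tauM away from zero, so tauM^-1 |eta|^2 may fail to be integrable; the
    right-hand side is then infinite, and the real-valued estimate is needed only in the other
    case. *)

Definition box a b : set X := [set x | forall i, x 0 i \in `]a i, b i]].

Lemma boxI a b a' b' :
  box a b `&` box a' b' =
  box (fun i => Num.max (a i) (a' i)) (fun i => Num.min (b i) (b' i)).
Proof.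
apply/seteqP; split => [x [h h'] i|x h].
  have := h i; have := h' i; rewrite !in_itv/= => /andP[h1 h2] /andP[h3 h4].
  by rewrite gt_max le_min h1 h2 h3 h4.
by split => i; have := h i; rewrite !in_itv/= gt_max le_min =>
  /andP[/andP[h1 h2] /andP[h3 h4]]; apply/andP.
Qed.

Lemma measure_box_lty a b : (mu (box a b) < +oo)%E.
Proof.
have [ab|/existsNP[i /negP abi]] := pselect (forall i, a i <= b i).
  by rewrite lebesgue_rV_box // ltry.
rewrite (_ : box a b = set0) ?measure0 ?ltry//.
apply/seteqP; split => // x /(_ i); rewrite in_itv/= => /andP[h1 h2].
by move: abi; rewrite (ltW (lt_le_trans h1 h2)).
Qed.

Lemma mx_norm_leP (x : X) r : 0 <= r -> `|x| <= r <-> forall i, `|x 0 i| <= r.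
Proof.
move=> r0; rewrite [in X in X <-> _]/Num.Def.normr/= mx_normrE; split.
  by move=> h i; apply: le_trans h; exact: (le_bigmax _ (fun j => `|x j.1 j.2|) (0, i)).
by move=> h; apply: bigmax_le => // -[i j] _; rewrite ord1.
Qed.

Lemma ler_norm_coord (x : X) i : `|x 0 i| <= `|x|.
Proof. by have [+ _] := mx_norm_leP x (normr_ge0 x); exact. Qed.

Lemma bounded_set_box A : bounded_set A ->
  exists2 M : R, 0 < M & A `<=` box (fun=> - M) (fun=> M).
Proof.
move=> [M [_ h]]; exists (`|M| + 2) => [|x Ax i].
  by rewrite (lt_le_trans (ltr0n _ 2))// lerDr.
have {h Ax}: `|x| <= `|M| + 1.
  by apply: h => //; rewrite (le_lt_trans (ler_norm M))// ltrDl.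
move=> /(le_trans (ler_norm_coord x i)).
rewrite ler_norml in_itv/= => /andP[h1 h2]; apply/andP; split; lra.
Qed.

Lemma bounded_measure_lty A : measurable A -> bounded_set A -> (mu A < +oo)%E.
Proof.
move=> mA /bounded_set_box[M _ AM].
by rewrite (le_lt_trans _ (measure_box_lty (fun=> - M) (fun=> M)))// le_measure ?inE//;
  exact: measurable_box.
Qed.

Definition cube (c : 'I_n -> R) r := box (fun i => c i - r) (fun i => c i + r).
Definition ccube (c : 'I_n -> R) r : set X := [set x | forall i, `|x 0 i - c i| <= r].

(** Rational centres and radii 1/(m+1) make the family of cubes countable. The closed cube of
    doubled radius is required to stay in U so that a cut-off of the small cube has compact support
    in U. With r < e / 3, a point of the doubled cube is within 2 r of a centre that is itself
    within r of x. *)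
Lemma open_cube U x : open U -> U x ->
  exists (c : {ffun 'I_n -> rat}) (m : nat),
    cube (fun i => ratr (c i)) m.+1%:R^-1 x /\
    ccube (fun i => ratr (c i)) (m.+1%:R^-1 + m.+1%:R^-1) `<=` U.
Proof.
move=> oU Ux; have /nbhs_ballP[e /= e0 xU] : nbhs x U by exact: open_nbhs_nbhs.
have [m hm] : exists m : nat, m.+1%:R^-1 < e / 3.
  have e3 : 0 < e / 3 by rewrite divr_gt0.
  exists (Num.truncn (e / 3)^-1).
  by rewrite invf_plt ?posrE ?ltr0n// truncnS_gt.
set r := m.+1%:R^-1 in hm *; have r0 : 0 < r by rewrite invr_gt0 ltr0n.
have /choice[c hc] : forall i : 'I_n, exists q : rat, ratr q \in `]x 0 i - r, x 0 i + r[.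
  move=> i; have : x 0 i - r < x 0 i + r by lra.
  by move=> /rat_in_itvoo[q hq]; exists q.
exists [ffun i => c i], m; rewrite -/r; split => [i|y hy].
  by have := hc i; rewrite ffunE !in_itv/= => /andP[h1 h2]; apply/andP; split; lra.
apply: xU; rewrite mx_norm_ball /ball_/= distrC.
apply: (@le_lt_trans _ _ (3 * r)); last by lra.
apply/mx_norm_leP => [|i]; first by lra.
have := hy i; have := hc i; rewrite ffunE !mxE in_itv/= !ler_norml.
by move=> /andP[h1 h2] /andP[h3 h4]; apply/andP; split; lra.
Qed.

Lemma cube_sub_ccube c r r' : r <= r' -> cube c r `<=` ccube c r'.
Proof.
move=> r0 x h i; have := h i; rewrite in_itv/= ler_norml => /andP[h1 h2].
by apply/andP; split; lra.
Qed.

Lemma open_bigcup_cube U : open U ->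
  U = \bigcup_(k in [set k : {ffun 'I_n -> rat} * nat |
      ccube (fun i => ratr (k.1 i)) (k.2.+1%:R^-1 + k.2.+1%:R^-1) `<=` U])
    cube (fun i => ratr (k.1 i)) k.2.+1%:R^-1.
Proof.
move=> oU; apply/seteqP; split => [x /(open_cube oU)[c [m [h1 h2]]]|x [k /= kU]].
  by exists (c, m).
move=> /(cube_sub_ccube (r' := k.2.+1%:R^-1 + k.2.+1%:R^-1)) h; apply: kU; apply: h.
by rewrite lerDl invr_ge0 ler0n.
Qed.

Lemma open_measurable_rV U : open U -> measurable U.
Proof.
move=> /open_bigcup_cube ->; rewrite bigcup_mkcond.
apply: countable_bigcupT_measurable => // k; case: ifP => // _.
exact: measurable_box.
Qed.

Lemma continuous_measurable_rV U (f : X -> R) : open U ->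
  (forall x, U x -> {for x, continuous f}) -> measurable_fun U f.
Proof.
move=> oU cf; apply: (measurability _ (RGenOpens.measurableE R)).
move=> _ [_ [p [q ->] <-]]; apply: open_measurable_rV.
rewrite openE => x [Ux fx]; rewrite /interior; apply: filterI; first exact: open_nbhs_nbhs.
by apply: cf => //; exact: open_nbhs_nbhs (conj (interval_open _ _) fx).
Qed.

End boxes.

(** * Half-open boxes as a generating pi-system; translation invariance *)

Section box_sigma.
Context {R : realType} {n : nat}.
Local Notation X := 'rV[R]_n.
Local Notation mu := (lebesgue_rV R n).

Definition boxes : set (set X) := [set A | exists a b, A = box a b].

Lemma boxes_sigma_coord i (B : set (measurableTypeR R)) : measurable B ->
  <<s boxes >> (@rV_coord R n i @^-1` B).
Proof.
move=> mB; pose T := g_sigma_algebraType boxes.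
suff h : measurable_fun (setT : set T) (@rV_coord R n i).
  by rewrite -[X in <<s _ >> X]setTI; exact: h.
apply: (@measurability _ _ T _ setT (@rV_coord R n i) (@ocitv R) erefl).
move=> _ [_ [[p q] /= _ <-] <-].
(* A slab in one coordinate is exhausted by boxes whose other sides are ]-k, k]. *)
rewrite (_ : _ `&` _ = \bigcup_(k in [set: nat])
    box (fun j => if j == i then p else - k%:R) (fun j => if j == i then q else k%:R) :> set X).
  apply: bigcup_measurable => k _; apply: sub_sigma_algebra.
  by eexists; eexists; reflexivity.
rewrite setTI; apply/seteqP; split => x.
  rewrite /preimage/= in_itv/= => xpq; exists (Num.truncn `|x|).+1 => // j.
  case: eqP => [->|_]; first by rewrite in_itv.
  have : `|x 0 j| < (Num.truncn `|x|).+1%:R.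
    by rewrite (le_lt_trans (ler_norm_coord x j))// truncnS_gt.
  by rewrite ltr_norml in_itv/= => /andP[-> /ltW ->].
by move=> [k _ /(_ i)]; rewrite eqxx.
Qed.

Lemma measurable_boxesE : @measurable _ X = <<s boxes >>.
Proof.
apply/seteqP; split; last first.
  apply: smallest_sub; first exact: sigma_algebra_measurable.
  by move=> _ [a [b ->]]; exact: measurable_box.
apply: smallest_sub; first exact: smallest_sigma_algebra.
move=> A; rewrite -bigcup_seq => -[i /= _ [B mB <-]].
by rewrite setTI; exact: boxes_sigma_coord.
Qed.

Lemma boxes_setI : setI_closed boxes.
Proof. by move=> _ _ [a [b ->]] [a' [b' ->]]; rewrite boxI; eexists; eexists. Qed.

Definition bigbox (k : nat) : set X := box (fun=> - k%:R) (fun=> k%:R).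

Lemma bigcup_bigbox : \bigcup_k bigbox k = setT.
Proof.
apply/seteqP; split => // x _; exists (Num.truncn `|x|).+1 => // j.
have : `|x 0 j| < (Num.truncn `|x|).+1%:R.
  by rewrite (le_lt_trans (ler_norm_coord x j))// truncnS_gt.
by rewrite ltr_norml in_itv/= => /andP[-> /ltW ->].
Qed.

Lemma measure_boxes_unique (m : {measure set X -> \bar R}) :
  (forall a b, m (box a b) = mu (box a b)) ->
  forall A, measurable A -> m A = mu A.
Proof.
move=> h A; rewrite measurable_boxesE => mA.
apply: (@g_sigma_algebra_measure_unique _ R X boxes _ bigbox _ _ m mu) => //.
- by move=> _ [a [b ->]]; exact: measurable_box.
- by move=> k; eexists; eexists; reflexivity.
- exact: bigcup_bigbox.
- exact: boxes_setI.
- by move=> _ [a [b ->]].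
- by move=> k; rewrite h; exact: measure_box_lty.
Qed.

Lemma box_emptyP (a b : 'I_n -> R) : ~ (forall i, a i <= b i) -> box a b = set0.
Proof.
move=> /existsNP[i /negP abi]; apply/seteqP; split => // x /(_ i).
by rewrite in_itv/= => /andP[h1 h2]; move: abi; rewrite (ltW (lt_le_trans h1 h2)).
Qed.

Lemma measurable_translation (v : X) : measurable_fun setT (fun x : X => x + v).
Proof.
apply: measurable_fun_rVP => i.
rewrite (_ : _ \o _ = (fun x => @rV_coord R n i x + v 0 i)).
  apply: measurable_funD; [exact: measurable_rV_coord|exact: measurable_cst].
by apply/funext => x; rewrite /rV_coord/= mxE.
Qed.

Lemma lebesgue_rV_translation (v : X) A : measurable A ->
  mu ((fun x => x + v) @^-1` A) = mu A.
Proof.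
have mt := measurable_translation v.
pose m := measure_function_pushforward__canonical__measure_function_Measure mu mt.
apply: (@measure_boxes_unique m) => a b.
rewrite [LHS](_ : _ = mu (box (fun i => a i - v 0 i) (fun i => b i - v 0 i))); last first.
  congr (mu _); apply/seteqP; split => x h i; have := h i;
    by rewrite !in_itv/= ?mxE ltrBlDr lerBrDr.
have [ab|ab] := pselect (forall i, a i <= b i); last first.
  rewrite (box_emptyP ab) box_emptyP// => ab'; apply: ab => i.
  by have := ab' i; rewrite lerD2r.
rewrite !lebesgue_rV_box// => [|i]; last by rewrite lerD2r.
by congr EFin; apply: eq_bigr => i _; rewrite opprB addrA subrK.
Qed.

(** Difference quotients of a test function integrate to zero by this invariance, which is how
    integration by parts starts. The nonnegative case is a pushforward; the general one treats the
    positive and negative parts separately. *)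
Lemma integral_translation (v : X) (f : X -> \bar R) :
  mu.-integrable setT f -> (\int[mu]_x f (x + v)%R = \int[mu]_x f x)%E.
Proof.
move=> /integrableP[mf if_].
have mt := measurable_translation v.
have E (g : X -> \bar R) : measurable_fun setT g -> (forall x, 0 <= g x)%E ->
    (\int[mu]_x g (x + v)%R = \int[mu]_x g x)%E.
  move=> mg g0; transitivity (\int[pushforward mu (fun x : X => (x + v)%R)]_x g x)%E.
    by rewrite ge0_integral_pushforward.
  apply: eq_measure_integral => A mA _; exact: lebesgue_rV_translation.
rewrite integralE [RHS]integralE; congr (_ - _)%E.
  by rewrite -(E _ (measurable_funepos mf) (funepos_ge0 f)); apply: eq_integral => x _;
    rewrite !funeposE.
by rewrite -(E _ (measurable_funeneg mf) (funeneg_ge0 f)); apply: eq_integral => x _;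
    rewrite !funenegE.
Qed.

(** The sets E on which g has zero integral over [box a0 b0] meet E form a Dynkin system. It
    contains the boxes, which are closed under intersection and generate, so it contains every
    measurable set. *)
Lemma integral_boxes_eq0 (a0 b0 : 'I_n -> R) (g : X -> R) :
  mu.-integrable (box a0 b0) (EFin \o g) ->
  (forall a b, (\int[mu]_(x in box a0 b0 `&` box a b) (g x)%:E = 0)%E) ->
  {ae mu, forall x, box a0 b0 x -> g x = 0}.
Proof.
move=> ig h; have mB := @measurable_box R n a0 b0.
suff /(integral_ae_eq mB ig) H : forall E, E `<=` box a0 b0 -> measurable E ->
    (\int[mu]_(x in E) (EFin \o g) x = \int[mu]_(x in E) cst 0%E x)%E.
  by apply: filterS (H (measurable_cst _)) => x /[apply]/= -[].
move=> E EB mE; rewrite integral_cst// mul0e.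
rewrite -(setIidr EB).
have {EB mE} : <<s boxes >> E by rewrite -measurable_boxesE.
have iS A : measurable A -> mu.-integrable (box a0 b0 `&` A) (EFin \o g).
  by move=> mA; apply: integrableS ig => //; exact: measurableI.
apply: (@dynkin_induction _ X boxes
  (fun E => \int[mu]_(x in box a0 b0 `&` E) (g x)%:E = 0)%E).
- exact: measurable_boxesE.
- exact: boxes_setI.
- by have := h a0 b0; rewrite setIid setIT.
- by move=> _ [a [b ->]].
- move=> S mS hS.
  have hB : (\int[mu]_(x in box a0 b0) (g x)%:E = 0)%E by have := h a0 b0; rewrite setIid.
  move: hB; rewrite -{1}(setIT (box a0 b0)) -(setUv S) setIUr integral_setU_EFin//; last 4 first.
  + exact: measurableI.
  + by apply: measurableI => //; exact: measurableC.
  + rewrite -setIUr setUv setIT; apply/measurable_EFinP; exact: measurable_int ig.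
  + by apply/disj_setPS => x [[_ Sx] [_]].
  by rewrite hS add0e.
- move=> F mF tF hF; rewrite setI_bigcupr integral_bigcup//.
  + by apply: eseries0 => k _ _; exact: hF.
  + exact: trivIset_setIl.
  + by move=> k; exact: measurableI.
  + by rewrite -setI_bigcupr; apply: iS; exact: bigcupT_measurable.
Qed.

End box_sigma.

(** * Smooth functions and test functions *)

Section flat.
Context {R : realType}.
Implicit Types (t : R) (k : nat).

(* The family t^-k exp(-1/t) is closed under differentiation up to linear
   combinations, and supplies all the cut-off functions below. *)
Definition flat k t : R := if 0 < t then t^-1 ^+ k * expR (- t^-1) else 0.

Lemma flat_ge0 k t : 0 <= flat k t.
Proof.
rewrite /flat; case: ifP => // t0.
by rewrite mulr_ge0 ?expR_ge0// exprn_ge0// invr_ge0 ltW.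
Qed.

Lemma flat_le0 k t : t <= 0 -> flat k t = 0.
Proof. by rewrite /flat ltNge => ->. Qed.

(** At y = 1/t this is exp(y) >= y^(k+2) / (k+2)!. The power of t is 2 so that the difference
    quotient at 0 still tends to 0. *)
Lemma flat_le k t : flat k t <= (k.+2)`!%:R * t ^+ 2.
Proof.
rewrite /flat; case: ifPn => t0; last by rewrite mulr_ge0// sqr_ge0.
have y0 : 0 < t^-1 by rewrite invr_gt0.
have f0 : (0 : R) < (k.+2)`!%:R by rewrite ltr0n fact_gt0.
have : t^-1 ^+ k.+2 / (k.+2)`!%:R <= expR t^-1.
  by rewrite (le_trans _ (expR_ge1Dxn k.+1 (ltW y0)))// lerDr.
rewrite ler_pdivrMr// expRN -ler_pdivrMl ?expR_gt0// mulrC => h.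
have -> : t^-1 ^+ k = t ^+ 2 * t^-1 ^+ k.+2.
  have tn0 : t != 0 by rewrite gt_eqF.
  by rewrite -(addn2 k) exprD !exprVn mulrC -mulrA mulVf ?mulr1// expf_neq0.
by rewrite -mulrA mulrC ler_wpM2r ?sqr_ge0.
Qed.

Lemma is_derive_flat k t :
  is_derive t 1 (flat k) (flat k.+2 t - k%:R * flat k.+1 t).
Proof.
have [t0|t0|->] := ltgtP t 0.
- rewrite !flat_le0 ?ltW// mulr0 subr0.
  apply: (@near_eq_is_derive _ _ _ (cst 0)).
  near=> y; rewrite flat_le0//; apply: ltW; near: y; exact: lt_nbhsl.
- pose g y := y^-1 ^+ k * expR (- y^-1) : R.
  apply: (@near_eq_is_derive _ _ _ g).
    near=> y; rewrite /g /flat ifT//; near: y; exact: lt_nbhsr.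
  have tn0 : t != 0 by rewrite gt_eqF.
  have dV : is_derive t 1 (fun y : R => y^-1) (- t ^- 2).
    by apply: is_derive_eq; first exact: (is_deriveV tn0); rewrite [_ *: _]mulr1.
  have dE : is_derive t 1 (expR \o (fun y : R => - y^-1)) (expR (- t^-1) * - - t ^- 2).
    by apply: is_derive1_comp.
  rewrite /flat t0.
  have -> : g = (GRing.inv ^+ k) * (expR \o (fun y : R => - y^-1)).
    by apply/funext => y; rewrite /g exprfctE.
  apply: is_derive_eq; rewrite exprfctE /GRing.scale/= opprK.
  case: k {g} => [|k]; first by rewrite expr0; field.
  by rewrite [in LHS]/= !(exprS t^-1) -exprVn expr2; ring.
(* At the origin the quotient is bounded by (k+2)! |h|, thanks to [flat_le]. *)
- rewrite !flat_le0// mulr0 subr0.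
  have cv : (fun h => h^-1 *: ((flat k \o shift 0) (h *: (1:R)) - flat k 0)) @ 0^' --> (0:R).
    apply/cvgrPdist_le => e e0.
    have C0 : (0 : R) < (k.+2)`!%:R by rewrite ltr0n fact_gt0.
    near=> h; rewrite /= addr0 [_%:A]mulr1 (@flat_le0 k 0)// subr0 sub0r normrN normrM.
    have hn0 : h != 0 by near: h; exact: nbhs_dnbhs_neq.
    rewrite (ger0_norm (flat_ge0 _ _)) normfV ler_pdivrMl ?normr_gt0//.
    rewrite (le_trans (flat_le _ _))// -[h ^+ 2]real_normK ?num_real// expr2 mulrCA.
    rewrite ler_wpM2l// -ler_pdivlMl// mulrC.
    have : `|h| < e / (k.+2)`!%:R; last exact: ltW.
    by near: h; apply: dnbhs0_lt; rewrite divr_gt0.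
  by split; [apply/cvg_ex; exists 0|exact/cvg_lim].
Unshelve. all: by end_near. Qed.

Lemma continuous_flat k : continuous (flat k).
Proof.
move=> t; apply: differentiable_continuous; apply/derivable1_diffP.
by case: (is_derive_flat k t).
Qed.

End flat.

Section smooth.
Context {R : realType} {n : nat}.
Local Notation X := 'rV[R]_n.
Implicit Types (U V A : set X) (f g : X -> R) (i j : 'I_n).

Lemma is_derive_comp1 (h : R -> R) (l : X -> R) (x v : X) (dh dl : R) :
  is_derive (l x) 1 h dh -> differentiable l x -> is_derive x v l dl ->
  is_derive x v (h \o l) (dh * dl).
Proof.
move=> [ex1 <-] dl1 [ex2 <-].
have dh1 : differentiable h (l x) := (derivable1_diffP h (l x)).1 ex1.
split; first by apply: diff_derivable; exact: differentiable_comp.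
rewrite deriveE; last exact: differentiable_comp.
rewrite diff_comp// /= diff1E// derive1E.
rewrite (deriveE _ dl1) mulrC.
by [].
Qed.

(* Closed under partial derivatives, hence made of smooth functions. *)
Inductive smooth_gen U : (X -> R) -> Prop :=
| Sg_smooth f : smooth_on U f -> smooth_gen U f
| Sg_flat k c e i : smooth_gen U (fun x => flat k (c * x 0 i + e))
| Sg_cst c : smooth_gen U (fun=> c)
| Sg_coord i : smooth_gen U (fun x => x 0 i)
| Sg_add f g : smooth_gen U f -> smooth_gen U g -> smooth_gen U (fun x => f x + g x)
| Sg_mul f g : smooth_gen U f -> smooth_gen U g -> smooth_gen U (fun x => f x * g x)
| Sg_inv f : smooth_gen U f -> (forall x, U x -> f x != 0) ->
    smooth_gen U (fun x => (f x)^-1).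

Lemma differentiable_affine_coord (c e : R) i (x : X) :
  differentiable (fun y : X => c * y 0 i + e) x.
Proof.
apply: differentiableD => //; apply: differentiableM => //.
exact: differentiable_coord.
Qed.

Lemma is_derive_coord i (x v : X) : is_derive x v (fun y : X => y 0 i) (v 0 i).
Proof.
split; first by apply/diff_derivable/differentiable_coord.
have dx : derivable (id : X -> X) x v by exact: derivable_id.
by have := derive_mx dx; rewrite derive_id => /matrixP/(_ 0 i); rewrite mxE => ->.
Qed.

Lemma smooth_on_cpartial U f i : smooth_on U f -> smooth_on U (cpartial i f).
Proof.
move=> sf s x Ux; have := sf (rcons s i) x Ux.
by rewrite foldr_rcons.
Qed.

Lemma smooth_gen_step U f : smooth_gen U f ->
  (forall x, U x -> {for x, continuous f} /\
    forall i, derivable f x (basis_vec i)) /\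
  forall i, exists2 g, smooth_gen U g & forall x, U x -> cpartial i f x = g x.
Proof.
elim=> {f} [f sf|k c e i|c|i|f g sf [f1 f2] sg [g1 g2]|f g sf [f1 f2] sg [g1 g2]|f sf [f1 f2] fn0].
- split; first by move=> x Ux; exact: (sf [::] x Ux).
  by move=> i; exists (cpartial i f) => //; constructor; exact: smooth_on_cpartial.
- have dl x v : is_derive x v (fun y : X => c * y 0 i + e) (c * v 0 i).
    have := is_derive_coord i x v => h.
    by apply: is_derive_eq; rewrite /GRing.scale/=; ring.
  have df x v : is_derive x v (flat k \o (fun y : X => c * y 0 i + e))
      ((flat k.+2 (c * x 0 i + e) - k%:R * flat k.+1 (c * x 0 i + e)) * (c * v 0 i)).
    apply: is_derive_comp1 => //; first exact: is_derive_flat.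
    exact: differentiable_affine_coord.
  split.
    move=> x Ux; split; last by move=> j; case: (df x (basis_vec j)).
    apply: continuous_comp; last exact: continuous_flat.
    by apply: differentiable_continuous; exact: differentiable_affine_coord.
  move=> j; exists (fun x => (flat k.+2 (c * x 0 i + e) + - k%:R * flat k.+1 (c * x 0 i + e)) *
      (c * basis_vec j 0 i)).
    by apply: Sg_mul; [apply: Sg_add; [exact: Sg_flat|
      apply: Sg_mul; [exact: Sg_cst|exact: Sg_flat]]|exact: Sg_cst].
  by move=> x Ux; rewrite /cpartial; case: (df x (basis_vec j)) => _ ->; rewrite mulNr.
- split; first by move=> x Ux; split=> [|i]; [exact: (@cst_continuous _ _ c)|
    exact: (@derivable_cst _ _ _ c)].
  by move=> i; exists (fun=> 0); [constructor|move=> x Ux; exact: (@derive_cst _ _ _ c)].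
- split.
    move=> x Ux; split=> [|j]; first exact: coord_continuous.
    by case: (is_derive_coord i x (basis_vec j)).
  move=> j; exists (fun=> basis_vec j 0 i); first by constructor.
  by move=> x Ux; case: (is_derive_coord i x (basis_vec j)).
- split.
    move=> x Ux; have [cf df] := f1 x Ux; have [cg dg] := g1 x Ux.
    by split=> [|j]; [exact: (continuousD cf cg)|exact: (derivableD (df j) (dg j))].
  move=> i; have [f' sf' Ef] := f2 i; have [g' sg' Eg] := g2 i.
  exists (fun x => f' x + g' x); first by constructor.
  move=> x Ux; have [_ df] := f1 x Ux; have [_ dg] := g1 x Ux.
  by rewrite -Ef// -Eg//; exact: (deriveD (df i) (dg i)).
- split.
    move=> x Ux; have [cf df] := f1 x Ux; have [cg dg] := g1 x Ux.
    by split=> [|j]; [exact: (continuousM cf cg)|exact: (derivableM (df j) (dg j))].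
  move=> i; have [f' sf' Ef] := f2 i; have [g' sg' Eg] := g2 i.
  exists (fun x => f x * g' x + g x * f' x); first by do 2 constructor.
  move=> x Ux; have [_ df] := f1 x Ux; have [_ dg] := g1 x Ux.
  by rewrite -Ef// -Eg//; exact: (deriveM (df i) (dg i)).
- split.
    move=> x Ux; have [cf df] := f1 x Ux.
    split=> [|j]; first by exact: (continuousV (fn0 _ Ux) cf).
    by apply: (derivableV _ (df j)); exact: fn0.
  move=> i; have [f' sf' Ef] := f2 i.
  exists (fun x => (-1) * (((f x)^-1 * (f x)^-1) * f' x)).
    by constructor; [constructor|constructor => //; constructor; exact: Sg_inv].
  move=> x Ux; have [_ df] := f1 x Ux.
  rewrite -Ef// /cpartial (deriveV _ (df i)); last exact: fn0.
  by rewrite mulN1r /GRing.scale/= expr2 invfM mulNr.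
Qed.

(** By induction on the list of directions, every iterated partial derivative agrees on U with a
    function of [smooth_gen]. The agreement can be differentiated again because U is open. *)
Lemma smooth_on_gen U f : open U -> smooth_gen U f -> smooth_on U f.
Proof.
move=> oU sf s.
have [g sg E] : exists2 g, smooth_gen U g & forall x, U x -> foldr cpartial f s x = g x.
  elim: s => [|i s [g sg E]]; first by exists f.
  have [g' sg' E'] := (smooth_gen_step sg).2 i.
  exists g' => // x Ux; rewrite /= -E'// /cpartial; apply: near_eq_derive.
  by near=> y; apply: E; near: y; exact: open_nbhs_nbhs.
move=> x Ux; have [cg dg] := (smooth_gen_step sg).1 x Ux.
have nE : {near x, g =1 foldr cpartial f s}.
  by near=> y; rewrite E//; near: y; exact: open_nbhs_nbhs.
split; last by move=> i; exact: near_eq_derivable nE (dg i).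
rewrite /prop_for /continuous_at E//; apply: cvg_trans cg.
apply: (@near_eq_cvg _ _ (nbhs x) _); exact: nE.
Unshelve. all: by end_near. Qed.

End smooth.

Section smooth_closure.
Context {R : realType} {n : nat}.
Local Notation X := 'rV[R]_n.
Implicit Types (U V A : set X) (f g : X -> R) (i j : 'I_n).

Lemma smooth_on_cst U c : open U -> smooth_on U (fun=> c).
Proof. by move=> oU; apply: smooth_on_gen => //; constructor. Qed.

Lemma smooth_on_coord U i : open U -> smooth_on U (fun x => x 0 i).
Proof. by move=> oU; apply: smooth_on_gen => //; constructor. Qed.

Lemma smooth_onD U f g : open U -> smooth_on U f -> smooth_on U g ->
  smooth_on U (fun x => f x + g x).
Proof. by move=> oU sf sg; apply: smooth_on_gen => //; apply: Sg_add; exact: Sg_smooth. Qed.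

Lemma smooth_onM U f g : open U -> smooth_on U f -> smooth_on U g ->
  smooth_on U (fun x => f x * g x).
Proof. by move=> oU sf sg; apply: smooth_on_gen => //; apply: Sg_mul; exact: Sg_smooth. Qed.

Lemma smooth_onV U f : open U -> smooth_on U f -> (forall x, U x -> f x != 0) ->
  smooth_on U (fun x => (f x)^-1).
Proof. by move=> oU sf f0; apply: smooth_on_gen => //; apply: Sg_inv => //; exact: Sg_smooth. Qed.

Lemma smooth_onZ U f c : open U -> smooth_on U f -> smooth_on U (fun x => c * f x).
Proof. by move=> oU sf; apply: smooth_onM => //; exact: smooth_on_cst. Qed.

Lemma smooth_on_sum (I : Type) (r : seq I) (P : pred I) U (F : I -> X -> R) : open U ->
  (forall k, P k -> smooth_on U (F k)) -> smooth_on U (fun x => \sum_(k <- r | P k) F k x).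
Proof.
move=> oU sF; have -> : (fun x => \sum_(k <- r | P k) F k x) = \sum_(k <- r | P k) F k.
  by apply/funext => x; rewrite fct_sumE.
by elim/big_ind : _ => [|f g sf sg|//]; [exact: smooth_on_cst|exact: smooth_onD].
Qed.

Lemma smooth_on_prod (I : Type) (r : seq I) (P : pred I) U (F : I -> X -> R) : open U ->
  (forall k, P k -> smooth_on U (F k)) -> smooth_on U (fun x => \prod_(k <- r | P k) F k x).
Proof.
move=> oU sF; have -> : (fun x => \prod_(k <- r | P k) F k x) = \prod_(k <- r | P k) F k.
  by apply/funext => x; rewrite fct_prodE.
by elim/big_ind : _ => [|f g sf sg|//]; [exact: smooth_on_cst|exact: smooth_onM].
Qed.

Lemma smooth_onX U f k : open U -> smooth_on U f -> smooth_on U (fun x => f x ^+ k).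
Proof.
move=> oU sf; elim: k => [|k IH]; first exact: smooth_on_cst.
have -> : (fun x => f x ^+ k.+1) = (fun x => f x * f x ^+ k).
  by apply/funext => x; rewrite exprS.
exact: smooth_onM.
Qed.

Lemma smooth_onS U V f : V `<=` U -> smooth_on U f -> smooth_on V f.
Proof. by move=> VU sf s x /VU; exact: sf. Qed.

Lemma smooth_onU U V f : smooth_on U f -> smooth_on V f -> smooth_on (U `|` V) f.
Proof. by move=> sU sV s x [/sU|/sV]; exact. Qed.

Lemma eq_cpartial U f g i x : open U -> (forall x, U x -> f x = g x) -> U x ->
  cpartial i f x = cpartial i g x.
Proof.
move=> oU E Ux; apply: near_eq_derive.
by near=> y; apply: E; near: y; exact: open_nbhs_nbhs.
Unshelve. all: by end_near. Qed.

Lemma eq_smooth_on U f g : open U -> (forall x, U x -> f x = g x) ->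
  smooth_on U f -> smooth_on U g.
Proof.
move=> oU E sf s.
have {E}E : forall x, U x -> foldr cpartial f s x = foldr cpartial g s x.
  elim: s {sf} => [|i s IH] //= x Ux.
  exact: (@eq_cpartial U _ _ i x oU IH Ux).
move=> x Ux; have [cf df] := sf s x Ux.
have nE : {near x, foldr cpartial f s =1 foldr cpartial g s}.
  by near=> y; apply: E; near: y; exact: open_nbhs_nbhs.
split; last by move=> i; exact: near_eq_derivable nE (df i).
rewrite /prop_for /continuous_at -E//; apply: cvg_trans cf.
by apply: (@near_eq_cvg _ _ (nbhs x) _); exact: nE.
Unshelve. all: by end_near. Qed.

Lemma smooth_on_continuous U f x : smooth_on U f -> U x -> {for x, continuous f}.
Proof. by move=> sf /(sf [::])[]. Qed.

Lemma smooth_on_derivable U f x i : smooth_on U f -> U x -> derivable f x (basis_vec i).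
Proof. by move=> sf /(sf [::])[_]; exact. Qed.

Lemma compact_continuous_bounded A f : compact A ->
  (forall x, A x -> {for x, continuous f}) ->
  exists2 C, 0 <= C & forall x, A x -> `|f x| <= C.
Proof.
move=> cA cf; have : compact (f @` A).
  apply: continuous_compact => //; apply: continuous_in_subspaceT => x /set_mem.
  exact: cf.
move=> /compact_bounded[M [_ hM]]; exists (`|M| + 1); first by rewrite addr_ge0.
move=> x Ax; apply: hM; last by exists x.
by rewrite (le_lt_trans (ler_norm M))// ltrDl.
Qed.

Lemma is_derive_line f i x (s : R) : derivable f (x + s *: basis_vec i) (basis_vec i) ->
  is_derive s 1 (fun t => f (x + t *: basis_vec i)) (cpartial i f (x + s *: basis_vec i)).
Proof.
set e := basis_vec i; move=> df.
have E : (fun h : R => h^-1 *: (((fun t => f (x + t *: e)) \o shift s) (h *: 1) - f (x + s *: e))) =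
    (fun h => h^-1 *: ((f \o shift (x + s *: e)) (h *: e) - f (x + s *: e))).
  apply/funext => h /=; congr (_ *: (f _ - _)).
  by rewrite [_%:A]mulr1 scalerDl addrCA addrA.
by split; rewrite /derivable /derive /cpartial /derive E.
Qed.

(** Mean value theorem along a coordinate line. The two signs of t are separate cases, since the
    one-variable theorem works on an ordered segment; bounding the intermediate point by |t| hides
    the distinction. *)
Lemma cpartial_MVT f i x (t : R) :
  (forall s, `|s| <= `|t| -> derivable f (x + s *: basis_vec i) (basis_vec i)) ->
  exists2 s, `|s| <= `|t| &
    f (x + t *: basis_vec i) - f x = t * cpartial i f (x + s *: basis_vec i).
Proof.
move=> df; pose g (s : R) := f (x + s *: basis_vec i).
pose dg (s : R) := cpartial i f (x + s *: basis_vec i).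
have D (s : R) : `|s| <= `|t| -> is_derive s 1 g (dg s).
  by move=> st; apply: is_derive_line; exact: df.
have C (a b : R) : (forall s : R, s \in `[a, b] -> `|s| <= `|t|) -> {within `[a, b], continuous g}.
  move=> ab; apply: continuous_in_subspaceT => s /set_mem/= sab.
  apply: differentiable_continuous; apply/derivable1_diffP.
  by case: (D s (ab _ sab)).
have [t0|t0] := leP 0 t.
  have ab (s : R) : s \in `[0, t] -> `|s| <= `|t|.
    by rewrite in_itv/= => /andP[s0 st]; rewrite !ger0_norm.
  have D' s : s \in `]0, t[ -> is_derive s 1 g (dg s).
    by move=> /subset_itv_oo_cc sab; apply: D; exact: ab.
  have [s /ab st] := MVT_segment t0 D' (C _ _ ab).
  rewrite /g scale0r addr0 subr0 => ->; exists s => //; exact: mulrC.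
have ab (s : R) : s \in `[t, 0] -> `|s| <= `|t|.
  by rewrite in_itv/= => /andP[s0 st]; rewrite !ler0_norm// ?lerN2// ltW.
have D' s : s \in `]t, 0[ -> is_derive s 1 g (dg s).
  by move=> /subset_itv_oo_cc sab; apply: D; exact: ab.
have [s /ab st] := MVT_segment (ltW t0) D' (C _ _ ab).
rewrite /g scale0r addr0 sub0r mulrN => h.
by exists s => //; rewrite -opprB h opprK mulrC.
Qed.

End smooth_closure.

(** * Test functions and the integral of their partial derivatives *)

Section test_functions.
Context {R : realType} {n : nat}.
Local Notation X := 'rV[R]_n.
Local Notation mu := (lebesgue_rV R n).
Implicit Types (U V A : set X) (f g phi psi : X -> R) (i j : 'I_n).

Lemma compact_supp phi A : compact A -> [set x | phi x != 0] `<=` A ->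
  compact (closure [set x | phi x != 0]) /\ closure [set x | phi x != 0] `<=` A.
Proof.
move=> cA sA; have clA : closed A by apply: compact_closed => //; exact: norm_hausdorff.
have sub : closure [set x | phi x != 0] `<=` A.
  by rewrite [X in _ `<=` X](closure_id A).1//; exact: closureS.
by split => //; apply: subclosed_compact cA sub; exact: closed_closure.
Qed.

Lemma test_functionP U phi A : smooth_on setT phi -> compact A -> A `<=` U ->
  [set x | phi x != 0] `<=` A -> test_function U phi.
Proof.
move=> sphi cA AU sA; have [c1 c2] := compact_supp cA sA.
by split => //; split => //; exact: subset_trans AU.
Qed.

Lemma test_functionS U V phi : U `<=` V -> test_function U phi -> test_function V phi.
Proof. by move=> UV [s [c h]]; split=> //; split=> //; exact: subset_trans UV. Qed.

Lemma test_out U phi x : test_function U phi -> ~ U x -> phi x = 0.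
Proof.
move=> [_ [_ sU]] Ux; apply/eqP/negPn/negP => px; apply: Ux; apply: sU.
exact: subset_closure.
Qed.

Lemma test0 U : test_function U (fun=> 0).
Proof.
apply: (@test_functionP _ _ set0) => //; [exact: smooth_on_cst openT|exact: compact0|].
by move=> x /=; rewrite eqxx.
Qed.

(** Here g is smooth on V only, yet the product is smooth everywhere: V and the complement of the
    support of phi are open and cover the space, and the product vanishes on the latter. *)
Lemma test_mul_smooth V g phi : open V -> smooth_on V g -> test_function V phi ->
  test_function V (fun x => g x * phi x).
Proof.
move=> oV sg [sphi [cphi sV]].
suff sgp : smooth_on setT (fun x => g x * phi x).
  apply: (test_functionP sgp cphi sV) => x /= h; apply: subset_closure => /=.
  by apply: contra h => /eqP ->; rewrite mulr0.
set S := closure _ in cphi sV *.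
have oS : open (~` S) by apply/closed_openC; exact: closed_closure.
have -> : setT = V `|` ~` S.
  apply/seteqP; split => // x _; have [/sV|] := pselect (S x); [by left|by right].
apply: smooth_onU.
  exact: (smooth_onM oV sg (smooth_onS (@subsetT _ V) sphi)).
apply: (@eq_smooth_on _ _ _ (fun=> 0)) => //; last exact: smooth_on_cst.
move=> x Sx; have -> : phi x = 0; last by rewrite mulr0.
by apply/eqP/negPn/negP => px; apply: Sx; exact: subset_closure.
Qed.

Lemma test_cpartial U i phi : test_function U phi -> test_function U (cpartial i phi).
Proof.
move=> [sphi [cphi sU]].
apply: (test_functionP (smooth_on_cpartial i sphi) cphi sU).
set S := closure _ in cphi sU *.
have oS : open (~` S) by apply/closed_openC; exact: closed_closure.
move=> x /= h; apply: contrapT => Sx; move/eqP: h; apply.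
rewrite (@eq_cpartial _ _ (~` S) _ (fun=> 0))//; first exact: (@derive_cst _ _ _ 0).
by move=> y Sy; apply/eqP/negPn/negP => py; apply: Sy; exact: subset_closure.
Qed.

Lemma test_bounded U phi : test_function U phi ->
  exists2 C, 0 <= C & forall x, `|phi x| <= C.
Proof.
move=> [sphi [cphi sU]].
have [|C C0 h] := compact_continuous_bounded (f := phi) cphi.
  by move=> x _; exact: (smooth_on_continuous sphi).
exists C => // x; have [/eqP ->|px] := boolP (phi x == 0); first by rewrite normr0.
by apply: h; exact: subset_closure.
Qed.

Lemma test_measurable U phi : test_function U phi -> measurable_fun setT phi.
Proof.
move=> [sphi _]; apply: continuous_measurable_rV; first exact: openT.
by move=> x _; exact: (smooth_on_continuous sphi).
Qed.

Lemma test_box U phi : test_function U phi ->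
  exists2 M : R, 0 < M & forall x, phi x != 0 -> box (fun=> - M) (fun=> M) x.
Proof.
move=> [_ [cphi _]]; have [M M0 h] := bounded_set_box (compact_bounded cphi).
by exists M => // x px; apply: h; exact: subset_closure.
Qed.

Lemma bounded_box_integrable (M C : R) f : measurable_fun setT f ->
  (forall x, `|f x| <= C) -> (forall x, f x != 0 -> box (fun=> - M) (fun=> M) x) ->
  mu.-integrable setT (EFin \o f).
Proof.
move=> mf fC fB; set B := box _ _ in fB; have mB : measurable B by exact: measurable_box.
rewrite (_ : f = f \_ B); last first.
  apply/funext => x; rewrite patchE; case: ifPn => // /negP; rewrite inE => Bx.
  by apply/eqP/negPn/negP => /fB.
rewrite -restrict_EFin; apply/(integrable_mkcond _ mB).
apply: measurable_bounded_integrable => //; first exact: measure_box_lty.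
  exact: measurable_funTS.
exists C; split; first exact: num_real.
by move=> y Cy x _ /=; rewrite (le_trans (fC x))// ltW.
Qed.

Lemma test_integrable U phi : test_function U phi -> mu.-integrable setT (EFin \o phi).
Proof.
move=> tp; have [C _ hC] := test_bounded tp; have [M _ hM] := test_box tp.
exact: (bounded_box_integrable (test_measurable tp) hC hM).
Qed.

Lemma box_line (M s : R) (i : 'I_n) (x : X) : `|s| <= 1 ->
  box (fun=> - M) (fun=> M) (x + s *: basis_vec i) ->
  box (fun=> - (M + 1)) (fun=> M + 1) x.
Proof.
rewrite ler_norml => /andP[s1 s2] h j; have := h j; rewrite !in_itv/= !mxE eqxx/=.
by case: eqP => _; rewrite ?mulr1 ?mulr0 => /andP[h1 h2]; apply/andP; split; lra.
Qed.

(** The difference quotients of step 1/(k+1) have zero integral by translation invariance. By the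
    mean value theorem they are bounded by the supremum of the derivative on a fixed box and vanish
    outside it, so dominated convergence applies. *)
Lemma integral_cpartial_test U i phi : test_function U phi ->
  (\int[mu]_x (cpartial i phi x)%:E = 0)%E.
Proof.
move=> tp; pose e : X := basis_vec i; pose t k : R := k.+1%:R^-1.
have t0 k : 0 < t k by rewrite invr_gt0 ltr0n.
have t1 k : t k <= 1 by rewrite invf_le1 ?ltr0n// ler1n.
pose F k x := (t k)^-1 * (phi (x + t k *: e) - phi x).
have iphi k : mu.-integrable setT (EFin \o (fun x => phi (x + t k *: e))).
  have [C _ hC] := test_bounded tp; have [M M0 hM] := test_box tp.
  apply: (@bounded_box_integrable (M + 1) C) => //.
    exact: measurableT_comp (test_measurable tp) (measurable_translation _).
  by move=> x /hM; apply: box_line; rewrite ger0_norm// ltW.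
have IF k : (\int[mu]_x (F k x)%:E = 0)%E.
  have ip := test_integrable tp.
  pose p1 := EFin \o (fun x => phi (x + t k *: e)); pose p2 := EFin \o phi.
  have -> : (fun x => (F k x)%:E) = (fun x => ((t k)^-1)%:E * (p1 \- p2) x)%E.
    by apply/funext => x; rewrite /F EFinM EFinB.
  rewrite (integralZl measurableT); last exact: (integrableB measurableT (iphi k) ip).
  rewrite (integralB measurableT (iphi k) ip) (integral_translation (t k *: e) ip).
  by rewrite subee ?mule0//; exact: (integrable_fin_num measurableT ip).
have tdp := test_cpartial i tp.
have [C C0 hC] := test_bounded tdp; have [M M0 hM] := test_box tp.
(* The steps are at most 1, so enlarging the box of the support by 1 also contains the support of
   every translate. *)
pose B : set X := box (fun=> - (M + 1)) (fun=> M + 1).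
have mB : measurable B by exact: measurable_box.
have FC k x : `|F k x| <= C * \1_B x.
  have [xB|xB] := pselect (B x).
    rewrite indicE mem_set// mulr1.
    have [s _] := @cpartial_MVT _ _ phi i x (t k) (fun s _ => smooth_on_derivable tp.1 I).
    by rewrite /F => ->; rewrite mulKf ?hC// gt_eqF.
  have H s : `|s| <= 1 -> phi (x + s *: e) = 0.
    by move=> s1; apply/eqP/negPn/negP => /hM /(box_line s1).
  have := H 0; rewrite scale0r addr0 normr0 /F => ->//.
  rewrite H; first by rewrite subrr mulr0 normr0 mulr_ge0.
  by rewrite ger0_norm// ltW.
have cF x : F ^~ x @ \oo --> cpartial i phi x.
  have d : (fun h => h^-1 *: ((phi \o shift x) (h *: e) - phi x)) @ 0^' --> cpartial i phi x.
    exact: (smooth_on_derivable (x := x) tp.1 I).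
  have ct : t @ \oo --> 0^'.
    move=> A /= hA; have : \forall k \near \oo, t k != 0 -> A (t k) := @cvg_harmonic R _ hA.
    move=> h; rewrite /nbhs/=; apply: filterS h => k; apply.
    by have := t0 k; rewrite lt0r => /andP[].
  have := cvg_comp _ _ ct d; apply: cvg_trans; apply: near_eq_cvg; apply: nearW => k.
  by rewrite /F /= [x + _]addrC.
have mF k : measurable_fun setT (F k).
  apply: measurable_funM => //; apply: measurable_funB; last exact: test_measurable tp.
  exact: measurableT_comp (test_measurable tp) (measurable_translation _).
have [|||||_ _] := @dominated_convergence _ X R mu setT measurableT (fun k => EFin \o F k)
  (EFin \o cpartial i phi) (EFin \o (fun x => C * \1_B x)).
- by move=> k; apply/measurable_EFinP.
- by apply/measurable_EFinP; exact: test_measurable tdp.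
- by apply: aeW => x _; apply: cvg_EFin; [exact: nearW|exact: cF].
- apply: (@bounded_box_integrable (M + 1) C).
  + by apply: measurable_funM => //; exact: measurable_indic.
  + move=> x; rewrite normrM (ger0_norm C0) ler_piMr// indicE.
    by case: (_ \in _); rewrite ?normr1 ?normr0.
  + by move=> x /=; rewrite indicE; case: (boolP (x \in B)) => [/set_mem//|_]; rewrite mulr0 eqxx.
- by apply: aeW => x k _; rewrite /= lee_fin.
rewrite (_ : [sequence _]_n = fun=> 0%E); last by apply/funext => k; exact: IF.
by move=> /cvg_lim <-//; rewrite lim_cst.
Qed.

End test_functions.

(** * Smooth approximation of boxes and the fundamental lemma of the calculus of variations *)

Section fundamental_lemma.
Context {R : realType} {n : nat}.
Local Notation X := 'rV[R]_n.
Local Notation mu := (lebesgue_rV R n).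
Implicit Types (U V A : set X) (f g phi psi : X -> R) (i j : 'I_n).

Lemma flat0_le1 (t : R) : flat 0 t <= 1.
Proof.
rewrite /flat expr0 mul1r; case: ifP => // t0.
by rewrite expR_le1 oppr_le0 invr_ge0 ltW.
Qed.

Lemma cvg_flat0 (s : R) : flat 0 (k.+1%:R * s) @[k --> \oo] --> ((0 < s)%R%:R : R).
Proof.
have [s0|s0] := ltP 0 s; last first.
  rewrite (_ : (fun _ => _) = fun=> 0); first exact: cvg_cst.
  by apply/funext => k; rewrite flat_le0// mulr_ge0_le0.
rewrite (_ : (fun _ => _) = (fun k => expR (- (s^-1 * harmonic k)))); last first.
  apply/funext => k; rewrite /flat pmulr_lgt0// ltr0n/= expr0 mul1r invfM mulrC.
  by rewrite mulrC.
rewrite -expR0; apply: (@cvg_comp _ _ _ _ expR _ (nbhs (0:R))); last exact: continuous_expR.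
rewrite -oppr0; apply: cvgN; rewrite -(mulr0 s^-1); apply: cvgMl_tmp.
exact: cvg_harmonic.
Qed.

(** A smooth approximation of the indicator of ]a, b]. As k grows, the first factor tends to the
    indicator of t > a and the second to that of t <= b. The last one only confines the support to
    [a, b + e] and tends to 1 on t <= b. Since [flat] vanishes at 0, the limit at the end points is
    exactly that of the half-open interval. *)
Definition plateau1 (a b e : R) (k : nat) (t : R) : R :=
  flat 0 (k.+1%:R * (t - a)) * (1 - flat 0 (k.+1%:R * (t - b))) *
  flat 0 (k.+1%:R * (b + e - t)).

Lemma plateau1_itv a b e k t : 0 <= plateau1 a b e k t <= 1.
Proof.
rewrite /plateau1; set u := flat 0 _; set v := flat 0 _; set w := flat 0 _.
have u0 : 0 <= u := flat_ge0 _ _; have u1 : u <= 1 := flat0_le1 _.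
have v0 : 0 <= v := flat_ge0 _ _; have v1 : v <= 1 := flat0_le1 _.
have w0 : 0 <= w := flat_ge0 _ _; have w1 : w <= 1 := flat0_le1 _.
have v' : 0 <= 1 - v by rewrite subr_ge0.
apply/andP; split; first by rewrite !mulr_ge0.
by rewrite !mulr_ile1 ?mulr_ge0// gerBl.
Qed.

Lemma plateau1_out a b e k t : plateau1 a b e k t != 0 -> a <= t <= b + e.
Proof.
move=> h; apply/andP; split; rewrite leNgt; apply: contra h => h; rewrite /plateau1.
  by rewrite (@flat_le0 _ _ (_ * (t - a))) ?mul0r// mulr_ge0_le0// subr_le0 ltW.
by rewrite (@flat_le0 _ _ (_ * (b + e - t))) ?mulr0// mulr_ge0_le0// subr_le0 ltW.
Qed.

Lemma cvg_plateau1 a b e t : 0 < e ->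
  plateau1 a b e k t @[k --> \oo] --> ((t \in `]a, b])%:R : R).
Proof.
move=> e0; have -> : (t \in `]a, b])%:R =
    (0 < t - a)%R%:R * (1 - (0 < t - b)%R%:R) * (0 < b + e - t)%R%:R :> R.
  rewrite in_itv/= subr_gt0 subr_gt0 subr_gt0; have [ta|ta] := ltP a t; rewrite ?mul0r//=.
  have [tb|tb] := leP t b; last by rewrite subrr mulr0 mul0r.
  by rewrite subr0 !mul1r (le_lt_trans tb)// ltrDl.
apply: cvgM; last exact: cvg_flat0.
apply: cvgM; first exact: cvg_flat0.
by apply: cvgB; [exact: cvg_cst|exact: cvg_flat0].
Qed.

Definition plateau (a b : 'I_n -> R) (e : R) (k : nat) (x : X) : R :=
  \prod_i plateau1 (a i) (b i) e k (x 0 i).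

Lemma smooth_plateau a b e k : smooth_on setT (plateau a b e k).
Proof.
have oT : open (setT : set X) := openT.
apply: smooth_on_prod => // i _; pose K : R := k.+1%:R.
have -> : (fun x : X => plateau1 (a i) (b i) e k (x 0 i)) =
    (fun x => flat 0 (K * x 0 i + - K * a i) * (1 + -1 * flat 0 (K * x 0 i + - K * b i)) *
      flat 0 (- K * x 0 i + K * (b i + e))).
  apply/funext => x; rewrite /plateau1 mulN1r.
  by congr (flat 0 _ * (1 - flat 0 _) * flat 0 _); rewrite -/K; ring.
apply: smooth_on_gen => //.
apply: Sg_mul; last exact: Sg_flat.
apply: Sg_mul; first exact: Sg_flat.
apply: Sg_add; first exact: Sg_cst.
apply: Sg_mul; first exact: Sg_cst.
exact: Sg_flat.
Qed.

Lemma plateau_itv a b e k x : 0 <= plateau a b e k x <= 1.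
Proof.
apply/andP; split; first by apply: prodr_ge0 => i _; case/andP: (plateau1_itv (a i) (b i) e k (x 0 i)).
by apply: prodr_ile1 => i _; exact: plateau1_itv.
Qed.

Lemma ccube_compact (c : 'I_n -> R) r : compact (ccube c r).
Proof.
rewrite (_ : ccube c r = [set v : X | forall i, v ord0 i \in `[c i - r, c i + r]]); last first.
  by apply/seteqP; split => x h i; have := h i; rewrite ler_norml in_itv/= =>
      /andP[h1 h2]; apply/andP; split; lra.
apply: (@rV_compact _ _ (fun i => `[c i - r, c i + r]%classic)) => i; exact: segment_compact.
Qed.

Lemma test_plateau U (c : 'I_n -> R) r a b e k :
  ccube c (r + e) `<=` U -> 0 <= e -> (forall i, c i - r <= a i) -> (forall i, b i <= c i + r) ->
  test_function U (plateau a b e k).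
Proof.
move=> cU e0 ca cb; apply: (test_functionP (smooth_plateau a b e k) (@ccube_compact c (r + e)) cU).
move=> x /= + i => /prodf_neq0 /(_ i isT) /plateau1_out/andP[h1 h2].
have h3 := ca i; have h4 := cb i.
by rewrite ler_norml; apply/andP; split; lra.
Qed.

Lemma cvg_plateau a b e x : 0 < e ->
  plateau a b e k x @[k --> \oo] --> (\1_(box a b) x : R).
Proof.
move=> e0; have -> : \1_(box a b) x = \prod_i (x 0 i \in `]a i, b i])%:R :> R.
  rewrite indicE; case: (boolP (x \in box a b)) => [/set_mem h|/negP h].
    by rewrite big1// => i _; rewrite h.
  have /existsNP[i hi] : ~ (forall i, x 0 i \in `]a i, b i]) by move=> h'; apply: h; rewrite inE.
  by rewrite (bigD1 i)//= (negbTE (introN idP hi)) mul0r.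
apply: cvg_big => [|i _]; first exact: mul_continuous.
exact: cvg_plateau1.
Qed.

Lemma fundamental_lemma U g : open U -> mu.-integrable U (EFin \o g) ->
  (forall phi, test_function U phi -> \int[mu]_(x in U) (g x * phi x) = 0) ->
  {ae mu, forall x, U x -> g x = 0}.
Proof.
move=> oU ig hg; have mU : measurable U := open_measurable_rV oU.
have mg : measurable_fun U g by apply/measurable_EFinP; exact: measurable_int ig.
pose r m : R := m.+1%:R^-1; have r0 m : 0 < r m by rewrite invr_gt0 ltr0n.
suff H (c : 'I_n -> R) m : ccube c (r m + r m) `<=` U ->
    {ae mu, forall x, cube c (r m) x -> g x = 0}.
  pose P (k : {ffun 'I_n -> rat} * nat) :=
    ccube (fun i => ratr (k.1 i)) (r k.2 + r k.2) `<=` U.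
  (* The cubes are indexed by natural numbers through [unpickle], so that their exceptional null
     sets form a countable family. *)
  have : forall m : nat, {ae mu, forall x, forall k, unpickle m = Some k -> P k ->
      cube (fun i => ratr (k.1 i)) (r k.2) x -> g x = 0}.
    move=> m; case: (@unpickle ({ffun 'I_n -> rat} * nat)%type m) => [k|]; last exact: aeW.
    have [Pk|Pk] := pselect (P k); last by apply: aeW => x k' [<-].
    by apply: filterS (H _ _ Pk) => x h k' [<-].
  move=> /ae_foralln; apply: filterS => x h Ux.
  have [c [m [h1 h2]]] := open_cube oU Ux.
  exact: (h (pickle (c, m)) (c, m) (pickleK _) h2 h1).
move=> cU; have mC : measurable (cube c (r m)) by exact: measurable_box.
have CU : cube c (r m) `<=` U.
  by apply: subset_trans cU; apply: cube_sub_ccube; rewrite lerDl ltW.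
apply: integral_boxes_eq0; first by apply: integrableS ig.
move=> a b; rewrite boxI.
set a' := fun i => _; set b' := fun i => _.
have mB : measurable (box a' b') by exact: measurable_box.
have BU : box a' b' `<=` U by rewrite -boxI => x [/CU].
have tt k : test_function U (plateau a' b' (r m) k).
  apply: (@test_plateau U c (r m)) => //; first exact: ltW.
    by move=> i; rewrite le_max lexx.
  by move=> i; rewrite ge_min lexx.
have mp k : measurable_fun U (plateau a' b' (r m) k).
  exact: measurable_funTS (test_measurable (tt k)).
have IF k : (\int[mu]_(x in U) (g x * plateau a' b' (r m) k x)%:E = 0)%E.
  rewrite -[LHS]fineK ?hg//; first by have := hg _ (tt k); rewrite /Rintegral => ->.
  apply: integrable_fin_num => //.
  apply: (le_integrable mU _ _ ig); first by apply/measurable_EFinP; exact: measurable_funM.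
  move=> x Ux /=; rewrite lee_fin normrM ler_piMr//.
  by have /andP[p0 p1] := plateau_itv a' b' (r m) k x; rewrite ger0_norm.
have [|||||_ _] := @dominated_convergence _ X R mu U mU
  (fun k => EFin \o (fun x => g x * plateau a' b' (r m) k x))
  (EFin \o (fun x => g x * \1_(box a' b') x)) (EFin \o (fun x => `|g x|)).
- by move=> k; apply/measurable_EFinP; exact: measurable_funM.
- by apply/measurable_EFinP; apply: measurable_funM => //; exact: measurable_funTS.
- apply: aeW => x _; apply: cvg_EFin; first exact: nearW.
  by apply: cvgMl_tmp; exact: cvg_plateau.
- exact: integrable_norm.
- apply: aeW => x k _; rewrite /= lee_fin normrM ler_piMr//.
  by have /andP[p0 p1] := plateau_itv a' b' (r m) k x; rewrite ger0_norm.
rewrite (_ : [sequence _]_n = fun=> 0%E); last by apply/funext => k; exact: IF.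
move=> /cvg_lim; rewrite lim_cst// => -> //.
rewrite [RHS](_ : _ = \int[mu]_(x in U) (((EFin \o g) \_ (box a' b')) x))%E; last first.
  apply: eq_integral => x _; rewrite patchE /= indicE.
  by case: ifP => _; rewrite ?mulr1 ?mulr0.
by rewrite -integral_mkcondr setIidr.
Qed.

End fundamental_lemma.

(** * Square-integrable functions and weak derivatives *)

Section L2_theory.
Context {R : realType} {n : nat}.
Local Notation X := 'rV[R]_n.
Local Notation mu := (lebesgue_rV R n).
Local Notation Int U f := (mu.-integrable U (EFin \o f)).
Variable U : set X.
Hypothesis mU : measurable U.
Implicit Types (f g h phi psi : X -> R) (i j : 'I_n).

Lemma Int_measurable f : Int U f -> measurable_fun U f.
Proof. by move=> h; apply/measurable_EFinP; exact: measurable_int h. Qed.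

Lemma ae_le_Int f g : measurable_fun U f ->
  {ae mu, forall x, U x -> `|f x| <= `|g x|} -> Int U g -> Int U f.
Proof.
move=> mf fg /integrableP[mg ig]; apply/integrableP.
split; first exact/measurable_EFinP.
apply: le_lt_trans ig; apply: ae_ge0_le_integral => //.
- by apply: measurableT_comp => //; exact/measurable_EFinP.
- by apply: measurableT_comp.
Qed.

Lemma le_Int f g : measurable_fun U f ->
  (forall x, U x -> `|f x| <= `|g x|) -> Int U g -> Int U f.
Proof. by move=> mf fg; apply: ae_le_Int => //; exact: aeW. Qed.

Lemma IntD f g : Int U f -> Int U g -> Int U (fun x => f x + g x).
Proof. by move=> hf hg; have := integrableD mU hf hg. Qed.

Lemma IntB f g : Int U f -> Int U g -> Int U (fun x => f x - g x).
Proof. by move=> hf hg; have := integrableB mU hf hg. Qed.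

Lemma IntZ c f : Int U f -> Int U (fun x => c * f x).
Proof. by move=> hf; have := integrableZl mU c hf. Qed.

Lemma IntN f : Int U f -> Int U (fun x => - f x).
Proof.
move=> hf; rewrite (_ : (fun x => - f x) = (fun x => -1 * f x)); first exact: IntZ.
by apply/funext => x; rewrite mulN1r.
Qed.

Lemma Int_sum (I : Type) (r : seq I) (P : pred I) (F : I -> X -> R) :
  (forall k, P k -> Int U (F k)) -> Int U (fun x => \sum_(k <- r | P k) F k x).
Proof.
move=> hF; have := integrable_sum mU r hF.
by congr (mu.-integrable U _); apply/funext => x /=; rewrite sumEFin.
Qed.

Lemma Rintegral_sum (I : Type) (r : seq I) (F : I -> X -> R) :
  (forall k, Int U (F k)) ->
  \int[mu]_(x in U) (\sum_(k <- r) F k x) = \sum_(k <- r) \int[mu]_(x in U) F k x.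
Proof.
move=> hF; elim: r => [|k r IH].
  rewrite big_nil -[RHS](mul0r (fine (mu U))) -(Rintegral_cst mu mU).
  by apply: eq_Rintegral => x _; rewrite big_nil.
rewrite big_cons -IH -RintegralD//; last exact: Int_sum.
by apply: eq_Rintegral => x _; rewrite big_cons.
Qed.

Lemma Rintegral_ae f g : measurable_fun U f -> measurable_fun U g ->
  {ae mu, forall x, U x -> f x = g x} ->
  \int[mu]_(x in U) f x = \int[mu]_(x in U) g x.
Proof.
move=> mf mg fg; congr fine; apply: ae_eq_integral => //; try exact/measurable_EFinP.
by apply: filterS fg => x + Ux => /(_ Ux) ->.
Qed.

Lemma Rintegral_ae0 f : measurable_fun U f -> {ae mu, forall x, U x -> f x = 0} ->
  \int[mu]_(x in U) f x = 0.
Proof.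
by move=> mf f0; rewrite (@Rintegral_ae f (fun=> 0))// Rintegral_cst// mul0r.
Qed.

Lemma RintegralN f : Int U f -> \int[mu]_(x in U) - f x = - \int[mu]_(x in U) f x.
Proof.
move=> hf; rewrite -mulN1r -RintegralZl//.
by apply: eq_Rintegral => x _; rewrite mulN1r.
Qed.

Lemma ae_le_Rintegral f g : Int U f -> Int U g ->
  {ae mu, forall x, U x -> f x <= g x} ->
  \int[mu]_(x in U) f x <= \int[mu]_(x in U) g x.
Proof.
move=> hf hg fg; rewrite -subr_ge0 -RintegralB//.
have mfg : measurable_fun U (fun x => g x - f x) := Int_measurable (IntB hg hf).
(* The absolute value turns a sign known almost everywhere into one that holds at every point. *)
rewrite (@Rintegral_ae _ (fun x => `|g x - f x|))//.
- by apply: Rintegral_ge0 => x _.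
- exact: measurableT_comp.
- by apply: filterS fg => x + Ux => /(_ Ux) h; rewrite ger0_norm// subr_ge0.
Qed.

Lemma Rintegral_sqr_eq0 f : Int U (fun x => f x ^+ 2) ->
  \int[mu]_(x in U) (f x ^+ 2) = 0 -> measurable_fun U f ->
  {ae mu, forall x, U x -> f x = 0}.
Proof.
move=> hf f0 mf.
have : (\int[mu]_(x in U) `|(EFin \o (fun x => (f x ^+ 2)%R)) x| = 0)%E.
  transitivity (\int[mu]_(x in U) (f x ^+ 2)%R%:E)%E.
    by apply: eq_integral => x _ /=; rewrite ger0_norm// sqr_ge0.
  have := congr1 EFin f0; rewrite /Rintegral fineK//.
  exact: (integrable_fin_num mU hf).
move=> /(ae_eq_integral_abs _ mU (measurable_int _ hf)).
by apply: filterS => x + Ux => /(_ Ux)/= [] /eqP; rewrite sqrf_eq0 => /eqP.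
Qed.

Lemma L2_measurable f : L2 U f -> measurable_fun U f. Proof. by case. Qed.

Lemma L2M f g : L2 U f -> L2 U g -> Int U (fun x => f x * g x).
Proof.
move=> [mf hf] [mg hg]; apply: le_Int (IntD hf hg) => [|x Ux].
  exact: measurable_funM.
rewrite [leRHS]ger0_norm; last by rewrite addr_ge0// sqr_ge0.
rewrite ler_norml; apply/andP; split; nra.
Qed.

Lemma ae_L2 f g : measurable_fun U f ->
  {ae mu, forall x, U x -> `|f x| <= `|g x|} -> L2 U g -> L2 U f.
Proof.
move=> mf fg [mg hg]; split => //; apply: ae_le_Int hg.
  exact: measurable_funX.
by apply: filterS fg => x + Ux => /(_ Ux) h; rewrite !normrX lerXn2r ?nnegrE.
Qed.

Lemma L2_ae f g : measurable_fun U f -> {ae mu, forall x, U x -> f x = g x} ->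
  L2 U g -> L2 U f.
Proof. by move=> mf fg; apply: ae_L2 => //; apply: filterS fg => x + Ux => ->. Qed.

Lemma L2D f g : L2 U f -> L2 U g -> L2 U (fun x => f x + g x).
Proof.
move=> [mf hf] [mg hg]; split; first exact: measurable_funD.
apply: le_Int (IntZ 2 (IntD hf hg)) => [|x Ux].
  by apply: measurable_funX; exact: measurable_funD.
rewrite [leRHS]ger0_norm; last by rewrite mulr_ge0// addr_ge0// sqr_ge0.
by rewrite ger0_norm ?sqr_ge0//; have := sqr_ge0 (f x - g x); lra.
Qed.

Lemma L2Z c f : L2 U f -> L2 U (fun x => c * f x).
Proof.
move=> [mf hf]; split; first exact: measurable_funM.
have := IntZ (c ^+ 2) hf; congr (mu.-integrable U (EFin \o _)).
by apply/funext => x; rewrite exprMn.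
Qed.

Lemma L2N f : L2 U f -> L2 U (fun x => - f x).
Proof.
by move=> /(L2Z (-1)); congr L2; apply/funext => x; rewrite mulN1r.
Qed.

Lemma L2B f g : L2 U f -> L2 U g -> L2 U (fun x => f x - g x).
Proof. by move=> hf /L2N; exact: L2D. Qed.

Lemma L2_0 : L2 U (fun=> 0).
Proof.
split; first exact: measurable_cst.
by rewrite (_ : _ \o _ = cst 0%E); [exact: integrable0|apply/funext => x /=; rewrite expr0n].
Qed.

Lemma L2_sum (I : Type) (r : seq I) (F : I -> X -> R) :
  (forall k, L2 U (F k)) -> L2 U (fun x => \sum_(k <- r) F k x).
Proof.
move=> hF; elim: r => [|k r IH].
  by have := L2_0; congr L2; apply/funext => x; rewrite big_nil.
by have := L2D (hF k) IH; congr L2; apply/funext => x; rewrite big_cons.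
Qed.

Lemma L2M_ae_bounded C f g : measurable_fun U g ->
  {ae mu, forall x, U x -> `|g x| <= C} -> L2 U f -> L2 U (fun x => g x * f x).
Proof.
move=> mg gC hf; apply: ae_L2 (L2Z C hf).
  by apply: measurable_funM => //; exact: L2_measurable.
apply: filterS gC => x + Ux => /(_ Ux) h; rewrite !normrM ler_wpM2r//.
by rewrite (le_trans h)// ler_norm.
Qed.

Lemma L2_fin_Int f : (mu U < +oo)%E -> L2 U f -> Int U f.
Proof.
move=> fU [mf hf]; have h1 : Int U (fun=> 1).
  apply: measurable_bounded_integrable => //; exists 1; split => // y y1 x _ /=.
  by rewrite normr1 ltW.
apply: le_Int (IntD h1 hf) => // x Ux.
rewrite [leRHS]ger0_norm; last by rewrite addr_ge0// sqr_ge0.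
by rewrite ler_norml; apply/andP; split; nra.
Qed.

Lemma L2_ae_bounded C f : (mu U < +oo)%E -> measurable_fun U f ->
  {ae mu, forall x, U x -> `|f x| <= C} -> L2 U f.
Proof.
move=> fU mf fC; apply: (@ae_L2 _ (fun=> C)) => //.
  by apply: filterS fC => x + Ux => /(_ Ux) h; rewrite (le_trans h)// ler_norm.
split; first exact: measurable_cst.
apply: measurable_bounded_integrable => //; exists (`|C ^+ 2|); split => // y y1 x _ /=.
exact: ltW.
Qed.

Lemma L2normE f : L2 U f -> L2norm U f ^+ 2 = \int[mu]_(x in U) (f x ^+ 2).
Proof. by move=> _; rewrite sqr_sqrtr// Rintegral_ge0// => x _; exact: sqr_ge0. Qed.

(** The integral of (f - t g)^2 is a nonnegative quadratic polynomial in t; its value at the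
    minimiser c / b gives the bound. *)
Lemma cauchy_schwarz f g : L2 U f -> L2 U g ->
  `|\int[mu]_(x in U) (f x * g x)| <= L2norm U f * L2norm U g.
Proof.
move=> hf hg; set c := Rintegral _ _ _.
have nn h : 0 <= L2norm U h by exact: sqrtr_ge0.
have Q t : 0 <= L2norm U f ^+ 2 - 2 * t * c + t ^+ 2 * L2norm U g ^+ 2.
  rewrite !L2normE// /c.
  have -> : \int[mu]_(x in U) (f x ^+ 2) - 2 * t * \int[mu]_(x in U) (f x * g x) +
      t ^+ 2 * \int[mu]_(x in U) (g x ^+ 2) = \int[mu]_(x in U) (f x - t * g x) ^+ 2.
    rewrite -!RintegralZl//; [|exact: hg.2|exact: L2M].
    rewrite -RintegralB//; [|exact: hf.2|by apply: IntZ; exact: L2M].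
    rewrite -RintegralD//; last 2 first.
    - by apply: IntB; [exact: hf.2|apply: IntZ; exact: L2M].
    - by apply: IntZ; exact: hg.2.
    by apply: eq_Rintegral => x _; ring.
  by apply: Rintegral_ge0 => x _; exact: sqr_ge0.
rewrite -(ler_pXn2r (n := 2)) ?nnegrE ?mulr_ge0// real_normK ?num_real// exprMn.
set a := L2norm U f ^+ 2 in Q *; set b := L2norm U g ^+ 2 in Q *.
have a0 : 0 <= a by exact: sqr_ge0.
have := sqr_ge0 (L2norm U g); rewrite -/b le_eqVlt => /predU1P[b0|b0].
  rewrite -b0 mulr0; rewrite -b0 in Q.
  have [->|c0] := eqVneq c 0; first by rewrite expr0n.
  (* When g has zero norm the polynomial is affine in t; at this point it equals -(a + 2) < 0, which
     is absurd. *)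
  have := Q ((a + 1) / c); rewrite mulr0 addr0 -mulrA divfK//; lra.
have := Q (c / b); have -> : a - 2 * (c / b) * c + (c / b) ^+ 2 * b = (a * b - c ^+ 2) / b.
  by field; rewrite gt_eqF.
by rewrite pmulr_lge0 ?invr_gt0// subr_ge0.
Qed.

Lemma Rintegral_support (V : set X) f : measurable V -> V `<=` U ->
  (forall x, U x -> ~ V x -> f x = 0) ->
  \int[mu]_(x in U) f x = \int[mu]_(x in V) f x.
Proof.
move=> mV VU f0; rewrite Rintegral_mkcond [RHS]Rintegral_mkcond.
apply: eq_Rintegral => x _; rewrite !patchE.
have [Vx|Vx] := pselect (V x); first by rewrite !mem_set//; exact: VU.
rewrite (memNset Vx); case: (boolP (x \in U)) => // /set_mem Ux.
exact: f0.
Qed.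

End L2_theory.

(** * Weak derivatives and the space H^1 *)

Section weak_derivatives.
Context {R : realType} {n : nat}.
Local Notation X := 'rV[R]_n.
Local Notation mu := (lebesgue_rV R n).
Local Notation Int U f := (mu.-integrable U (EFin \o f)).
Implicit Types (U V : set X) (f g h phi psi : X -> R) (i j : 'I_n).

Lemma test_measurable_on U V phi : test_function V phi -> measurable_fun U phi.
Proof. by move=> tp; exact: measurable_funTS (test_measurable tp). Qed.

Lemma test_Int U V phi : measurable U -> test_function V phi -> Int U phi.
Proof. by move=> mU tp; apply: integrableS (test_integrable tp). Qed.

Lemma L2_test U V phi : measurable U -> test_function V phi -> L2 U phi.
Proof.
move=> mU tp; split; first exact: test_measurable_on tp.
have [C C0 hC] := test_bounded tp.
apply: (le_Int mU _ _ (IntZ mU C (test_Int mU tp))) => [|x _].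
  by apply: measurable_funX; exact: test_measurable_on tp.
by rewrite normrX normrM expr2 (ger0_norm C0) ler_wpM2r.
Qed.

Lemma L2_mul_test U V f phi : measurable U -> L2 U f -> test_function V phi ->
  L2 U (fun x => f x * phi x).
Proof.
move=> mU hf tp; have [C _ hC] := test_bounded tp.
have := @L2M_ae_bounded _ _ U mU C f phi (test_measurable_on tp) (aeW _ (fun x _ => hC x)) hf.
by congr L2; apply/funext => x; exact: mulrC.
Qed.

(** The finite measure of U makes g1 - g2 integrable, as the fundamental lemma demands. *)
Lemma weak_partial_unique U i f g1 g2 : open U -> (mu U < +oo)%E ->
  L2 U g1 -> L2 U g2 -> weak_partial U i f g1 -> weak_partial U i f g2 ->
  {ae mu, forall x, U x -> g1 x = g2 x}.
Proof.
move=> oU fU h1 h2 w1 w2; have mU := open_measurable_rV oU.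
have : {ae mu, forall x, U x -> g1 x - g2 x = 0}.
  apply: fundamental_lemma => //; first by apply: L2_fin_Int => //; exact: L2B.
  move=> phi tp; have L := L2_test mU tp.
  transitivity (\int[mu]_(x in U) (g1 x * phi x - g2 x * phi x)).
    by apply: eq_Rintegral => x _; rewrite mulrBl.
  rewrite RintegralB//; [|exact: L2M|exact: L2M].
  have := w1 _ tp; rewrite (w2 _ tp) => /oppr_inj ->.
  exact: subrr.
by apply: filterS => x + Ux => /(_ Ux)/eqP; rewrite subr_eq0 => /eqP.
Qed.

Lemma wpartialP U i f : (exists g, L2 U g /\ weak_partial U i f g) ->
  L2 U (wpartial U i f) /\ weak_partial U i f (wpartial U i f).
Proof. by move=> h; have := xgetPex (cst 0) h. Qed.

(** Valid for every f: where no weak derivative exists, [wpartial] is the zero function.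
    Measurability and integrability of derivatives therefore never require a regularity
    hypothesis. *)
Lemma L2_wpartial U i f : measurable U -> L2 U (wpartial U i f).
Proof.
by move=> mU; rewrite /wpartial; case: xgetP => [g _ []//|_]; exact: L2_0.
Qed.

Lemma measurable_wpartial U i f : measurable U -> measurable_fun U (wpartial U i f).
Proof. by move=> mU; apply: L2_measurable; exact: L2_wpartial. Qed.

Lemma wpartial_eq U i f g : open U -> (mu U < +oo)%E -> L2 U g -> weak_partial U i f g ->
  {ae mu, forall x, U x -> wpartial U i f x = g x}.
Proof.
move=> oU fU hg wg.
have [h w] : L2 U (wpartial U i f) /\ weak_partial U i f (wpartial U i f).
  by apply: wpartialP; exists g.
exact: (weak_partial_unique oU fU h hg w wg).
Qed.

Lemma weak_partialB U i f g f' g' : measurable U -> L2 U f -> L2 U g -> L2 U f' -> L2 U g' ->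
  weak_partial U i f f' -> weak_partial U i g g' ->
  weak_partial U i (fun x => f x - g x) (fun x => f' x - g' x).
Proof.
move=> mU hf hg hf' hg' wf wg phi tp; have L := L2_test mU tp.
have L' := L2_test mU (test_cpartial i tp).
transitivity (\int[mu]_(x in U) (f x * cpartial i phi x - g x * cpartial i phi x)).
  by apply: eq_Rintegral => x _; rewrite mulrBl.
rewrite RintegralB//; [|exact: L2M|exact: L2M].
rewrite wf// wg// -opprD; congr (- _); rewrite -RintegralB//; [|exact: L2M|exact: L2M].
by apply: eq_Rintegral => x _; rewrite mulrBl.
Qed.

Lemma weak_partialZ U i c f f' : measurable U -> L2 U f -> L2 U f' ->
  weak_partial U i f f' -> weak_partial U i (fun x => c * f x) (fun x => c * f' x).
Proof.
move=> mU hf hf' wf phi tp; have L := L2_test mU tp.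
have L' := L2_test mU (test_cpartial i tp).
transitivity (\int[mu]_(x in U) (c * (f x * cpartial i phi x))).
  by apply: eq_Rintegral => x _; rewrite mulrA.
rewrite RintegralZl//; last exact: L2M.
rewrite wf// mulrN; congr (- _); rewrite -RintegralZl//; last exact: L2M.
by apply: eq_Rintegral => x _; rewrite mulrA.
Qed.

Lemma weak_partial0 U i : measurable U -> weak_partial U i (fun=> 0) (fun=> 0).
Proof.
move=> mU phi tp; have I0 h : \int[mu]_(x in U) (0 * h x) = 0.
  rewrite -[RHS](mul0r (fine (mu U))) -(Rintegral_cst mu mU).
  by apply: eq_Rintegral => x _; rewrite mul0r.
by rewrite !I0 oppr0.
Qed.

Lemma weak_partial_ae U i f g f' g' : measurable U -> measurable_fun U f -> measurable_fun U g ->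
  measurable_fun U f' -> measurable_fun U g' ->
  {ae mu, forall x, U x -> f x = f' x} -> {ae mu, forall x, U x -> g x = g' x} ->
  weak_partial U i f g -> weak_partial U i f' g'.
Proof.
move=> mU mf mg mf' mg' ff' gg' w phi tp; have m1 := test_measurable_on (U := U) tp.
have m2 := test_measurable_on (U := U) (test_cpartial i tp).
rewrite -(@Rintegral_ae _ _ U mU (fun x => f x * cpartial i phi x)); last 3 first.
- exact: measurable_funM.
- exact: measurable_funM.
- by apply: filterS ff' => x + Ux => ->.
rewrite w//; congr (- _); apply: Rintegral_ae => //; try exact: measurable_funM.
by apply: filterS gg' => x + Ux => ->.
Qed.

Lemma weak_partialS U V i f g : measurable U -> measurable V -> V `<=` U ->
  weak_partial U i f g -> weak_partial V i f g.
Proof.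
move=> mU mV VU w phi tp.
have t0 psi (tpsi : test_function V psi) x : U x -> ~ V x -> psi x = 0.
  by move=> _; exact: test_out tpsi.
rewrite -(@Rintegral_support _ _ U V)//; last first.
  by move=> x Ux Vx; rewrite (t0 _ (test_cpartial i tp))// mulr0.
rewrite w; last exact: test_functionS tp.
congr (- _); rewrite (@Rintegral_support _ _ U V)//.
by move=> x Ux Vx; rewrite (t0 _ tp)// mulr0.
Qed.

Lemma L2S U V f : measurable U -> measurable V -> V `<=` U -> L2 U f -> L2 V f.
Proof.
move=> mU mV VU [mf hf]; split; first exact: measurable_funS mf.
exact: integrableS hf.
Qed.

Lemma cpartialM g phi i x : derivable g x (basis_vec i) -> derivable phi x (basis_vec i) ->
  cpartial i (fun y => g y * phi y) x = g x * cpartial i phi x + cpartial i g x * phi x.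
Proof.
move=> dg dp; rewrite /cpartial; have := deriveM dg dp.
by rewrite /GRing.scale/= => h; rewrite -[LHS]/('D_(basis_vec i) (g * phi) x) h [X in _ + X]mulrC.
Qed.

(** Although g may be irregular outside U, g phi is a test function on the whole space, so the
    integral of its partial derivative is zero; the product rule does the rest. *)
Lemma weak_partial_smooth U i g : open U -> smooth_on U g ->
  weak_partial U i g (cpartial i g).
Proof.
move=> oU sg phi tp; have mU := open_measurable_rV oU.
have tgp := test_mul_smooth oU sg tp.
have t1 := test_mul_smooth oU sg (test_cpartial i tp).
have t2 := test_mul_smooth oU (smooth_on_cpartial i sg) tp.
apply/eqP; rewrite -addr_eq0 -RintegralD ?(test_Int mU t1) ?(test_Int mU t2)//.
have -> : \int[mu]_(x in U) (g x * cpartial i phi x + cpartial i g x * phi x) =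
    \int[mu]_(x in U) cpartial i (fun y => g y * phi y) x.
  apply: eq_Rintegral => x /set_mem Ux; rewrite cpartialM//.
    exact: (smooth_on_derivable sg).
  exact: (smooth_on_derivable tp.1).
rewrite -(@Rintegral_support _ _ setT U)//.
  by rewrite /Rintegral (integral_cpartial_test i tgp).
by move=> x _; exact: test_out (test_cpartial i tgp).
Qed.

(** For a test function psi, the weak derivative of f is tested with phi psi. *)
Lemma weak_partial_mul_test U i f f' phi : open U -> L2 U f -> L2 U f' ->
  weak_partial U i f f' -> test_function U phi ->
  weak_partial U i (fun x => f x * phi x) (fun x => f' x * phi x + f x * cpartial i phi x).
Proof.
move=> oU hf hf' w tp psi tpsi; have mU := open_measurable_rV oU.
have tpp : test_function U (fun x => phi x * psi x).
  by apply: test_mul_smooth => //; apply: smooth_onS tp.1.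
have tdp := test_cpartial i tp; have tdpsi := test_cpartial i tpsi.
have L h k (th : test_function U h) (tk : test_function U k) f0 (h0 : L2 U f0) :
    Int U (fun x => f0 x * h x * k x).
  by apply: L2M => //; [exact: L2_mul_test th|exact: L2_test tk].
apply/eqP; rewrite -addr_eq0 -RintegralD//; last 2 first.
- exact: L.
- by rewrite (_ : (fun x => _) = (fun x => f' x * phi x * psi x + f x * cpartial i phi x * psi x));
    [apply: IntD => //; exact: L|apply/funext => x; rewrite mulrDl].
rewrite (@eq_Rintegral _ _ _ mu U (fun x => f x * cpartial i (fun y => phi y * psi y) x +
    f' x * (phi x * psi x))).
  rewrite RintegralD//; last 2 first.
  - by apply: L2M => //; exact: L2_test (test_cpartial i tpp).
  - by apply: L2M => //; exact: L2_test tpp.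
  by rewrite w// addNr.
move=> x _; rewrite cpartialM; last 2 first.
- exact: (smooth_on_derivable tp.1).
- exact: (smooth_on_derivable tpsi.1).
by ring.
Qed.

Section H1.
Variable U : set X.
Hypotheses (oU : open U) (fU : (mu U < +oo)%E).
Let mU : measurable U := open_measurable_rV oU.

Lemma H1_L2 f : H1 U f -> L2 U f. Proof. by case. Qed.

Lemma H1_weak i f : H1 U f -> weak_partial U i f (wpartial U i f).
Proof. by case=> _ /(_ i) /wpartialP[]. Qed.

Lemma H1B f g : H1 U f -> H1 U g -> H1 U (fun x => f x - g x).
Proof.
move=> hf hg; split; first by apply: L2B => //; exact: H1_L2.
move=> i; exists (fun x => wpartial U i f x - wpartial U i g x); split.
  by apply: L2B => //; exact: L2_wpartial.
by apply: weak_partialB => //; try exact: H1_L2; try exact: L2_wpartial; exact: H1_weak.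
Qed.

Lemma H1Z c f : H1 U f -> H1 U (fun x => c * f x).
Proof.
move=> hf; split; first by apply: L2Z => //; exact: H1_L2.
move=> i; exists (fun x => c * wpartial U i f x); split.
  by apply: L2Z => //; exact: L2_wpartial.
by apply: weak_partialZ => //; [exact: H1_L2|exact: L2_wpartial|exact: H1_weak].
Qed.

Lemma wpartialB i f g : H1 U f -> H1 U g ->
  {ae mu, forall x, U x -> wpartial U i (fun y => f y - g y) x = wpartial U i f x - wpartial U i g x}.
Proof.
move=> hf hg; apply: wpartial_eq => //; first by apply: L2B => //; exact: L2_wpartial.
by apply: weak_partialB => //; try exact: H1_L2; try exact: L2_wpartial; exact: H1_weak.
Qed.

Lemma wpartial0 i : {ae mu, forall x, U x -> wpartial U i (fun=> 0) x = 0}.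
Proof. by apply: wpartial_eq => //; [exact: L2_0|exact: weak_partial0]. Qed.

Lemma wpartial_test i phi : test_function U phi ->
  {ae mu, forall x, U x -> wpartial U i phi x = cpartial i phi x}.
Proof.
move=> tp; apply: wpartial_eq => //; first exact: L2_test (test_cpartial i tp).
by apply: weak_partial_smooth => //; exact: smooth_onS tp.1.
Qed.

Lemma H1_test phi : test_function U phi -> H1 U phi.
Proof.
move=> tp; split; first exact: L2_test tp.
move=> i; exists (cpartial i phi); split; first exact: L2_test (test_cpartial i tp).
by apply: weak_partial_smooth => //; exact: smooth_onS tp.1.
Qed.

Lemma L2norm_ge0 f : 0 <= L2norm U f. Proof. exact: sqrtr_ge0. Qed.

Lemma L2norm_ae f g : measurable_fun U f -> measurable_fun U g ->
  {ae mu, forall x, U x -> f x = g x} -> L2norm U f = L2norm U g.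
Proof.
move=> mf mg fg; congr Num.sqrt; apply: Rintegral_ae => //; try exact: measurable_funX.
by apply: filterS fg => x + Ux => ->.
Qed.

Lemma L2norm_le_H1norm f : L2norm U f <= H1norm U f.
Proof.
rewrite -[leLHS]ger0_norm ?L2norm_ge0// -sqrtr_sqr ler_sqrt.
  by rewrite lerDl sumr_ge0// => i _; exact: sqr_ge0.
by rewrite addr_ge0 ?sqr_ge0// sumr_ge0// => i _; exact: sqr_ge0.
Qed.

Lemma wpartial_le_H1norm i f : L2norm U (wpartial U i f) <= H1norm U f.
Proof.
rewrite -[leLHS]ger0_norm ?L2norm_ge0// -sqrtr_sqr ler_sqrt.
  rewrite (bigD1 i)//= addrCA lerDl addr_ge0 ?sqr_ge0// sumr_ge0// => j _; exact: sqr_ge0.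
by rewrite addr_ge0 ?sqr_ge0// sumr_ge0// => j _; exact: sqr_ge0.
Qed.

Lemma H1norm0 : H1norm U (fun=> 0) = 0.
Proof.
have L0 : L2norm U (fun=> 0) = 0.
  rewrite /L2norm -[in RHS]sqrtr0; congr Num.sqrt; rewrite -[RHS](mul0r (fine (mu U))).
  rewrite -(Rintegral_cst mu mU); apply: eq_Rintegral => x _; exact: expr0n.
rewrite /H1norm L0 big1; first by rewrite expr0n addr0 sqrtr0.
move=> i _; rewrite (@L2norm_ae _ (fun=> 0)) ?L0 ?expr0n//.
  exact: measurable_wpartial.
exact: wpartial0.
Qed.

Lemma H10_test phi : test_function U phi -> H10 U phi.
Proof.
move=> tp; split; first exact: H1_test.
by move=> e e0; exists phi; split => //; rewrite subrr (_ : 0 = fun=> 0)// H1norm0.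
Qed.

(* By density of the test functions in H^1_0. *)
Lemma weak_partial_H10 i f g eta : L2 U f -> L2 U g -> weak_partial U i f g -> H10 U eta ->
  \int[mu]_(x in U) (f x * wpartial U i eta x) = - \int[mu]_(x in U) (g x * eta x).
Proof.
move=> hf hg w [he de]; apply/eqP; rewrite -addr_eq0; set c := _ + _.
have C0 : 0 <= L2norm U f + L2norm U g by rewrite addr_ge0// L2norm_ge0.
suff : forall eps : R, 0 < eps -> `|c| <= (L2norm U f + L2norm U g) * eps.
  move=> h; apply/negPn/negP; rewrite -normr_gt0 => c0.
  have := h (`|c| / (2 * (L2norm U f + L2norm U g + 1))).
  rewrite divr_gt0// ?mulr_gt0// ?ltr_wpDl// => /(_ isT).
  rewrite mulrCA -{1}[`|c|]mulr1 ler_pM2l// ler_pdivlMr; last by rewrite mulr_gt0// ltr_wpDl.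
  by lra.
move=> eps e0; have [phi [tp /ltW hphi]] := de _ e0.
have Le := H1_L2 he; have Lp := L2_test mU tp; have H1p := H1_test tp.
have Ld := L2_wpartial i eta mU; have Ldp := L2_test mU (test_cpartial i tp).
have Le' : L2 U (fun x => eta x - phi x) := L2B mU Le Lp.
have Ld' : L2 U (fun x => wpartial U i eta x - cpartial i phi x) := L2B mU Ld Ldp.
have -> : c = \int[mu]_(x in U) (f x * (wpartial U i eta x - cpartial i phi x)) +
    \int[mu]_(x in U) (g x * (eta x - phi x)).
  have IB h k l : L2 U h -> L2 U k -> L2 U l -> \int[mu]_(x in U) (h x * (k x - l x)) =
      \int[mu]_(x in U) (h x * k x) - \int[mu]_(x in U) (h x * l x).
    move=> Lh Lk Ll; rewrite -RintegralB//; [|exact: L2M|exact: L2M].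
    by apply: eq_Rintegral => x _; rewrite mulrBr.
  by rewrite !IB// w// /c; ring.
rewrite (le_trans (ler_normD _ _))// mulrDl lerD//.
  rewrite (le_trans (cauchy_schwarz mU hf Ld'))// ler_wpM2l ?L2norm_ge0//.
  rewrite (le_trans _ hphi)// (le_trans _ (wpartial_le_H1norm i _))//.
  rewrite (@L2norm_ae _ (wpartial U i (eta - phi)))//.
  - exact: L2_measurable Ld'.
  - exact: measurable_wpartial.
  - have := wpartialB i he H1p; apply: filterS2 (wpartial_test i tp) => x h1 h2 Ux.
    by rewrite -(h1 Ux) -(h2 Ux).
rewrite (le_trans (cauchy_schwarz mU hg Le'))// ler_wpM2l ?L2norm_ge0//.
by rewrite (le_trans _ hphi)// (le_trans _ (L2norm_le_H1norm _)).
Qed.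

End H1.
End weak_derivatives.

(** * Mapped rational functions are smooth up to the boundary *)

Section C1_differentiable.
Context {R : realType} {n : nat}.
Local Notation X := 'rV[R]_n.
Implicit Types (U V W A : set X) (f g : X -> R) (i j : 'I_n).

(** The increment of g is o(h), so the zero map is a differential of g at x. *)
Lemma differentiable_small (g : X -> R) (x : X) :
  (forall e : R, 0 < e -> \forall h \near (0 : X), `|g (h + x) - g x| <= e * `|h|) ->
  differentiable g x.
Proof.
move=> hg.
have E : g \o shift x = cst (g x) + (\0 : X -> R) +o_ (0 : X) id.
  apply/eqaddoP => e e0; have := hg e e0; apply: filterS => h.
  by rewrite !fctE/= addr0.
apply/diff_locallyP.
have c0 : continuous (\0 : X -> R) by move=> y; exact: (@cst_continuous _ _ 0).
by rewrite (diff_unique c0 E).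
Qed.

(** The vertices of the path from 0 to h that moves along one coordinate axis at a time. *)
Definition head_part (h : X) (k : nat) : X := \row_i (if (i < k)%N then h 0 i else 0).

Lemma head_partS h (k : 'I_n) : head_part h k.+1 = head_part h k + h 0 k *: basis_vec k.
Proof.
apply/rowP => i; rewrite !mxE eqxx/= ltnS leq_eqVlt.
have [->|ik] := eqVneq i k; first by rewrite eqxx/= ltnn add0r mulr1.
by rewrite val_eqE (negbTE ik)/= mulr0 addr0.
Qed.

(** [smooth_on] speaks of partial derivatives only. After the linear map L with the same partial
    derivatives at x is subtracted, those of the remainder g vanish at x and are small nearby. The
    increment of g telescopes along the axis-parallel path, and the mean value theorem bounds each
    leg. *)
Lemma smooth_on_differentiable U f x : open U -> smooth_on U f -> U x -> differentiable f x.
Proof.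
move=> oU sf Ux; pose c i := cpartial i f x.
pose L (y : X) := \sum_i c i * y 0 i; pose g y := f y + - 1 * L y.
have sL : smooth_on U L.
  by apply: smooth_on_sum => [|i _]; [exact: oU|exact: (smooth_onZ (c i) oU (smooth_on_coord i oU))].
have LE : L = \sum_i (c i *: (fun y : X => y 0 i)).
  by apply/funext => y; rewrite /L fct_sumE.
have dL : differentiable L x.
  rewrite LE; apply: differentiable_sum => i; apply: differentiableZ.
  exact: differentiable_coord.
have sg : smooth_on U g := smooth_onD oU sf (smooth_onZ (-1) oU sL).
have -> : f = g + L by apply/funext => y; rewrite /g fctE mulN1r subrK.
apply: differentiableD; last exact: dL.
apply: differentiable_small => e e0.
have g0 i : cpartial i g x = 0.
  have : is_derive x (basis_vec i) L (\sum_k c k *: (basis_vec i : X) 0 k).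
    rewrite LE; apply: is_derive_sum => k.
    by have h := is_derive_coord k x (basis_vec i); exact: is_deriveZ.
  have -> : \sum_k c k *: (basis_vec i : X) 0 k = c i.
    rewrite (bigD1 i)//= big1 ?addr0 => [|k ki]; first by rewrite mxE !eqxx [_ *: _]mulr1.
    by rewrite mxE eqxx (negbTE ki) [_ *: _]mulr0.
  move=> dLi; have dfi : is_derive x (basis_vec i) f (c i).
    by split => //; exact: (smooth_on_derivable sf).
  have gE : g = f - L by apply/funext => y; rewrite /g mulN1r.
  have := @is_deriveB _ _ _ _ _ _ _ _ _ dfi dLi; rewrite subrr => -[_].
  by rewrite /cpartial gE.
(* The n legs contribute n r |h| <= e |h|; dividing by n + 1 avoids a zero denominator in dimension
   0. *)
pose r : R := e / n.+1%:R; have r0 : 0 < r by rewrite divr_gt0// ltr0n.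
have near_i i : \forall y \near x, `|cpartial i g y| <= r.
  have := smooth_on_continuous (smooth_on_cpartial i sg) Ux.
  rewrite /prop_for /continuous_at g0 => /cvgrPdist_le/(_ _ r0).
  by apply: filterS => y; rewrite sub0r normrN.
have : \forall y \near x, U y /\ forall i, `|cpartial i g y| <= r.
  by apply: filterI; [exact: open_nbhs_nbhs|
    exact: (@filter_forall _ _ (fun i y => `|cpartial i g y| <= r) _ _ near_i)].
move=> /nbhs_ballP[d /= d0 hd]; apply/nbhs_ballP; exists d => //= h.
rewrite mx_norm_ball /ball_/= sub0r normrN => hlt.
have hd' (y : X) : `|y| <= `|h| -> U (x + y) /\ forall i, `|cpartial i g (x + y)| <= r.
  move=> yh; apply: hd; rewrite mx_norm_ball /ball_/= opprD addrA subrr sub0r normrN.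
  exact: le_lt_trans yh hlt.
have hsmall (k : 'I_n) s : `|s| <= `|h 0 k| -> `|head_part h k + s *: basis_vec k| <= `|h|.
  move=> sh; apply/(mx_norm_leP _ (normr_ge0 h)) => i; rewrite !mxE eqxx/=.
  have [->|ik] := eqVneq i k; first by rewrite ltnn add0r mulr1 (le_trans sh)// ler_norm_coord.
  by rewrite mulr0 addr0; case: ifP => _; rewrite ?normr0 ?ler_norm_coord.
have step (k : 'I_n) : `|g (x + head_part h k.+1) - g (x + head_part h k)| <= r * `|h|.
  have [s sh|s sh] := @cpartial_MVT _ _ g k (x + head_part h k) (h 0 k).
    by rewrite -addrA; apply: (smooth_on_derivable sg); case: (hd' _ (hsmall _ _ sh)).
  rewrite head_partS addrA => ->; rewrite normrM mulrC ler_pM ?ler_norm_coord//.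
  by rewrite -addrA; case: (hd' _ (hsmall _ _ sh)).
have -> : g (h + x) - g x = \sum_(k < n) (g (x + head_part h k.+1) - g (x + head_part h k)).
  rewrite -(big_mkord xpredT (fun k => g (x + head_part h k.+1) - g (x + head_part h k))).
  rewrite telescope_sumr//; congr (g _ - g _).
    by rewrite addrC; congr (_ + _); apply/rowP => i; rewrite mxE ltn_ord.
  by rewrite -[LHS]addr0; congr (_ + _); apply/rowP => i; rewrite !mxE.
rewrite (le_trans (ler_norm_sum _ _ _))//.
rewrite (@le_trans _ _ (\sum_(k < n) (r * `|h|)))//; first by apply: ler_sum => k _; exact: step.
rewrite sumr_const card_ord -mulr_natl /r mulrA ler_wpM2r//.
rewrite mulrCA -[leRHS]mulr1; apply: ler_wpM2l; first exact: ltW.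
by rewrite ler_pdivrMr ?ltr0n// mul1r ler_nat.
Qed.

End C1_differentiable.

Section element_maps.
Context {R : realType} {n : nat}.
Local Notation X := 'rV[R]_n.
Implicit Types (U V W A : set X) (f g : X -> R) (F G : X -> X) (i j : 'I_n).

Lemma smooth_map_differentiable U F x : open U -> (forall i, smooth_on U (vcomp F i)) ->
  U x -> differentiable F x.
Proof.
move=> oU sF Ux.
have -> : F = \sum_i (fun y => vcomp F i y *: (basis_vec i : X)).
  apply/funext => y; rewrite fct_sumE; apply/rowP => k.
  rewrite summxE (bigD1 k)//= big1 ?addr0 => [|i ik]; first by rewrite !mxE !eqxx mulr1.
  by rewrite !mxE eqxx eq_sym (negbTE ik) mulr0.
apply: differentiable_sum => i; apply: differentiableZl.
exact: smooth_on_differentiable (sF i) Ux.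
Qed.

Lemma jacobianE F x i j : differentiable F x ->
  jacobian F x i j = cpartial i (vcomp F j) x.
Proof.
move=> dF; have := deriveEjacobian (basis_vec i) dF.
rewrite -rowE derive_mx; last exact: diff_derivable.
by move=> /rowP/(_ j); rewrite !mxE.
Qed.

(** The chain rule for F o G = id near x. A [jacobian] acts on row vectors from the right, so that
    of the inner map G comes first. *)
Lemma jacobian_inverse F G x : differentiable F (G x) -> differentiable G x ->
  {near x, F \o G =1 id} -> jacobian G x *m jacobian F (G x) = 1%:M.
Proof.
move=> dF dG FG; apply/row_matrixP => i; rewrite !rowE mulmx1 mulmxA.
rewrite -(deriveEjacobian _ dG) -(deriveEjacobian _ dF).
rewrite (deriveE _ dG) (deriveE _ dF).
have dFG : differentiable (F \o G) x := differentiable_comp dG dF.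
have := deriveE (delta_mx 0 i) dFG.
rewrite (near_eq_derive _ FG) (_ : 'D__ id x = delta_mx 0 i); last exact: derive_id.
have h := congr1 (fun k => k (delta_mx 0 i)) (diff_comp dG dF).
by move=> e; rewrite [RHS]e; symmetry; exact: h.
Qed.

(* The Piola transform is polynomial in the entries of r and of the jacobian of
   the inverse map, so no division is needed when pulling it back. *)
Lemma piola_adj (r : 'rV[R]_n) (JG JF : 'M[R]_n) : JG *m JF = 1%:M ->
  (\det JF)^-1 *: (r *m JF) = r *m \adj JG.
Proof.
move=> J1; have d1 : \det JG * \det JF = 1 by rewrite -det_mulmx J1 det1.
have dF0 : \det JF != 0.
  by apply/eqP => d0; move: d1; rewrite d0 mulr0 => /esym/eqP; rewrite oner_eq0.
have -> : (\det JF)^-1 = \det JG by apply: (mulIf dF0); rewrite mulVf.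
rewrite scalemxAr; congr (_ *m _).
by rewrite -[RHS]mulmx1 -J1 mulmxA mul_adj_mx mul_scalar_mx.
Qed.

Lemma smooth_on_det U m (A : X -> 'M[R]_m) : open U ->
  (forall k l : 'I_m, smooth_on U (fun x => A x k l)) -> smooth_on U (fun x => \det (A x)).
Proof.
move=> oU sA; apply: smooth_on_sum => [|s _]; first exact: oU.
apply: (smooth_onM oU (smooth_on_cst _ oU)).
by apply: smooth_on_prod => [|k _]; [exact: oU|exact: sA].
Qed.

Lemma smooth_on_adj U m (A : X -> 'M[R]_m) : open U ->
  (forall k l : 'I_m, smooth_on U (fun x => A x k l)) ->
  forall k l : 'I_m, smooth_on U (fun x => (\adj (A x)) k l).
Proof.
move=> oU sA i j.
have -> : (fun x => (\adj (A x)) i j) =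
    (fun x => (-1) ^+ (j + i) * \det (row' j (col' i (A x)))).
  by apply/funext => x; rewrite mxE.
apply: (smooth_onM oU (smooth_on_cst _ oU)); apply: (smooth_on_det oU) => k l.
have -> : (fun x => row' j (col' i (A x)) k l) = (fun x => A x (lift j k) (lift i l)).
  by apply/funext => x; rewrite !mxE.
exact: sA.
Qed.

Lemma smooth_on_meval U G (P : mpoly.mpoly n R) : open U ->
  (forall i, smooth_on U (vcomp G i)) ->
  smooth_on U (fun x => mpoly.meval (fun i => G x 0 i) P).
Proof.
move=> oU sG.
have -> : (fun x => mpoly.meval (fun i => G x 0 i) P) =
    (fun x => \sum_(m <- mpoly.msupp P) mpoly.mcoeff m P *
      \prod_i (vcomp G i x) ^+ (mpoly.fun_of_multinom m i)).
  by apply/funext => x; rewrite mpoly.mevalE.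
apply: smooth_on_sum => [|m _]; first exact: oU.
apply: (smooth_onM oU (smooth_on_cst _ oU)).
apply: smooth_on_prod => [|i _]; first exact: oU.
exact: (smooth_onX _ oU (sG i)).
Qed.

Lemma smooth_near_all A (I : finType) (f : I -> X -> R) :
  (forall k : I, smooth_near A (f k)) ->
  exists U, [/\ open U, A `<=` U & forall k : I, smooth_on U (f k)].
Proof.
move=> /choice[U hU]; exists (\bigcap_(i in [set: I]) U i); split.
- rewrite openE => x Ux; rewrite /interior.
  have H (k : I) : nbhs x (U k) by apply: open_nbhs_nbhs; split; [case: (hU k)|exact: Ux].
  by apply: filterS (@filter_forall X I U _ _ H) => y hy k _; exact: hy.
- by move=> x Ax i _; case: (hU i) => _ + _; apply.
- by move=> i; case: (hU i) => _ _; apply: smooth_onS => x; apply.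
Qed.

(** The denominator is known to be nonzero on B only; by continuity it stays nonzero after
    composition with G on an open neighbourhood of A, where the quotient is smooth. *)
Lemma smooth_near_rational A B G (r : X -> R) : rational_on B r ->
  (forall i, smooth_near A (vcomp G i)) -> (forall x, A x -> B (G x)) ->
  exists2 g, smooth_near A g & forall x, A x -> r (G x) = g x.
Proof.
move=> [P [Q hr]] /smooth_near_all[U [oU AU sG]] AB.
pose num x := mpoly.meval (fun i => G x 0 i) P.
pose den x := mpoly.meval (fun i => G x 0 i) Q.
have sn : smooth_on U num := smooth_on_meval P oU sG.
have sd : smooth_on U den := smooth_on_meval Q oU sG.
pose V := U `&` [set x | den x != 0].
have oV : open V.
  rewrite openE => x [Ux dx]; rewrite /interior; apply: filterI; first exact: open_nbhs_nbhs.
  have := smooth_on_continuous sd Ux.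
  move=> /(_ [set y | y != 0]); apply; apply: open_nbhs_nbhs; split.
    exact: open_neq.
  exact: dx.
have VU : V `<=` U by move=> x [].
exists (fun x => num x * (den x)^-1); last by move=> x /AB/hr[_ ->].
exists V; split => //; first by move=> x Ax; split; [exact: AU|case: (hr _ (AB _ Ax))].
apply: (smooth_onM oV (smooth_onS VU sn)); apply: (smooth_onV oV (smooth_onS VU sd)).
by move=> x [].
Qed.

Lemma smooth_nearD A f g : smooth_near A f -> smooth_near A g ->
  smooth_near A (fun x => f x + g x).
Proof.
move=> [U [oU AU sf]] [V [oV AV sg]]; exists (U `&` V); split; first exact: openI.
  by move=> x Ax; split; [exact: AU|exact: AV].
by apply: (smooth_onD (openI oU oV)); [apply: smooth_onS sf|apply: smooth_onS sg] => x [].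
Qed.

Lemma smooth_nearM A f g : smooth_near A f -> smooth_near A g ->
  smooth_near A (fun x => f x * g x).
Proof.
move=> [U [oU AU sf]] [V [oV AV sg]]; exists (U `&` V); split; first exact: openI.
  by move=> x Ax; split; [exact: AU|exact: AV].
by apply: (smooth_onM (openI oU oV)); [apply: smooth_onS sf|apply: smooth_onS sg] => x [].
Qed.

Lemma smooth_near_cst A c : smooth_near A (fun=> c).
Proof. by exists setT; split; [exact: openT|by []|exact: (smooth_on_cst c openT)]. Qed.

Lemma smooth_near_sum A (I : Type) (r : seq I) (F : I -> X -> R) :
  (forall k, smooth_near A (F k)) -> smooth_near A (fun x => \sum_(k <- r) F k x).
Proof.
move=> sF; elim: r => [|k r IH].
  rewrite (_ : (fun x => _) = fun=> 0); first exact: smooth_near_cst.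
  by apply/funext => x; rewrite big_nil.
rewrite (_ : (fun x => _) = (fun x => F k x + \sum_(l <- r) F l x)).
  exact: (smooth_nearD (sF k) IH).
by apply/funext => x; rewrite big_cons.
Qed.

Lemma smooth_near_cpartial A f i : smooth_near A f -> smooth_near A (cpartial i f).
Proof.
by move=> [U [oU AU sf]]; exists U; split; [exact: oU|exact: AU|exact: smooth_on_cpartial].
Qed.

End element_maps.

Section mapped_fields.
Context {R : realType} {n : nat}.
Local Notation X := 'rV[R]_n.
Local Notation mu := (lebesgue_rV R n).
Variables (K E : set X) (F G : X -> X).
Hypothesis FG : element_map K E F G.
Hypothesis oE : open E.

Let GE x : closure E x -> closure K (G x) /\ F (G x) = x.
Proof.
by case: FG => _ [_ <-] _ _ GF [y Ky <-]; rewrite GF.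
Qed.

(** Under either pull-back, v coincides on the element with a field smooth up to its boundary: the
    components of r o G are rational functions of a smooth map, and the Piola factor becomes the
    adjugate of the derivative of G. Boundedness of discrete velocities and of their gradients rests
    on this. *)
Lemma mapped_smooth_near (v : X -> X) (r : X -> X) :
  (forall i, rational_on (closure K) (vcomp r i)) ->
  ({ae mu, forall x, E x -> v x = r (G x)} \/
   {ae mu, forall x, E x ->
      v x = (\det (jacobian F (G x)))^-1 *: (r (G x) *m jacobian F (G x))}) ->
  forall i, exists2 g, smooth_near (closure E) g &
    {ae mu, forall x, E x -> vcomp v i x = g x}.
Proof.
case: (FG) => [[oK cK] [FK FcK] sF sG GF] hr hv i.
have rG j : exists2 g, smooth_near (closure E) g &
    forall x, closure E x -> vcomp r j (G x) = g x.
  by apply: smooth_near_rational (hr j) sG _ => x /GE[].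
case: hv => hv.
  have [g sg Eg] := rG i; exists g => //; apply: filterS hv => x + Ex => /(_ Ex) h.
  by rewrite /vcomp h; apply: Eg; exact: subset_closure.
have /choice[g hg] : forall j, exists g : X -> R, smooth_near (closure E) g /\
    forall x, closure E x -> vcomp r j (G x) = g x.
  by move=> j; have [g sg Eg] := rG j; exists g.
have [U [oU EU sGU]] := smooth_near_all sG.
have [V [oV KV sFV]] := smooth_near_all sF.
(* The same matrix as [jacobian G] on the element, in a form whose entries are visibly smooth. *)
pose J x : 'M[R]_n := \matrix_(k, l) cpartial k (vcomp G l) x.
exists (fun x => \sum_j g j x * (\adj (J x)) j i).
  apply: smooth_near_sum => j; apply: smooth_nearM; first by case: (hg j).
  exists U; split => //; apply: (smooth_on_adj oU) => k l.
  have -> : (fun x => J x k l) = cpartial k (vcomp G l) by apply/funext => x; rewrite mxE.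
  exact: smooth_on_cpartial.
apply: filterS hv => x + Ex => /(_ Ex) h.
have cEx : closure E x by exact: subset_closure.
have dG : differentiable G x by apply: (smooth_map_differentiable oU sGU); exact: EU.
have dF : differentiable F (G x).
  by apply: (smooth_map_differentiable oV sFV); apply: KV; case: (GE cEx).
have JE : jacobian G x = J x by apply/matrixP => k l; rewrite jacobianE// mxE.
have J1 : J x *m jacobian F (G x) = 1%:M.
  rewrite -JE; apply: jacobian_inverse => //.
  near=> y; have Ey : E y by near: y; exact: open_nbhs_nbhs.
  by case: (GE (subset_closure Ey)).
rewrite /vcomp h (piola_adj _ J1) mxE; apply: eq_bigr => j _; congr (_ * _).
by case: (hg j) => _ <-.
Unshelve. all: by end_near. Qed.

End mapped_fields.

(** * Integration by parts in H^1_0 *)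

Lemma lt_sqr_double (R : realFieldType) (a b c e : R) : 0 <= b -> 0 <= c ->
  b < e / 2 -> c < e / 2 -> a ^+ 2 <= 2 * (b ^+ 2 + c ^+ 2) -> a < e.
Proof. by move=> b0 c0 be ce h; rewrite ltNge; apply/negP => ea; nra. Qed.

Section sobolev.
Context {R : realType} {n : nat}.
Local Notation X := 'rV[R]_n.
Local Notation mu := (lebesgue_rV R n).
Local Notation Int U f := (mu.-integrable U (EFin \o f)).
Implicit Types (f g h v eta phi psi : X -> R) (i j : 'I_n).

Section domain.
Variable U : set X.
Hypotheses (oU : open U) (fU : (mu U < +oo)%E).
Let mU : measurable U := open_measurable_rV oU.

Lemma testB phi psi : test_function U phi -> test_function U psi ->
  test_function U (fun x => phi x - psi x).
Proof.
move=> [s1 [c1 h1]] [s2 [c2 h2]].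
set A := closure _ in c1 h1; set B := closure _ in c2 h2.
have s : smooth_on setT (fun x => phi x - psi x).
  have -> : (fun x => phi x - psi x) = (fun x => phi x + (-1) * psi x).
    by apply/funext => x; rewrite mulN1r.
  exact: (smooth_onD openT s1 (smooth_onZ (-1) openT s2)).
apply: (@test_functionP _ _ U _ (A `|` B) s (compactU c1 c2)).
  by move=> x [/h1|/h2].
move=> x /= h; apply: contrapT => /not_orP[Ax Bx]; move/eqP: h; apply.
have -> : phi x = 0 by apply/eqP/negPn/negP => p0; apply: Ax; exact: subset_closure.
have -> : psi x = 0 by apply/eqP/negPn/negP => p0; apply: Bx; exact: subset_closure.
exact: subrr.
Qed.

Lemma L2norm_sqrB f g : L2 U f -> L2 U g ->
  L2norm U (fun x => f x - g x) ^+ 2 <= 2 * (L2norm U f ^+ 2 + L2norm U g ^+ 2).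
Proof.
move=> hf hg; rewrite !L2normE//; last exact: L2B.
rewrite -RintegralD//; [|exact: hf.2|exact: hg.2].
have h : Int U (fun x => f x ^+ 2 + g x ^+ 2) := IntD mU hf.2 hg.2.
rewrite -RintegralZl//; apply: le_Rintegral => //.
- by have [] := L2B mU hf hg.
- exact: IntZ.
- by move=> x _; have := sqr_ge0 (f x + g x); lra.
Qed.

Lemma H1norm_sqrE f : H1norm U f ^+ 2 =
  L2norm U f ^+ 2 + \sum_i L2norm U (wpartial U i f) ^+ 2.
Proof.
by rewrite sqr_sqrtr// addr_ge0 ?sqr_ge0// sumr_ge0// => i _; exact: sqr_ge0.
Qed.

Lemma H1norm_ge0 f : 0 <= H1norm U f. Proof. exact: sqrtr_ge0. Qed.

Lemma H1norm_sqrB f g h : h = (fun x => f x - g x) -> H1 U f -> H1 U g ->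
  H1norm U h ^+ 2 <= 2 * (H1norm U f ^+ 2 + H1norm U g ^+ 2).
Proof.
move=> hE hf hg.
have aux (a b c A B C A' B' C' : R) : a = A + A' -> b = B + B' -> c = C + C' ->
    A <= 2 * (B + C) -> A' <= 2 * (B' + C') -> a <= 2 * (b + c).
  by move=> -> -> -> h1 h2; lra.
apply: (aux _ _ _ _ _ _ _ _ _ (H1norm_sqrE h) (H1norm_sqrE f) (H1norm_sqrE g)).
  by rewrite hE; exact: (L2norm_sqrB (H1_L2 hf) (H1_L2 hg)).
rewrite -big_split/= mulr_sumr; apply: ler_sum => i _.
have Lf := L2_wpartial i f mU; have Lg := L2_wpartial i g mU.
have W : L2norm U (wpartial U i h) = L2norm U (fun x => wpartial U i f x - wpartial U i g x).
  apply: L2norm_ae => //; first exact: measurable_wpartial.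
    exact: L2_measurable (L2B mU Lf Lg).
  by rewrite hE; exact: (wpartialB oU fU i hf hg).
by rewrite W; exact: (L2norm_sqrB Lf Lg).
Qed.

(** Approximating f and g to within e / 2 suffices, since the squared norm of a difference is at
    most twice the sum of the squared norms. *)
Lemma H10B f g : H10 U f -> H10 U g -> H10 U (fun x => f x - g x).
Proof.
move=> [hf df] [hg dg]; split; first exact: H1B.
move=> e e0; have e2 : 0 < e / 2 by rewrite divr_gt0.
have [phi [tp hp]] := df _ e2; have [psi [tq hq]] := dg _ e2.
exists (fun x => phi x - psi x); split; first exact: testB.
have H1p := H1B oU hf (H1_test oU tp); have H1q := H1B oU hg (H1_test oU tq).
have hE : (fun x => f x - g x) - (fun x => phi x - psi x) = (fun x => f x - phi x - (g x - psi x)).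
  by apply/funext => x; rewrite !fctE; ring.
exact: (lt_sqr_double (H1norm_ge0 _) (H1norm_ge0 _) hp hq (H1norm_sqrB hE H1p H1q)).
Qed.

(** For a test function phi, v phi has a weak derivative in L^2, so eta may be used against it by
    density. No boundedness enters at this stage, as every integrand contains phi or one of its
    derivatives. *)
Lemma weak_partial_mul_H10 i v eta : H1 U v -> H10 U eta ->
  weak_partial U i (fun x => v x * eta x)
    (fun x => wpartial U i v x * eta x + v x * wpartial U i eta x).
Proof.
move=> hv he phi tp; have Lv := H1_L2 hv; have Le := H1_L2 he.1.
have Ldv := L2_wpartial i v mU; have Lde := L2_wpartial i eta mU.
have tdp := test_cpartial i tp.
have L1 := L2_mul_test mU Lv tp; have L2' := L2_mul_test mU Ldv tp.
have L3 := L2_mul_test mU Lv tdp.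
have w := weak_partial_mul_test oU Lv Ldv (H1_weak i hv) tp.
have H := weak_partial_H10 oU fU L1 (L2D mU L2' L3) w he.
have I1 := L2M mU L1 Lde; have I2 := L2M mU L2' Le; have I3 := L2M mU L3 Le.
have E1 : \int[mu]_(x in U) ((wpartial U i v x * phi x + v x * cpartial i phi x) * eta x) =
    \int[mu]_(x in U) (wpartial U i v x * phi x * eta x) +
    \int[mu]_(x in U) (v x * cpartial i phi x * eta x).
  by rewrite -RintegralD//; apply: eq_Rintegral => x _; rewrite mulrDl.
have E2 : \int[mu]_(x in U) ((wpartial U i v x * eta x + v x * wpartial U i eta x) * phi x) =
    \int[mu]_(x in U) (wpartial U i v x * phi x * eta x) +
    \int[mu]_(x in U) (v x * phi x * wpartial U i eta x).
  by rewrite -RintegralD//; apply: eq_Rintegral => x _; ring.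
have E3 : \int[mu]_(x in U) (v x * eta x * cpartial i phi x) =
    \int[mu]_(x in U) (v x * cpartial i phi x * eta x).
  by apply: eq_Rintegral => x _; ring.
by rewrite E2 E3 H E1; ring.
Qed.

(** The bounds on v and its derivative put v eta and its weak derivative in L^2, so that a can be
    the H^1_0 function in the integration by parts. This is one summand of the skew-symmetry of c(a,
    ., .); summing over i brings out div a. *)
Lemma integral_mul_H10 i a v eta Cv Cdv : H10 U a -> H1 U v -> H10 U eta ->
  {ae mu, forall x, U x -> `|v x| <= Cv} ->
  {ae mu, forall x, U x -> `|wpartial U i v x| <= Cdv} ->
  \int[mu]_(x in U) (a x * wpartial U i v x * eta x + a x * wpartial U i eta x * v x) =
  - \int[mu]_(x in U) (wpartial U i a x * (v x * eta x)).
Proof.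
move=> ha hv he bv bdv.
have Le := H1_L2 he.1; have Lde := L2_wpartial i eta mU.
have mv := L2_measurable (H1_L2 hv); have mdv := measurable_wpartial (U := U) i v mU.
have L1 := L2M_ae_bounded mU mv bv Le; have L2' := L2M_ae_bounded mU mdv bdv Le.
have L3 := L2M_ae_bounded mU mv bv Lde.
have H := weak_partial_H10 oU fU L1 (L2D mU L2' L3) (weak_partial_mul_H10 i hv he) ha.
transitivity (- - \int[mu]_(x in U)
    ((wpartial U i v x * eta x + v x * wpartial U i eta x) * a x)).
  by rewrite opprK; apply: eq_Rintegral => x _; ring.
by rewrite -H; congr (- _); apply: eq_Rintegral => x _; ring.
Qed.

End domain.

Section subdomain.
Variables U E : set X.
Hypotheses (oU : open U) (fU : (mu U < +oo)%E) (oE : open E) (EU : E `<=` U).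
Hypothesis cE : compact (closure E).
Let mU : measurable U := open_measurable_rV oU.
Let mE : measurable E := open_measurable_rV oE.

Lemma precompact_measure_lty : (mu E < +oo)%E.
Proof.
apply: bounded_measure_lty => //; have [M [Mr h]] := compact_bounded cE.
by exists M; split => // x Mx y Ey; apply: (h _ Mx); exact: subset_closure.
Qed.

Let fE := precompact_measure_lty.

(** Smoothness is required up to the boundary, where compactness gives bounds, and modulo null sets,
    since fields and their weak derivatives are only determined up to those. *)
Definition ae_smooth h := measurable_fun E h /\
  exists2 g, smooth_near (closure E) g & {ae mu, forall x, E x -> h x = g x}.

Lemma ae_smooth_bounded h : ae_smooth h -> exists C, {ae mu, forall x, E x -> `|h x| <= C}.
Proof.
move=> [_ [g [W [oW EW sg]] hg]].
have [|C _ hC] := @compact_continuous_bounded R n (closure E) g cE.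
  by move=> x /EW; exact: (smooth_on_continuous sg).
exists C; apply: filterS hg => x + Ex => /(_ Ex) ->; apply: hC.
exact: subset_closure.
Qed.

Lemma ae_smooth_L2 h : ae_smooth h -> L2 E h.
Proof.
move=> sh; have [C hC] := ae_smooth_bounded sh.
exact: L2_ae_bounded fE sh.1 hC.
Qed.

Lemma ae_smooth_cpartial g i : smooth_near (closure E) g -> ae_smooth (cpartial i g).
Proof.
move=> sg; have sdg := smooth_near_cpartial i sg; split; last first.
  by exists (cpartial i g); [exact: sdg|exact: aeW].
have [W [oW EW sg']] := sdg; apply: continuous_measurable_rV => // x Ex.
by apply: (smooth_on_continuous sg'); apply: EW; exact: subset_closure.
Qed.

Lemma ae_smooth_weak_partial g h i : smooth_near (closure E) g -> measurable_fun E h ->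
  {ae mu, forall x, E x -> h x = g x} -> weak_partial E i h (cpartial i g).
Proof.
move=> sg mh hg; have [W [oW EW sgW]] := sg.
have sgE : smooth_on E g by apply: (smooth_onS _ sgW) => x Ex; apply: EW; exact: subset_closure.
have mg : measurable_fun E g.
  by apply: continuous_measurable_rV => // x Ex; exact: (smooth_on_continuous sgE).
have mdg := (ae_smooth_cpartial i sg).1.
have gh : {ae mu, forall x, E x -> g x = h x} by apply: filterS hg => x + Ex => ->.
have dd : {ae mu, forall x, E x -> cpartial i g x = cpartial i g x} by exact: aeW.
have w : weak_partial E i g (cpartial i g) := weak_partial_smooth i oE sgE.
exact: (weak_partial_ae mE mg mdg mh mdg gh dd w).
Qed.

Lemma ae_smooth_H1 h : ae_smooth h -> H1 E h.
Proof.
move=> sh; split; first exact: ae_smooth_L2.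
move=> i; have [mh [g sg hg]] := sh; exists (cpartial i g); split.
  exact/ae_smooth_L2/ae_smooth_cpartial.
exact: ae_smooth_weak_partial.
Qed.

(** The weak derivative on the whole domain restricts to one on E, where uniqueness identifies it
    with the classical derivative of the smooth representative. Jumps across element boundaries are
    excluded by the hypothesis that h is in H^1 of the domain. *)
Lemma ae_smooth_wpartial h i : H1 U h -> ae_smooth h -> ae_smooth (wpartial U i h).
Proof.
move=> hh [mh [g sg hg]].
have L := L2S mU mE EU (L2_wpartial i h mU).
split; first exact: L2_measurable L.
exists (cpartial i g); first exact: smooth_near_cpartial.
apply: (weak_partial_unique oE fE L (ae_smooth_L2 (ae_smooth_cpartial i sg))
  (weak_partialS mU mE EU (H1_weak i hh))).
exact: ae_smooth_weak_partial.
Qed.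

Lemma ae_smoothD f g : ae_smooth f -> ae_smooth g -> ae_smooth (fun x => f x + g x).
Proof.
move=> [mf [f' sf hf]] [mg [g' sg hg]]; split; first exact: measurable_funD.
exists (fun x => f' x + g' x); first exact: smooth_nearD.
by apply: filterS2 hf hg => x h1 h2 Ex; rewrite h1// h2.
Qed.

Lemma ae_smoothZ c f : ae_smooth f -> ae_smooth (fun x => c * f x).
Proof.
move=> [mf [f' sf hf]]; split; first exact: measurable_funM.
exists (fun x => c * f' x); first exact: (smooth_nearM (smooth_near_cst _ c) sf).
by apply: filterS hf => x h1 Ex; rewrite h1.
Qed.

Lemma H1S f : H1 U f -> H1 E f.
Proof.
move=> hf; split; first exact: L2S (H1_L2 hf).
move=> i; exists (wpartial U i f); split; first exact: L2S (L2_wpartial i f mU).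
exact: (weak_partialS mU mE EU (H1_weak i hf)).
Qed.

Lemma wpartialS f i : H1 U f -> {ae mu, forall x, E x -> wpartial E i f x = wpartial U i f x}.
Proof.
move=> hf; apply: wpartial_eq => //; first exact: L2S (L2_wpartial i f mU).
exact: (weak_partialS mU mE EU (H1_weak i hf)).
Qed.

End subdomain.
End sobolev.

(** * Euclidean products of vectors and matrices, and Young inequalities *)

Section dot_product.
Context {R : realType} {d : nat}.
Local Notation X := 'rV[R]_d.
Implicit Types x y z : X.

Lemma dotC x y : dot x y = dot y x.
Proof. by apply: eq_bigr => i _; exact: mulrC. Qed.

Lemma dotDl x y z : dot (x + y) z = dot x z + dot y z.
Proof. by rewrite -big_split/=; apply: eq_bigr => i _; rewrite mxE mulrDl. Qed.

Lemma dotNl x z : dot (- x) z = - dot x z.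
Proof. by rewrite -sumrN; apply: eq_bigr => i _; rewrite mxE mulNr. Qed.

Lemma dotBl x y z : dot (x - y) z = dot x z - dot y z.
Proof. by rewrite dotDl dotNl. Qed.

Lemma dotZr c x y : dot x (c *: y) = c * dot x y.
Proof. by rewrite mulr_sumr; apply: eq_bigr => i _; rewrite mxE; ring. Qed.

Lemma dot_ge0 x : 0 <= dot x x.
Proof. by apply: sumr_ge0 => i _; rewrite -expr2 sqr_ge0. Qed.

Lemma dot_young (c : R) x y : 0 < c -> dot x y <= c * dot x x + (4 * c)^-1 * dot y y.
Proof.
move=> c0; rewrite /dot !mulr_sumr -big_split/=; apply: ler_sum => i _.
set s := x 0 i; set t := y 0 i.
have -> : c * (s * s) + (4 * c)^-1 * (t * t) = s * t + c^-1 * (c * s - t / 2) ^+ 2.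
  by field; rewrite gt_eqF.
by rewrite lerDl mulr_ge0 ?sqr_ge0// invr_ge0 ltW.
Qed.

Lemma dot_weighted_young (c tau : R) x y : 0 < c -> 0 < tau ->
  `|dot x y| <= c * (tau * dot x x) + (4 * c)^-1 * (tau^-1 * dot y y).
Proof.
move=> c0 t0; have ct : 0 < c * tau by rewrite mulr_gt0.
have -> : c * (tau * dot x x) + (4 * c)^-1 * (tau^-1 * dot y y) =
    (c * tau) * dot x x + (4 * (c * tau))^-1 * dot y y.
  by field; rewrite !gt_eqF.
rewrite ler_norml lerNl -dotNl dot_young// andbT.
apply: le_trans (dot_young (- x) y ct) _.
by rewrite dotNl dotC dotNl opprK.
Qed.

Lemma ddot_young (S T : 'M[R]_d) : - ddot S T <= ddot S S + 4^-1 * ddot T T.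
Proof.
rewrite /ddot mulr_sumr -sumrN -big_split/=; apply: ler_sum => i _.
rewrite mulr_sumr -sumrN -big_split/=; apply: ler_sum => j _.
by have := sqr_ge0 (S i j + T i j / 2); lra.
Qed.

Lemma ddotDl (S S' T : 'M[R]_d) : ddot (S + S') T = ddot S T + ddot S' T.
Proof.
rewrite -big_split/=; apply: eq_bigr => i _; rewrite -big_split/=; apply: eq_bigr => j _.
by rewrite mxE mulrDl.
Qed.

Lemma ddotZ (c : R) (S T : 'M[R]_d) : ddot (c *: S) (c *: T) = c ^+ 2 * ddot S T.
Proof.
rewrite mulr_sumr; apply: eq_bigr => i _; rewrite mulr_sumr; apply: eq_bigr => j _.
by rewrite !mxE; ring.
Qed.

Lemma ddot_ge0 (S : 'M[R]_d) : 0 <= ddot S S.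
Proof. by apply: sumr_ge0 => i _; apply: sumr_ge0 => j _; rewrite -expr2 sqr_ge0. Qed.

End dot_product.

Section vector_L2.
Context {R : realType} {d : nat}.
Local Notation X := 'rV[R]_d.
Local Notation mu := (lebesgue_rV R d).
Local Notation Int U f := (mu.-integrable U (EFin \o f)).
Variable U : set X.
Hypothesis mU : measurable U.
Implicit Types (s t : X -> X) (S T : X -> 'M[R]_d).

Lemma Int_dot s t : vL2 U s -> vL2 U t -> Int U (fun x => dot (s x) (t x)).
Proof. by move=> hs ht; apply: Int_sum => // i _; exact: L2M (hs i) (ht i). Qed.

Lemma vL2D s t : vL2 U s -> vL2 U t -> vL2 U (fun x => s x + t x).
Proof.
move=> hs ht i; have := L2D mU (hs i) (ht i); congr L2.
by apply/funext => x; rewrite /vcomp mxE.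
Qed.

Lemma vL2B s t : vL2 U s -> vL2 U t -> vL2 U (fun x => s x - t x).
Proof.
move=> hs ht i; have := L2B mU (hs i) (ht i); congr L2.
by apply/funext => x; rewrite /vcomp !mxE.
Qed.

Lemma vL2_ae s t : (forall i, measurable_fun U (vcomp s i)) ->
  {ae mu, forall x, U x -> s x = t x} -> vL2 U t -> vL2 U s.
Proof.
move=> ms st ht i; apply: L2_ae (ms i) _ (ht i) => //.
by apply: filterS st => x + Ux => /(_ Ux); rewrite /vcomp => ->.
Qed.

Lemma vL2M_ae_bounded C (g : X -> R) s : measurable_fun U g ->
  {ae mu, forall x, U x -> `|g x| <= C} -> vL2 U s -> vL2 U (fun x => g x *: s x).
Proof.
move=> mg gC hs i; have := L2M_ae_bounded mU mg gC (hs i); congr L2.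
by apply/funext => x; rewrite /vcomp mxE.
Qed.

Lemma Int_ddot S T : (forall i j, L2 U (fun x => S x i j)) ->
  (forall i j, L2 U (fun x => T x i j)) -> Int U (fun x => ddot (S x) (T x)).
Proof.
move=> hS hT; apply: Int_sum => // i _; apply: Int_sum => // j _.
exact: L2M (hS i j) (hT i j).
Qed.

End vector_L2.

(** * Integration and almost-everywhere statements over a mesh *)

Section mesh_measure.
Context {R : realType} {d : nat}.
Local Notation X := 'rV[R]_d.
Local Notation mu := (lebesgue_rV R d).
Local Notation Int U f := (mu.-integrable U (EFin \o f)).
Variables (Omega : set X) (M : mesh R d).
Hypothesis hM : mesh_of Omega M.

Lemma mesh_open : open Omega.
Proof. by case: hM => _ _ _ ->; exact: open_interior. Qed.

Lemma elem_open e : open (elem (m := M) e).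
Proof. by case: hM => /(_ e)[]. Qed.

Lemma elem_compact e : compact (closure (elem (m := M) e)).
Proof. by case: hM => /(_ e)[]. Qed.

Lemma elem_sub e : elem (m := M) e `<=` Omega.
Proof.
case: hM => _ _ _ ->; rewrite -(open_subsetE _ (@elem_open e)) => y Ey.
by exists e => //; exact: subset_closure.
Qed.

Lemma mesh_measurable : measurable Omega.
Proof. exact: open_measurable_rV mesh_open. Qed.

Lemma elem_measurable e : measurable (elem (m := M) e).
Proof. exact: open_measurable_rV (@elem_open e). Qed.

Lemma elem_disjoint e e' x : elem (m := M) e x -> elem (m := M) e' x -> e = e'.
Proof.
move=> h h'; apply/eqP/negPn/negP => ee'; case: hM => _ _ /(_ _ _ ee') E _.
by have : set0 x by rewrite -E.
Qed.

Lemma mesh_lty : (mu Omega < +oo)%E.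
Proof.
have /choice[C hC] : forall e : 'I_(nel M), exists C,
    forall x, closure (elem (m := M) e) x -> `|x| <= C.
  move=> e; have [C [_ hC]] := compact_bounded (@elem_compact e).
  by exists (`|C| + 1) => x; apply: hC; rewrite (le_lt_trans (ler_norm C))// ltrDl.
apply: bounded_measure_lty; first exact: mesh_measurable.
exists (\sum_e `|C e|); split; first exact: num_real.
move=> y /ltW yC x; case: hM => _ _ _ -> /interior_subset[e _ Ex].
rewrite /= (le_trans _ yC)// (le_trans (hC e x Ex))//.
by rewrite (bigD1 e)//= ler_wpDr// ?sumr_ge0// ler_norm.
Qed.

Lemma elem_lty e : (mu (elem (m := M) e) < +oo)%E.
Proof.
apply: le_lt_trans mesh_lty; apply: le_measure; rewrite ?inE.
- exact: elem_measurable.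
- exact: mesh_measurable.
- exact: elem_sub.
Qed.

(** The closed elements cover the domain, and each differs from its interior element by a negligible
    set; there are finitely many of them. *)
Lemma mesh_ae_cover : {ae mu, forall x, Omega x -> exists e, elem (m := M) e x}.
Proof.
have H (e : 'I_(nel M)) : {ae mu, forall x, closure (elem (m := M) e) x -> elem (m := M) e x}.
  case: hM => /(_ e)[_ _ _ [N [mN N0 sN]]] _ _ _; exists N; split => // x /= /not_implyP h.
  exact: sN.
have : {ae mu, forall x, forall e : 'I_(nel M), closure (elem (m := M) e) x -> elem (m := M) e x}.
  exact: (@filter_forall _ _ (fun e x => closure (elem (m := M) e) x -> elem (m := M) e x) _ _ H).
apply: filterS => x h Ox; move: Ox; case: hM => _ _ _ -> /interior_subset[e _ Ex].
by exists e; exact: h.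
Qed.

Lemma mesh_ae (P : X -> Prop) : (forall e, {ae mu, forall x, elem (m := M) e x -> P x}) ->
  {ae mu, forall x, Omega x -> P x}.
Proof.
move=> H; have : {ae mu, forall x, forall e, elem (m := M) e x -> P x}.
  exact: (@filter_forall _ _ (fun e x => elem (m := M) e x -> P x) _ _ H).
move=> H'; apply: filterS2 mesh_ae_cover H' => x hc h Ox.
by have [e Ex] := hc Ox; exact: h Ex.
Qed.

Lemma ae_elem (P : X -> Prop) e : {ae mu, forall x, Omega x -> P x} ->
  {ae mu, forall x, elem (m := M) e x -> P x}.
Proof. by apply: filterS => x h /elem_sub; exact: h. Qed.

Lemma Int_elem e f : Int Omega f -> Int (elem (m := M) e) f.
Proof.
apply: integrableS; [exact: mesh_measurable|exact: elem_measurable|exact: elem_sub].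
Qed.

Lemma mesh_bounded (f : X -> R) :
  (forall e, exists C, {ae mu, forall x, elem (m := M) e x -> `|f x| <= C}) ->
  exists C, {ae mu, forall x, Omega x -> `|f x| <= C}.
Proof.
move=> /choice[C hC]; exists (\sum_e `|C e|); apply: mesh_ae => e.
apply: filterS (hC e) => x + Ex => /(_ Ex) h; rewrite (le_trans h)//.
by rewrite (bigD1 e)//= ler_wpDr// ?sumr_ge0// ler_norm.
Qed.

(** Elements are disjoint, so f agrees almost everywhere with the sum of its restrictions extended
    by zero. *)
Lemma mesh_Rintegral f : Int Omega f ->
  \int[mu]_(x in Omega) f x = \sum_e \int[mu]_(x in elem (m := M) e) f x.
Proof.
move=> hf; have mO := mesh_measurable; have mf := Int_measurable hf.
pose g e x := (f \_ (elem (m := M) e)) x.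
have mge e : measurable_fun Omega (g e).
  apply/(measurable_restrict _ (elem_measurable e) mO).
  by apply: measurable_funS mf => // x [].
have ig e : Int Omega (g e).
  apply: le_Int hf => // x Ox; rewrite /g patchE; case: ifP => _ //.
  by rewrite normr0.
have ge e : \int[mu]_(x in elem (m := M) e) f x = \int[mu]_(x in Omega) g e x.
  by rewrite -Rintegral_mkcondr setIidr//; exact: elem_sub.
under eq_bigr do rewrite ge.
rewrite -Rintegral_sum//; apply: Rintegral_ae => //.
  by apply: Int_measurable; apply: Int_sum.
apply: filterS mesh_ae_cover => x h Ox; have [e Ex] := h Ox.
rewrite (bigD1 e)//= /g patchE mem_set// big1 ?addr0// => e' ee'.
rewrite patchE memNset// => Ex'; move/eqP: ee'; apply.
exact: elem_disjoint Ex' Ex.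
Qed.

End mesh_measure.

Lemma ae_forall (R : realType) (d : nat) (I : finType) (P : I -> 'rV[R]_d -> Prop) :
  (forall i, {ae lebesgue_rV R d, forall x, P i x}) ->
  {ae lebesgue_rV R d, forall x, forall i, P i x}.
Proof. exact: filter_forall. Qed.

(** * Gradient, divergence and convection of vector fields *)

Section fields.
Context {R : realType} {d : nat}.
Local Notation X := 'rV[R]_d.
Local Notation mu := (lebesgue_rV R d).
Local Notation Int U f := (mu.-integrable U (EFin \o f)).
Variable U : set X.
Hypotheses (oU : open U) (fU : (mu U < +oo)%E).
Let mU : measurable U := open_measurable_rV oU.
Implicit Types (u v w a eta : X -> X) (q r : X -> R) (i j k : 'I_d).

Definition vH1 v := forall i, H1 U (vcomp v i).

Lemma vcompB v w i : vcomp (v - w) i = fun x => vcomp v i x - vcomp w i x.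
Proof. by apply/funext => x; rewrite /vcomp !mxE. Qed.

Lemma vH1B v w : vH1 v -> vH1 w -> vH1 (v - w).
Proof. by move=> hv hw i; rewrite vcompB; exact: H1B. Qed.

Lemma vH10B v w : vH10 U v -> vH10 U w -> vH10 U (v - w).
Proof. by move=> hv hw i; rewrite vcompB; exact: H10B. Qed.

Lemma vH10_vH1 v : vH10 U v -> vH1 v.
Proof. by move=> hv i; case: (hv i). Qed.

Lemma vH1_vL2 v : vH1 v -> vL2 U v.
Proof. by move=> hv i; exact: H1_L2. Qed.

Lemma vgradE v x i j : vgrad U v x i j = wpartial U j (vcomp v i) x.
Proof. by rewrite mxE. Qed.

Lemma advectE a v x i : advect U a v x 0 i = \sum_j a x 0 j * wpartial U j (vcomp v i) x.
Proof. by rewrite mxE; apply: eq_bigr => j _; rewrite mxE vgradE. Qed.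

Lemma divE v x : div U v x = \sum_i wpartial U i (vcomp v i) x.
Proof. by apply: eq_bigr => i _; rewrite vgradE. Qed.

Lemma symgradE v x i j : symgrad U v x i j =
  2^-1 * (wpartial U j (vcomp v i) x + wpartial U i (vcomp v j) x).
Proof. by rewrite !mxE. Qed.

Lemma vgradB v w : vH1 v -> vH1 w ->
  {ae mu, forall x, U x -> vgrad U (v - w) x = vgrad U v x - vgrad U w x}.
Proof.
move=> hv hw.
have H (k : 'I_d * 'I_d) : {ae mu, forall x, U x ->
    wpartial U k.2 (vcomp (v - w) k.1) x =
    wpartial U k.2 (vcomp v k.1) x - wpartial U k.2 (vcomp w k.1) x}.
  by rewrite vcompB; exact: wpartialB.
apply: filterS (ae_forall H) => x h Ux; apply/matrixP => i j.
by rewrite vgradE (h (i, j) Ux) !mxE.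
Qed.

Lemma symgrad_of_vgrad u v w x : vgrad U u x = vgrad U v x - vgrad U w x ->
  symgrad U u x = symgrad U v x - symgrad U w x.
Proof.
move=> h; rewrite /symgrad h; move: (vgrad U v x) (vgrad U w x) => G H.
by apply/matrixP => i j; rewrite !mxE; ring.
Qed.

Lemma advect_of_vgrad a u v w x : vgrad U u x = vgrad U v x - vgrad U w x ->
  advect U a u x = advect U a v x - advect U a w x.
Proof. by move=> h; rewrite /advect h linearB mulmxBr. Qed.

Lemma div_of_vgrad u v w x : vgrad U u x = vgrad U v x - vgrad U w x ->
  div U u x = div U v x - div U w x.
Proof. by move=> h; rewrite /div h linearB. Qed.

Lemma gradB q r : H1 U q -> H1 U r ->
  {ae mu, forall x, U x -> grad U (q - r) x = grad U q x - grad U r x}.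
Proof.
move=> hq hr.
have H (k : 'I_d) : {ae mu, forall x, U x ->
    wpartial U k (q - r) x = wpartial U k q x - wpartial U k r x}.
  exact: (wpartialB oU fU k hq hr).
by apply: filterS (ae_forall H) => x h Ux; apply/rowP => i; rewrite !mxE (h i Ux).
Qed.

Lemma vL2_grad q : vL2 U (grad U q).
Proof.
move=> i; rewrite (_ : vcomp _ _ = wpartial U i q); first exact: L2_wpartial.
by apply/funext => x; rewrite /vcomp mxE.
Qed.

Lemma L2_symgrad v i j : L2 U (fun x => symgrad U v x i j).
Proof.
have h := L2Z mU 2^-1 (L2D mU (L2_wpartial j (vcomp v i) mU) (L2_wpartial i (vcomp v j) mU)).
by move: h; congr L2; apply/funext => x; rewrite symgradE.
Qed.

Lemma L2_div v : L2 U (div U v).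
Proof.
have h := L2_sum mU (index_enum 'I_d) (fun i => L2_wpartial i (vcomp v i) mU).
by move: h; congr L2; apply/funext => x; rewrite divE.
Qed.

Lemma measurable_advect a v i : vL2 U a -> measurable_fun U (vcomp (advect U a v) i).
Proof.
move=> ha; have -> : vcomp (advect U a v) i =
    (fun x => \sum_j a x 0 j * wpartial U j (vcomp v i) x).
  by apply/funext => x; exact: advectE.
apply: (@measurable_sum _ _ R U 'I_d (index_enum 'I_d)
  (fun j x => a x 0 j * wpartial U j (vcomp v i) x)) => j.
by apply: measurable_funM; [exact: L2_measurable (ha j)|exact: measurable_wpartial].
Qed.

Lemma Int_advect a v i : vL2 U a -> Int U (vcomp (advect U a v) i).
Proof.
move=> ha; have -> : vcomp (advect U a v) i =
    (fun x => \sum_j a x 0 j * wpartial U j (vcomp v i) x).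
  by apply/funext => x; exact: advectE.
by apply: Int_sum => // j _; apply: L2M => //; [exact: ha|exact: L2_wpartial].
Qed.

(** The zero boundary values of eta remove the boundary term, so none are asked of q. *)
Lemma integral_grad_dot q eta : H1 U q -> vH10 U eta ->
  vip U (grad U q) eta = - ip U q (div U eta).
Proof.
move=> hq he.
have I1 i : Int U (fun x => wpartial U i q x * eta x 0 i).
  by apply: L2M => //; [exact: L2_wpartial|exact: H1_L2 (he i).1].
have I2 i : Int U (fun x => q x * wpartial U i (vcomp eta i) x).
  by apply: L2M => //; [exact: H1_L2|exact: L2_wpartial].
rewrite /vip /ip.
transitivity (\sum_i \int[mu]_(x in U) (wpartial U i q x * eta x 0 i)).
  rewrite -Rintegral_sum//; apply: eq_Rintegral => x _.
  by apply: eq_bigr => i _; rewrite mxE.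
transitivity (- \sum_i \int[mu]_(x in U) (q x * wpartial U i (vcomp eta i) x)).
  rewrite -sumrN; apply: eq_bigr => i _.
  have := weak_partial_H10 oU fU (H1_L2 hq) (L2_wpartial i q mU) (H1_weak i hq) (he i).
  by move=> ->; rewrite opprK.
congr (- _); rewrite -Rintegral_sum//; apply: eq_Rintegral => x _.
by rewrite divE mulr_sumr.
Qed.

Definition ae_bounded (h : X -> R) := exists C, {ae mu, forall x, U x -> `|h x| <= C}.

Section bounded_field.
Variables (a v : X -> X).
Hypotheses (ha : vH10 U a) (hdiva : {ae mu, forall x, U x -> div U a x = 0}).
Hypotheses (hv : vH10 U v) (bv : forall i, ae_bounded (vcomp v i))
  (bdv : forall i j, ae_bounded (wpartial U j (vcomp v i))).

Lemma vL2_advect_bounded : vL2 U (advect U a v).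
Proof.
move=> i; have -> : vcomp (advect U a v) i =
    (fun x => \sum_j wpartial U j (vcomp v i) x * a x 0 j).
  by apply/funext => x; rewrite /vcomp advectE; apply: eq_bigr => j _; exact: mulrC.
apply: L2_sum => // j; have [C hC] := bdv i j.
by apply: L2M_ae_bounded hC _ => //; [exact: measurable_wpartial|exact: H1_L2 (ha j).1].
Qed.

(** The convective derivative of eta is a sum of products of L^2 functions, hence only integrable;
    boundedness of v makes the product integrable. *)
Lemma Int_advect_bounded eta : vH1 eta -> Int U (fun x => dot (advect U a eta x) (v x)).
Proof.
move=> he; apply: Int_sum => // k _; have [C hC] := bv k.
apply: (ae_le_Int mU (g := fun x => C * vcomp (advect U a eta) k x)).
- apply: measurable_funM; last exact: L2_measurable (H1_L2 (hv k).1).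
  by apply: measurable_advect; exact: vH1_vL2 (vH10_vH1 ha).
- apply: filterS hC => x + Ux => /(_ Ux) h; rewrite !normrM mulrC ler_wpM2r//.
  by rewrite (le_trans h)// ler_norm.
- by apply: IntZ => //; apply: Int_advect; exact: vH1_vL2 (vH10_vH1 ha).
Qed.

(** Componentwise, the two forms add up to minus the integral of (div a) v_k eta_k, which vanishes.
    The bounds on v and its gradient are what makes each of the integrals finite. *)
Lemma c_form_skew eta : vH10 U eta -> c_form U a eta v = - c_form U a v eta.
Proof.
move=> he; apply/eqP; rewrite -addr_eq0; apply/eqP; rewrite /c_form /vip.
have La k : L2 U (vcomp a k) := H1_L2 (ha k).1.
have Lv k : L2 U (vcomp v k) := H1_L2 (hv k).1.
have Le k : L2 U (vcomp eta k) := H1_L2 (he k).1.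
have I1 k j : Int U (fun x => a x 0 j * wpartial U j (vcomp v k) x * eta x 0 k).
  have [C hC] := bdv k j.
  have := L2M_ae_bounded mU (measurable_wpartial j (vcomp v k) mU) hC (La j).
  move=> /(L2M mU) /(_ (Le k)); congr (mu.-integrable U (EFin \o _)).
  by apply/funext => x; rewrite [_ * vcomp a j x]mulrC.
have I2 k j : Int U (fun x => a x 0 j * wpartial U j (vcomp eta k) x * v x 0 k).
  have [C hC] := bv k.
  have := L2M_ae_bounded mU (L2_measurable (Lv k)) hC (La j).
  move=> /(L2M mU) /(_ (L2_wpartial j (vcomp eta k) mU)).
  congr (mu.-integrable U (EFin \o _)).
  by apply/funext => x; rewrite /vcomp; ring.
have I3 k j : Int U (fun x => wpartial U j (vcomp a j) x * (vcomp v k x * vcomp eta k x)).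
  have [C hC] := bv k.
  apply: L2M => //; first exact: L2_wpartial.
  exact: (L2M_ae_bounded mU (L2_measurable (Lv k)) hC (Le k)).
rewrite -RintegralD//; last 2 first.
- exact: Int_advect_bounded (vH10_vH1 he).
- exact: (Int_dot mU vL2_advect_bounded (vH1_vL2 (vH10_vH1 he))).
transitivity (\sum_k \sum_j \int[mu]_(x in U)
    (a x 0 j * wpartial U j (vcomp v k) x * eta x 0 k +
     a x 0 j * wpartial U j (vcomp eta k) x * v x 0 k)).
  under [RHS]eq_bigr do rewrite -(Rintegral_sum mU _ (fun j => IntD mU (I1 _ j) (I2 _ j))).
  rewrite -Rintegral_sum//; last first.
    by move=> k; apply: Int_sum => // j _; apply: IntD.
  apply: eq_Rintegral => x _; rewrite addrC -big_split/=; apply: eq_bigr => k _.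
  by rewrite !advectE !mulr_suml -big_split.
rewrite big1// => k _.
have [C hC] := bv k.
transitivity (\sum_j - \int[mu]_(x in U)
    (wpartial U j (vcomp a j) x * (vcomp v k x * vcomp eta k x))).
  apply: eq_bigr => j _; have [C' hC'] := bdv k j.
  by have := (integral_mul_H10 oU fU (ha j) (hv k).1 (he k) hC hC').

rewrite sumrN -Rintegral_sum// Rintegral_ae0 ?oppr0//.
  by apply: Int_measurable; apply: Int_sum.
by apply: filterS hdiva => x + Ux => /(_ Ux); rewrite divE -mulr_suml => ->; rewrite mul0r.
Qed.

End bounded_field.
End fields.

(** * The strong form of the Oseen problem *)

Section oseen_strong.
Context {R : realType} {d : nat}.
Local Notation X := 'rV[R]_d.
Local Notation mu := (lebesgue_rV R d).
Local Notation Int U f := (mu.-integrable U (EFin \o f)).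
Variable U : set X.
Hypotheses (oU : open U) (fU : (mu U < +oo)%E).
Let mU : measurable U := open_measurable_rV oU.
Variables (nu : R) (a f u : X -> X) (p : X -> R).
Hypotheses (ha : vH10 U a) (hf : vL2 U f).
Implicit Types (v w eta : X -> X) (q r phi : X -> R) (i j k : 'I_d).

Lemma wpartial_ae i (g h : X -> R) : measurable_fun U g -> H1 U h ->
  {ae mu, forall x, U x -> g x = h x} ->
  {ae mu, forall x, U x -> wpartial U i g x = wpartial U i h x}.
Proof.
move=> mg hh gh; have L := L2_wpartial i h mU; apply: wpartial_eq => //.
have hg : {ae mu, forall x, U x -> h x = g x} by apply: filterS gh => x + Ux => ->.
have dd : {ae mu, forall x, U x -> wpartial U i h x = wpartial U i h x} by exact: aeW.
exact: (weak_partial_ae mU (L2_measurable (H1_L2 hh)) (L2_measurable L) mg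
  (L2_measurable L) hg dd (H1_weak i hh)).
Qed.

(** Test fields along one axis, which extract one component of the momentum equation. *)
Definition unit_field i phi : X -> X := fun x => phi x *: basis_vec i.

Lemma vcomp_unit_field i phi k : vcomp (unit_field i phi) k =
  if k == i then phi else fun=> 0.
Proof.
apply/funext => x; rewrite /vcomp /unit_field !mxE eqxx/=.
by case: eqP => _; rewrite ?mulr1 ?mulr0.
Qed.

Lemma vH10_unit_field i phi : test_function U phi -> vH10 U (unit_field i phi).
Proof.
move=> tp k; rewrite vcomp_unit_field; case: ifP => _; apply: H10_test => //.
exact: test0.
Qed.

Lemma wpartial_unit_field i phi : test_function U phi ->
  {ae mu, forall x, U x -> forall k l, wpartial U l (vcomp (unit_field i phi) k) x =
    (k == i)%:R * cpartial l phi x}.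
Proof.
move=> tp; have H (k : 'I_d * 'I_d) : {ae mu, forall x, U x ->
    wpartial U k.2 (vcomp (unit_field i phi) k.1) x = (k.1 == i)%:R * cpartial k.2 phi x}.
  rewrite vcomp_unit_field; case: eqP => _.
    by apply: filterS (wpartial_test oU fU k.2 tp) => x h Ux; rewrite mul1r h.
  by apply: filterS (wpartial0 oU fU k.2) => x h Ux; rewrite mul0r h.
by apply: filterS (ae_forall H) => x h Ux k l; exact: (h (k, l) Ux).
Qed.

Lemma dot_unit_field i phi (s : X -> X) x : dot (s x) (unit_field i phi x) = vcomp s i x * phi x.
Proof.
rewrite /dot (bigD1 i)//= big1 ?addr0 => [|k ki].
  by rewrite !mxE !eqxx/= mulr1.
by rewrite !mxE (negbTE ki) andbF !mulr0.
Qed.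

Lemma H1_symgrad v i j : (forall k l, H1 U (wpartial U l (vcomp v k))) ->
  H1 U (fun x => symgrad U v x i j).
Proof.
move=> hv; have h := H1Z oU 2^-1 (H1B oU (hv i j) (H1Z oU (-1) (hv j i))).
by move: h; congr H1; apply/funext => x; rewrite symgradE mulN1r opprK.
Qed.

Lemma symgrad_sym v x i j : symgrad U v x i j = symgrad U v x j i.
Proof.
rewrite (symgradE U v x i j) (symgradE U v x j i).
exact: (congr1 (GRing.mul 2^-1) (addrC _ _)).
Qed.

Hypothesis hup : oseen_solution U nu a f u p.
Hypotheses (hu2 : vH2 U u) (hp1 : H1 U p).

Let stress x i j : R := ((2 * nu) *: symgrad U u x) i j.

Let H1_stress i j : H1 U (fun x => stress x i j).
Proof.
have h := H1Z oU (2 * nu) (H1_symgrad i j (fun k l => (hu2 k).2 l)).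
by move: h; congr H1; apply/funext => x; rewrite /stress [RHS]mxE.
Qed.

Definition strong_visc : X -> X := mdiv U (fun x => (2 * nu) *: symgrad U u x).

Lemma strong_viscE x i : strong_visc x 0 i = \sum_j wpartial U j (fun y => stress y i j) x.
Proof. by rewrite mxE. Qed.

Lemma vL2_strong_visc : vL2 U strong_visc.
Proof.
move=> i; have h := L2_sum mU (index_enum 'I_d)
  (fun j => L2_wpartial j (fun y => stress y i j) mU).
by move: h; congr L2; apply/funext => x; rewrite /vcomp strong_viscE.
Qed.

(** The stress is symmetric, so contracting it with the symmetrized gradient of phi e_i leaves row i
    of the stress times grad phi; each entry of the stress is then integrated by parts. *)
Lemma k_form_unit_field i phi : test_function U phi ->
  k_form U nu u (unit_field i phi) = - \int[mu]_(x in U) (vcomp strong_visc i x * phi x).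
Proof.
move=> tp.
have I1 j : Int U (fun x => stress x i j * cpartial j phi x).
  by apply: L2M => //; [exact: H1_L2|exact: L2_test (test_cpartial j tp)].
have I2 j : Int U (fun x => wpartial U j (fun y => stress y i j) x * phi x).
  by apply: L2M => //; [exact: L2_wpartial|exact: L2_test tp].
transitivity (\int[mu]_(x in U) \sum_j (stress x i j * cpartial j phi x)).
  apply: Rintegral_ae => //.
  - apply: measurable_funM => //; apply: Int_measurable; apply: Int_ddot => // k l;
      exact: L2_symgrad.
  - by apply: Int_measurable; apply: Int_sum.
  apply: filterS (wpartial_unit_field i tp) => x h Ux.
  have E (k l : 'I_d) : symgrad U (unit_field i phi) x k l =
      2^-1 * ((k == i)%:R * cpartial l phi x + (l == i)%:R * cpartial k phi x).
    by rewrite symgradE !h.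
  rewrite /stress /ddot.
  under eq_bigr do under eq_bigr do rewrite E.
  have S := @symgrad_sym u x.
  under [RHS]eq_bigr do rewrite mxE.
  move: (symgrad U u x) S => S symS {E h}.
  (* The two halves of the symmetrized gradient select a row and a column of S; symmetry makes the
     two sums equal. *)
  transitivity (2 * nu * (2^-1 * (\sum_l S i l * cpartial l phi x +
      \sum_k S k i * cpartial k phi x))).
    congr (_ * _); rewrite mulrDr.
    transitivity (\sum_k \sum_l (2^-1 * ((k == i)%:R * (S k l * cpartial l phi x))) +
       \sum_k \sum_l (2^-1 * ((l == i)%:R * (S k l * cpartial k phi x)))).
      rewrite -big_split/=; apply: eq_bigr => k _; rewrite -big_split/=; apply: eq_bigr => l _.
      by ring.
    congr (_ + _).
      rewrite (bigD1 i)//= [X in _ + X]big1 ?addr0.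
        by rewrite mulr_sumr; apply: eq_bigr => l _; rewrite eqxx mul1r.
      by move=> k ki; rewrite big1// => l _; rewrite (negbTE ki) mul0r mulr0.
    rewrite mulr_sumr; apply: eq_bigr => k _.
    rewrite (bigD1 i)//= [X in _ + X]big1 ?addr0; first by rewrite eqxx mul1r.
    by move=> l li; rewrite (negbTE li) mul0r mulr0.
  have -> : \sum_k S k i * cpartial k phi x = \sum_l S i l * cpartial l phi x.
    by apply: eq_bigr => k _; rewrite symS.
  rewrite -mulr2n -[X in 2^-1 * X]mulr_natl mulKf ?pnatr_eq0// mulr_sumr.
  by apply: eq_bigr => l _; rewrite mulrA.
rewrite Rintegral_sum//.
transitivity (\sum_j - \int[mu]_(x in U) (wpartial U j (fun y => stress y i j) x * phi x)).
  by apply: eq_bigr => j _; exact: (H1_weak j (H1_stress i j)).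
rewrite sumrN; congr (- _); rewrite -Rintegral_sum//; apply: eq_Rintegral => x _.
by rewrite /vcomp strong_viscE mulr_suml.
Qed.

Lemma b_form_unit_field i phi q : test_function U phi -> H1 U q ->
  b_form U (unit_field i phi) q = - \int[mu]_(x in U) (wpartial U i q x * phi x).
Proof.
move=> tp hq; have Lq := H1_L2 hq.
rewrite -(H1_weak i hq tp); apply: Rintegral_ae => //.
- by apply: measurable_funM; [exact: L2_measurable (L2_div oU _)|exact: L2_measurable].
- apply: measurable_funM; first exact: L2_measurable.
  exact: test_measurable_on (test_cpartial i tp).
apply: filterS (wpartial_unit_field i tp) => x h Ux.
rewrite divE (bigD1 i)//= big1 ?addr0 => [|k ki]; first by rewrite h// eqxx mul1r mulrC.
by rewrite h// (negbTE ki) mul0r.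
Qed.

(** The weak equation with v = phi e_i and q = 0 says that component i of the residual is orthogonal
    to every test function. The residual is only known to be integrable, because of its convective
    part, and this is all the fundamental lemma asks. *)
Lemma oseen_strong : {ae mu, forall x, U x ->
  advect U a u x - strong_visc x + grad U p x = f x}.
Proof.
have La := vH1_vL2 (vH10_vH1 ha).
pose res i x := vcomp (advect U a u) i x - vcomp strong_visc i x + wpartial U i p x - vcomp f i x.
have Lp i := L2_wpartial i p mU.
have H i : {ae mu, forall x, U x -> res i x = 0}.
  have IL g : L2 U g -> Int U g by exact: L2_fin_Int.
  have I1 : Int U (vcomp (advect U a u) i) := Int_advect oU u i La.
  have I2 := IL _ (vL2_strong_visc i); have I3 := IL _ (Lp i); have I4 := IL _ (hf i).
  apply: (fundamental_lemma oU).
    by apply: IntB => //; apply: IntD => //; apply: IntB.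
  move=> phi tp; have [_ _ /(_ (unit_field i phi) (fun=> 0))] := hup.
  have [C _ hC] := test_bounded tp.
  have J g : Int U g -> Int U (fun x => g x * phi x).
    move=> hg; apply: (ae_le_Int mU (g := fun x => C * g x)); last exact: IntZ.
      apply: measurable_funM; first exact: Int_measurable hg.
      exact: test_measurable_on tp.
    apply: aeW => x _; rewrite !normrM mulrC ler_wpM2r//.
    by rewrite (le_trans (hC x))// ler_norm.
  have J1 := J _ I1; have J2 := J _ I2; have J3 := J _ I3; have J4 := J _ I4.
  move=> /(_ (vH10_unit_field i tp)).
  have L0 : L20 U (fun=> 0).
    by split; [exact: L2_0|rewrite Rintegral_cst ?mul0r].
  move=> /(_ L0); rewrite k_form_unit_field// b_form_unit_field//.
  have -> : b_form U u (fun=> 0) = 0.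
    rewrite /b_form /ip -[RHS](mul0r (fine (mu U))) -(Rintegral_cst mu mU).
    by apply: eq_Rintegral => x _; rewrite mulr0.
  have -> : c_form U a u (unit_field i phi) =
      \int[mu]_(x in U) (vcomp (advect U a u) i x * phi x).
    by apply: eq_Rintegral => x _; rewrite dot_unit_field.
  have -> : vip U f (unit_field i phi) = \int[mu]_(x in U) (vcomp f i x * phi x).
    by apply: eq_Rintegral => x _; rewrite dot_unit_field.
  rewrite addr0 opprK => /eqP; rewrite -subr_eq0 -RintegralB//.
  rewrite -RintegralD//; last exact: IntB.
  rewrite -RintegralB//; last by apply: IntD => //; exact: IntB.
  move=> /eqP <-; apply: eq_Rintegral => x _.
  by rewrite /res !(mulrDl, mulNr).
apply: filterS (ae_forall H) => x h Ux; apply/rowP => i; apply/eqP.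
rewrite -subr_eq0 -[X in _ == X](h i Ux) /res /vcomp; apply/eqP.
by rewrite !mxE.
Qed.

(** Integration by parts against the constant 1. It makes div v mean-free, and so an admissible
    pressure test function. *)
Lemma integral_div_H10 v : vH10 U v -> \int[mu]_(x in U) div U v x = 0.
Proof.
move=> hv.
have L1 : L2 U (fun=> 1).
  apply: (@L2_ae_bounded _ _ U mU 1) => //; apply: aeW => x _; by rewrite normr1.
have w i : weak_partial U i (fun=> 1) (fun=> 0).
  have s1 : smooth_on U (fun=> 1) := smooth_on_cst 1 oU.
  have E : cpartial i (fun=> 1 : R) = (fun=> 0) :> (X -> R).
    by apply/funext => x; exact: (@derive_cst _ _ _ (1 : R)).
  by rewrite -E; have := weak_partial_smooth i oU s1.
have I1 i : Int U (wpartial U i (vcomp v i)) by apply: L2_fin_Int => //; exact: L2_wpartial.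
transitivity (\sum_i \int[mu]_(x in U) wpartial U i (vcomp v i) x).
  by rewrite -Rintegral_sum//; apply: eq_Rintegral => x _; rewrite divE.
rewrite big1// => i _.
have := weak_partial_H10 oU fU L1 (L2_0 U) (w i) (hv i).
rewrite (@eq_Rintegral _ _ _ mu U (wpartial U i (vcomp v i))); last by move=> x _; rewrite mul1r.
move=> ->; rewrite -[RHS]oppr0; congr (- _).
rewrite -[RHS](mul0r (fine (mu U))) -(Rintegral_cst mu mU).
by apply: eq_Rintegral => x _; rewrite mul0r.
Qed.

Lemma vH10_0 : vH10 U (fun=> 0).
Proof.
move=> i; have := H10_test oU fU (test0 U); congr H10.
by apply/funext => x; rewrite /vcomp mxE.
Qed.

Lemma vgrad0 : {ae mu, forall x, U x -> vgrad U (fun=> 0) x = 0}.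
Proof.
have H (k : 'I_d) : {ae mu, forall x, U x -> wpartial U k (fun=> 0) x = 0} by exact: wpartial0.
apply: filterS (ae_forall H) => x h Ux; apply/matrixP => i j; rewrite vgradE [RHS]mxE.
rewrite -[RHS](h j Ux); congr wpartial.
by apply/funext => y; rewrite /vcomp mxE.
Qed.

(** The weak equation with v = 0 and q = div u reduces to the vanishing of the squared L^2 norm of
    div u. *)
Lemma oseen_div0 : {ae mu, forall x, U x -> div U u x = 0}.
Proof.
have [hu _ /(_ (fun=> 0) (div U u) vH10_0)] := hup.
have Ld : L2 U (div U u) := L2_div oU u.
have R0 g : (forall x, U x -> g x = 0) -> \int[mu]_(x in U) g x = 0.
  move=> h; rewrite -[RHS](mul0r (fine (mu U))) -(Rintegral_cst mu mU).
  by apply: eq_Rintegral => x /set_mem; exact: h.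
move=> /(_ (conj Ld (integral_div_H10 hu))).
have -> : c_form U a u (fun=> 0) = 0.
  by apply: R0 => x _; rewrite /dot big1// => i _; rewrite [(0 : 'rV[R]_d) _ _]mxE mulr0.
have -> : k_form U nu u (fun=> 0) = 0.
  apply: Rintegral_ae0 => //.
    apply: measurable_funM => //; apply: Int_measurable; apply: Int_ddot => // k l;
      exact: L2_symgrad.
  apply: filterS vgrad0 => x h Ux.
  have -> : symgrad U (fun=> 0) x = 0 by rewrite /symgrad h// trmx0 addr0 scaler0.
  rewrite /ddot big1 ?mulr0// => i _; rewrite big1// => j _.
  by rewrite [(0 : 'M[R]_d) _ _]mxE mulr0.
have -> : b_form U (fun=> 0) p = 0.
  apply: Rintegral_ae0 => //.
    by apply: measurable_funM; [exact: L2_measurable (L2_div oU _)|exact: L2_measurable (H1_L2 hp1)].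
  by apply: filterS vgrad0 => x h Ux; rewrite /div h// mxtrace0 mul0r.
have -> : vip U f (fun=> 0) = 0.
  by apply: R0 => x _; rewrite /dot big1// => i _; rewrite [(0 : 'rV[R]_d) _ _]mxE mulr0.
rewrite !add0r oppr0 add0r => h.
apply: (Rintegral_sqr_eq0 mU Ld.2 _ Ld.1).
transitivity (b_form U u (div U u)); last exact: h.
by apply: eq_Rintegral => x _; rewrite expr2.
Qed.

End oseen_strong.

(** * The discrete problem and the error estimate *)

Section discrete.
Context {R : realType} {d : nat}.
Local Notation X := 'rV[R]_d.
Local Notation mu := (lebesgue_rV R d).
Local Notation Int U f := (mu.-integrable U (EFin \o f)).
Variables (Omega : set X) (M : mesh R d).
Hypothesis hM : mesh_of Omega M.
Let oO : open Omega := mesh_open hM.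
Let fO : (mu Omega < +oo)%E := mesh_lty hM.
Let mO : measurable Omega := mesh_measurable hM.
Let oE e : open (elem (m := M) e) := @elem_open _ _ _ _ hM e.
Let fE e : (mu (elem (m := M) e) < +oo)%E := elem_lty hM e.
Let mE e : measurable (elem (m := M) e) := elem_measurable hM e.
Let EO e : elem (m := M) e `<=` Omega := @elem_sub _ _ _ _ hM e.
Let cE e : compact (closure (elem (m := M) e)) := @elem_compact _ _ _ _ hM e.
Implicit Types (v w eta : X -> X) (q r : X -> R) (i j : 'I_d) (e : 'I_(nel M)).

Definition discrete_velocity v :=
  vH10 Omega v /\ forall e i, ae_smooth (elem (m := M) e) (vcomp v i).

Lemma pw_rational_discrete v : vH10 Omega v -> vmapped_pw_rational M v -> discrete_velocity v.
Proof.
move=> hv pv; split => // e i; have [r [hr hvr]] := pv e.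
have hmap : element_map (ref (m := M) e) (elem e) (emap e) (einv e).
  by case: hM => _ /(_ e) + _ _.
split; last exact: (mapped_smooth_near hmap (@oE e) hr hvr).
exact: measurable_funS mO (@EO e) (L2_measurable (H1_L2 (hv i).1)).
Qed.

Lemma discrete_velocity_bounded v i : discrete_velocity v -> ae_bounded Omega (vcomp v i).
Proof.
move=> [_ sv]; apply: (mesh_bounded hM) => e.
exact: (ae_smooth_bounded (@cE e) (sv e i)).
Qed.

Lemma discrete_velocity_grad v i j e : discrete_velocity v ->
  ae_smooth (elem (m := M) e) (wpartial Omega j (vcomp v i)).
Proof.
move=> [hv sv].
exact: (ae_smooth_wpartial oO (@oE e) (@EO e) (@cE e) j (hv i).1 (sv e i)).
Qed.

Lemma discrete_velocity_grad_bounded v i j : discrete_velocity v ->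
  ae_bounded Omega (wpartial Omega j (vcomp v i)).
Proof.
move=> hv; apply: (mesh_bounded hM) => e.
exact: (ae_smooth_bounded (@cE e) (discrete_velocity_grad i j e hv)).
Qed.

Variables (nu : R) (a : X -> X).
Hypothesis ha : vH10 Omega a.

(* The regularity shared by discrete pairs and by the exact solution: what makes
   every term of A_red finite, the advection field being only in H^1_0. *)
Definition regular_pair v q := [/\ vH1 Omega v, H1 Omega q, vL2 Omega (advect Omega a v) &
  forall e i j, H1 (elem (m := M) e) (fun x => symgrad Omega v x i j)].

Lemma discrete_regular v q : discrete_velocity v -> H1 Omega q -> regular_pair v q.
Proof.
move=> hv hq; split => //; first exact: vH10_vH1 hv.1.
  by apply: (vL2_advect_bounded oO ha) => i j; exact: discrete_velocity_grad_bounded.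
move=> e i j; apply: (ae_smooth_H1 (@oE e) (@cE e)).
have := ae_smoothZ 2^-1 (ae_smoothD (discrete_velocity_grad i j e hv)
  (discrete_velocity_grad j i e hv)).
by congr ae_smooth; apply/funext => x; rewrite symgradE.
Qed.

Lemma regular_pairB v w q r : regular_pair v q -> regular_pair w r -> regular_pair (v - w) (q - r).
Proof.
move=> [hv hq Lv sv] [hw hr Lw sw]; have G := vgradB oO fO hv hw.
split; [exact: (vH1B oO hv hw)|exact: (H1B oO hq hr)| |].
  apply: (vL2_ae mO _ _ (vL2B mO Lv Lw)).
    by move=> i; apply: (measurable_advect oO); exact: vH1_vL2 (vH10_vH1 ha).
  by apply: filterS G => x h Ox; apply: advect_of_vgrad; exact: h.
move=> e i j; have h := H1B (@oE e) (sv e i j) (sw e i j).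
have ms : measurable_fun (elem (m := M) e) (fun x => symgrad Omega (v - w) x i j).
  exact: measurable_funS mO (@EO e) (L2_measurable (L2_symgrad oO _ _ _)).
have E : {ae mu, forall x, elem (m := M) e x -> symgrad Omega v x i j - symgrad Omega w x i j =
    symgrad Omega (v - w) x i j}.
  apply: filterS (ae_elem hM e G) => x hx Ex.
  by rewrite (symgrad_of_vgrad (hx Ex)) [RHS]mxE; congr (_ + _); rewrite [RHS]mxE.
split; first by apply: (L2_ae (mE e) ms _ (H1_L2 h)); apply: filterS E => x + Ex => ->.
move=> k; have Lk := L2_wpartial k (fun x => symgrad Omega v x i j - symgrad Omega w x i j) (mE e).
exists (wpartial (elem e) k (fun x => symgrad Omega v x i j - symgrad Omega w x i j)).
split; first exact: Lk.
have mk := L2_measurable Lk.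
have dd : {ae mu, forall x, elem (m := M) e x ->
  wpartial (elem e) k (fun x => symgrad Omega v x i j - symgrad Omega w x i j) x =
  wpartial (elem e) k (fun x => symgrad Omega v x i j - symgrad Omega w x i j) x} by exact: aeW.
exact: (weak_partial_ae (mE e) (L2_measurable (H1_L2 h)) mk ms mk E dd (H1_weak k h)).
Qed.

Lemma viscE e v x i : visc Omega nu e v x 0 i =
  \sum_j wpartial (elem e) j (fun y => ((2 * nu) *: symgrad Omega v y) i j) x.
Proof. by rewrite mxE. Qed.

Lemma vL2_visc e v : vL2 (elem e) (visc Omega nu e v).
Proof.
move=> i; have h := L2_sum (mE e) (index_enum 'I_d)
  (fun j => L2_wpartial j (fun y => ((2 * nu) *: symgrad Omega v y) i j) (mE e)).
by move: h; congr L2; apply/funext => x; rewrite /vcomp viscE.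
Qed.

Lemma H1_stress e v q i j : regular_pair v q ->
  H1 (elem (m := M) e) (fun y => ((2 * nu) *: symgrad Omega v y) i j).
Proof.
move=> [_ _ _ sv]; have := H1Z (@oE e) (2 * nu) (sv e i j).
by congr H1; apply/funext => y; rewrite [RHS]mxE.
Qed.

Lemma viscB e v w q r : regular_pair v q -> regular_pair w r ->
  {ae mu, forall x, elem e x ->
    visc Omega nu e (v - w) x = visc Omega nu e v x - visc Omega nu e w x}.
Proof.
move=> rv rw; have rvw := regular_pairB rv rw.
have [hv _ _ _] := rv; have [hw _ _ _] := rw; have G := vgradB oO fO hv hw.
have H (k : 'I_d * 'I_d) : {ae mu, forall x, elem e x ->
    wpartial (elem e) k.2 (fun y => ((2 * nu) *: symgrad Omega (v - w) y) k.1 k.2) x =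
    wpartial (elem e) k.2 (fun y => ((2 * nu) *: symgrad Omega v y) k.1 k.2) x -
    wpartial (elem e) k.2 (fun y => ((2 * nu) *: symgrad Omega w y) k.1 k.2) x}.
  have h1 := H1_stress e k.1 k.2 rv; have h2 := H1_stress e k.1 k.2 rw.
  have h3 := H1_stress e k.1 k.2 rvw.
  have m3 := L2_measurable (H1_L2 h3).
  have E : {ae mu, forall x, elem (m := M) e x ->
      ((2 * nu) *: symgrad Omega (v - w) x) k.1 k.2 =
      ((2 * nu) *: symgrad Omega v x) k.1 k.2 - ((2 * nu) *: symgrad Omega w x) k.1 k.2}.
    apply: filterS (ae_elem hM e G) => x hx Ex.
    rewrite (symgrad_of_vgrad (hx Ex)) scalerBr.
    by rewrite [LHS]mxE; congr (_ + _); rewrite [LHS]mxE.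
  have W1 := wpartial_ae (@oE e) (fE e) k.2 m3 (H1B (@oE e) h1 h2) E.
  have W2 := wpartialB (@oE e) (fE e) k.2 h1 h2.
  by apply: filterS2 W1 W2 => x h h' Ex; exact: (etrans (h Ex) (h' Ex)).
apply: filterS (ae_forall H) => x h Ex; apply/rowP => i.
rewrite viscE (eq_bigr _ (fun j _ => h (i, j) Ex)) sumrB.
by rewrite [RHS]mxE viscE; congr (_ + _); rewrite [RHS]mxE viscE.
Qed.

End discrete.

(** Index 1 refers to the discrete part xi of the error and index 2 to eta. K is the viscous energy,
    S the streamline energy, W the elementwise viscous residual, Y the term in tauM^-1; c, k and P2
    are the forms at (eta, xi), and P1 is the stabilization at (xi, xi). The weights leave 1 - 1/4 -
    1/4 = 1/2 of K1 and 1/2 - 1/6 - 1/12 = 1/4 of S1 on the left, against K2 + 3 (S2 + W2 + Y).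
    Multiplying by 4 gives the constant 12. *)
Lemma energy_arith (R : realFieldType) (P1 P2 W1 W2 c k K1 K2 S1 S2 Y : R) :
  2^-1 * S1 - 2^-1 * W1 <= P1 -> - P2 <= 6^-1 * S1 + 3 * S2 + 3 * W2 ->
  0 <= S1 -> 0 <= K1 -> 0 <= K2 -> W1 <= 2^-1 * K1 -> - k <= K2 + 4^-1 * K1 ->
  - c <= 12^-1 * S1 + 3 * Y -> c + k + P2 + (0 + K1 + P1) = 0 ->
  K1 + S1 <= 12 * (K2 + S2 + W2 + Y).
Proof. by move=> *; lra. Qed.

(** * The energy estimate for the discrete part of the error *)

Section energy.
Context {R : realType} {d : nat}.
Local Notation X := 'rV[R]_d.
Local Notation mu := (lebesgue_rV R d).
Local Notation Int U f := (mu.-integrable U (EFin \o f)).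
Variables (Omega : set X) (M : mesh R d).
Hypothesis hM : mesh_of Omega M.
Variables (nu : R) (a : X -> X) (tauC tauM : X -> R) (Cinv : 'I_(nel M) -> R).
Hypotheses (hnu : 0 < nu) (ha : vH10 Omega a).
Hypothesis hdiva : {ae mu, forall x, Omega x -> div Omega a x = 0}.
Hypotheses (mtauC : measurable_fun Omega tauC) (mtauM : measurable_fun Omega tauM).
Hypothesis htauM : forall x, Omega x -> 0 < tauM x.
Hypothesis hCinv : forall e, 0 < Cinv e.
Hypothesis htau : forall e x, elem e x -> tauM x <= diam (elem e) ^+ 2 / (Cinv e * nu).
Let oO : open Omega := mesh_open hM.
Let fO : (mu Omega < +oo)%E := mesh_lty hM.
Let mO : measurable Omega := mesh_measurable hM.
Let mE e : measurable (elem (m := M) e) := elem_measurable hM e.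
Let EO e : elem (m := M) e `<=` Omega := @elem_sub _ _ _ _ hM e.
Implicit Types (v w eta s t : X -> X) (q r : X -> R) (i j : 'I_d) (e : 'I_(nel M)).

Local Notation sl := (streamline Omega a).
Local Notation vis := (visc Omega nu).
Local Notation regular := (regular_pair Omega M a).
Local Notation DV := (discrete_velocity Omega M).

Lemma vL2_elem e s : vL2 Omega s -> vL2 (elem e) s.
Proof. by move=> hs i; exact: (L2S mO (mE e) (@EO e) (hs i)). Qed.

(** Assumption (ii) bounds tauM on each of the finitely many elements. *)
Lemma tau_bounded : ae_bounded Omega tauM.
Proof.
apply: (mesh_bounded hM) => e; exists (diam (elem e) ^+ 2 / (Cinv e * nu)).
apply: aeW => x Ex; rewrite ger0_norm; first exact: htau.
by apply/ltW/htauM; exact: (@EO e).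
Qed.

Lemma vL2_tau s : vL2 Omega s -> vL2 Omega (fun x => tauM x *: s x).
Proof. by have [C hC] := tau_bounded; exact: (vL2M_ae_bounded mO mtauM hC). Qed.

Lemma vL2_tau_elem e s : vL2 (elem e) s -> vL2 (elem e) (fun x => tauM x *: s x).
Proof.
have [C hC] := tau_bounded.
exact: (vL2M_ae_bounded (mE e) (measurable_funS mO (@EO e) mtauM) (ae_elem hM e hC)).
Qed.

Lemma Int_tau_dot s t : vL2 Omega s -> vL2 Omega t -> Int Omega (fun x => tauM x * dot (s x) (t x)).
Proof.
move=> hs ht; have := Int_dot mO hs (vL2_tau ht).
by congr (mu.-integrable Omega (EFin \o _)); apply/funext => x; rewrite dotZr.
Qed.

Lemma Int_tau_dot_elem e s t : vL2 (elem e) s -> vL2 (elem e) t ->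
  Int (elem e) (fun x => tauM x * dot (s x) (t x)).
Proof.
move=> hs ht; have := Int_dot (mE e) hs (vL2_tau_elem ht).
by congr (mu.-integrable (elem e) (EFin \o _)); apply/funext => x; rewrite dotZr.
Qed.

Lemma vL2_streamline v q : regular v q -> vL2 Omega (sl v q).
Proof. by move=> [_ _ Lv _]; apply: (vL2D mO Lv); exact: vL2_grad. Qed.

Definition stab e w r v q : R := vip (elem e)
  (fun x => advect Omega a w x - vis e w x + grad Omega r x) (fun x => tauM x *: sl v q x).

Lemma residualE e w r x : advect Omega a w x - vis e w x + grad Omega r x =
  sl w r x - vis e w x.
Proof. by rewrite /streamline addrAC. Qed.

Lemma vL2_residual e w r : regular w r -> vL2 (elem e)
  (fun x => advect Omega a w x - vis e w x + grad Omega r x).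
Proof.
move=> rw; have := vL2B (mE e) (vL2_elem e (vL2_streamline rw)) (vL2_visc hM nu e w).
by congr vL2; apply/funext => x; rewrite residualE.
Qed.

Lemma regular_ae_sub w r w' r' : regular w r -> regular w' r' ->
  {ae mu, forall x, Omega x -> vgrad Omega (w - w') x = vgrad Omega w x - vgrad Omega w' x /\
     sl (w - w') (r - r') x = sl w r x - sl w' r' x}.
Proof.
move=> [hw hr _ _] [hw' hr' _ _].
apply: filterS2 (vgradB oO fO hw hw') (gradB oO fO hr hr') => x h1 h2 Ox.
split; first exact: h1.
by rewrite /streamline (advect_of_vgrad a (h1 Ox)) (h2 Ox) addrACA -opprD.
Qed.

Lemma stabB e w r w' r' v q : regular w r -> regular w' r' -> regular v q ->
  stab e (w - w') (r - r') v q = stab e w r v q - stab e w' r' v q.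
Proof.
move=> rw rw' rv.
have L1 := vL2_residual e rw; have L2' := vL2_residual e rw'.
have L3 := vL2_residual e (regular_pairB hM ha rw rw').
have Lt := vL2_tau_elem (vL2_elem e (vL2_streamline rv)).
rewrite /stab /vip -RintegralB//; [|exact: Int_dot|exact: Int_dot].
apply: (Rintegral_ae (mE e)).
- by apply: Int_measurable; exact: Int_dot.
- by apply: Int_measurable; apply: IntB => //; exact: Int_dot.
apply: filterS2 (ae_elem hM e (regular_ae_sub rw rw')) (viscB hM nu ha e rw rw') => x h1 h2 Ex.
rewrite -dotBl; congr (dot _ _).
have aux (A B C S S1 S2 V V1 V2 : X) : A = S - V -> B = S1 - V1 -> C = S2 - V2 ->
    S = S1 - S2 -> V = V1 - V2 -> A = B - C.
  by move=> -> -> -> -> ->; rewrite !opprD !opprK [LHS]addrACA.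
exact: (aux _ _ _ _ _ _ _ _ _ (residualE e (w - w') (r - r') x) (residualE e w r x)
  (residualE e w' r' x) (h1 Ex).2 (h2 Ex)).
Qed.

Lemma k_formB w r w' r' v : regular w r -> regular w' r' ->
  k_form Omega nu (w - w') v = k_form Omega nu w v - k_form Omega nu w' v.
Proof.
move=> rw rw'.
have I u : Int Omega (fun x => 2 * nu * ddot (symgrad Omega u x) (symgrad Omega v x)).
  by apply: IntZ => //; apply: Int_ddot => // i j; exact: L2_symgrad.
rewrite /k_form -RintegralB//; apply: (Rintegral_ae mO).
- exact: Int_measurable (I _).
- exact: Int_measurable (IntB mO (I _) (I _)).
apply: filterS (regular_ae_sub rw rw') => x h Ox.
rewrite (symgrad_of_vgrad (h Ox).1) -mulrBr; congr (_ * _).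
rewrite ddotDl; congr (_ + _).
by rewrite -sumrN; apply: eq_bigr => i _; rewrite -sumrN; apply: eq_bigr => j _; rewrite mxE mulNr.
Qed.

Lemma c_formB w r w' r' v : DV v -> regular w r -> regular w' r' ->
  c_form Omega a (w - w') v = c_form Omega a w v - c_form Omega a w' v.
Proof.
move=> hv rw rw'; have [hw _ _ _] := rw; have [hw' _ _ _] := rw'.
have bv i := discrete_velocity_bounded hM i hv.
have I u : vH1 Omega u -> Int Omega (fun x => dot (advect Omega a u x) (v x)).
  by move=> hu; exact: (Int_advect_bounded oO ha hv.1 bv hu).
rewrite /c_form /vip -RintegralB//; [|exact: I|exact: I].
apply: (Rintegral_ae mO).
- by apply: Int_measurable; apply: I; exact: vH1B.
- by apply: Int_measurable; apply: IntB => //; exact: I.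
apply: filterS (regular_ae_sub rw rw') => x h Ox.
by rewrite (advect_of_vgrad a (h Ox).1) dotBl.
Qed.

Lemma A_red_div0 w r v q : {ae mu, forall x, Omega x -> div Omega v x = 0} ->
  A_red Omega nu a M tauC tauM w r v q =
  c_form Omega a w v + k_form Omega nu w v + \sum_e stab e w r v q.
Proof.
move=> dv; rewrite /A_red (_ : ip _ _ _ = 0) ?addr0//.
apply: (Rintegral_ae0 mO).
  apply: measurable_funM; last exact: L2_measurable (L2_div oO v).
  by apply: measurable_funM => //; exact: L2_measurable (L2_div oO w).
by apply: filterS dv => x + Ox => ->; rewrite ?mulr0.
Qed.

(** This and the next two definitions are real-valued counterparts of terms of the extended-real
    norms. A real integral has the default value 0 when the extended one is infinite, so
    [mass_energy] is meaningful only together with an integrability hypothesis. *)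
Definition stream_energy (D : set X) v q : R :=
  \int[mu]_(x in D) (tauM x * dot (sl v q x) (sl v q x)).

Definition visc_energy e v : R :=
  \int[mu]_(x in elem e) (tauM x * dot (vis e v x) (vis e v x)).

Definition mass_energy v : R := \int[mu]_(x in Omega) ((tauM x)^-1 * dot (v x) (v x)).

Section core.
Variables (eta v : X -> X) (r q : X -> R).
Hypotheses (reta : regular eta r) (heta : vH10 Omega eta).
Hypothesis dieta : {ae mu, forall x, Omega x -> div Omega eta x = 0}.
Hypotheses (hv : DV v) (hq : H1 Omega q).
Hypothesis hinv : forall e, vip (elem e) (vis e v) (vis e v) <=
  Cinv e / diam (elem e) ^+ 2 *
  mip (elem e) (fun x => nu *: symgrad Omega v x) (fun x => nu *: symgrad Omega v x).
Hypothesis Zeta : Int Omega (fun x => (tauM x)^-1 * dot (eta x) (eta x)).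

Let rv : regular v q := discrete_regular hM ha hv hq.
Let bv i : ae_bounded Omega (vcomp v i) := discrete_velocity_bounded hM i hv.
Let bdv i j : ae_bounded Omega (wpartial Omega j (vcomp v i)) :=
  discrete_velocity_grad_bounded hM i j hv.
Let Ls : vL2 Omega (sl v q) := vL2_streamline rv.

Local Notation K w := (k_form Omega nu w w).
Local Notation S := (stream_energy Omega).
Local Notation Se e := (stream_energy (elem (m := M) e)).
Local Notation V := visc_energy.
Local Notation Z := (mass_energy eta).

Let IS w p : regular w p -> Int Omega (fun x => tauM x * dot (sl w p x) (sl w p x)).
Proof. by move=> rw; apply: Int_tau_dot; exact: vL2_streamline. Qed.

Let ISe e w p : regular w p -> Int (elem e) (fun x => tauM x * dot (sl w p x) (sl w p x)).
Proof. by move=> rw; apply: (Int_elem hM); exact: IS. Qed.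

Let IVe e w : Int (elem e) (fun x => tauM x * dot (vis e w x) (vis e w x)).
Proof. by apply: Int_tau_dot_elem; exact: vL2_visc. Qed.

Lemma c_form_self : c_form Omega a v v = 0.
Proof.
have := c_form_skew oO fO ha hdiva hv.1 bv bdv hv.1 => /eqP.
by rewrite -addr_eq0 -mulr2n mulrn_eq0 => /eqP.
Qed.

(* The convective term is moved onto the discrete velocity; grad q may then be
   added for free since eta is divergence free. *)
Lemma c_form_streamline : c_form Omega a eta v = - \int[mu]_(x in Omega) dot (sl v q x) (eta x).
Proof.
rewrite (c_form_skew oO fO ha hdiva hv.1 bv bdv heta) /c_form /vip; congr (- _).
have Le := vH1_vL2 (vH10_vH1 heta).
have La : vL2 Omega (advect Omega a v) := vL2_advect_bounded oO ha bdv.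
have -> : \int[mu]_(x in Omega) dot (sl v q x) (eta x) =
    \int[mu]_(x in Omega) dot (advect Omega a v x) (eta x) + vip Omega (grad Omega q) eta.
  rewrite /vip -RintegralD//; last 2 first.
  - exact: (Int_dot mO La Le).
  - exact: (Int_dot mO (vL2_grad oO q) Le).
  by apply: eq_Rintegral => x _; rewrite /streamline dotDl.
have -> : vip Omega (grad Omega q) eta = 0; last by rewrite addr0.
rewrite (integral_grad_dot oO fO hq heta) -oppr0; congr (- _).
apply: (Rintegral_ae0 mO).
  by apply: measurable_funM; [exact: L2_measurable (H1_L2 hq)|exact: L2_measurable (L2_div oO eta)].
by apply: filterS dieta => x + Ox => ->; rewrite ?mulr0.
Qed.

(** Young with weight 1/12 on the streamline term, tauM^(1/2) going to one factor and tauM^(-1/2) to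
    the other; the dual weight is 1 / (4/12) = 3. *)
Lemma c_form_le : - c_form Omega a eta v <= 12^-1 * S v q + 3 * Z.
Proof.
have I1 := IntZ mO 12^-1 (IS rv); have I2 := IntZ mO 3 Zeta.
rewrite c_form_streamline opprK /stream_energy /mass_energy -(RintegralZl _ mO (IS rv)).
rewrite -(RintegralZl _ mO Zeta) -(RintegralD mO I1 I2).
apply: (le_Rintegral mO (Int_dot mO Ls (vH1_vL2 (vH10_vH1 heta))) (IntD mO I1 I2)).
move=> x Ox; have c0 : 0 < 12^-1 :> R by rewrite invr_gt0.
have := dot_weighted_young (sl v q x) (eta x) c0 (htauM Ox).
have -> : (4 * 12^-1)^-1 = 3 :> R by field.
by move=> /ler_normlP[].
Qed.

Lemma k_form_le : - k_form Omega nu eta v <= K eta + 4^-1 * K v.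
Proof.
have I u w : Int Omega (fun x => 2 * nu * ddot (symgrad Omega u x) (symgrad Omega w x)).
  by apply: IntZ => //; apply: Int_ddot => // i j; exact: L2_symgrad.
rewrite /k_form -RintegralN// -RintegralZl// -RintegralD//; last exact: IntZ.
apply: le_Rintegral => //.
- exact: IntN.
- by apply: IntD => //; exact: IntZ.
move=> x Ox; rewrite [4^-1 * _]mulrCA -mulrN -mulrDr ler_wpM2l//.
  by rewrite mulr_ge0// ltW.
exact: ddot_young.
Qed.

(** The integrand is tauM (s - z) . s with s the streamline field and z the viscous term, and z . s
    <= |z|^2 / 2 + |s|^2 / 2. *)
Lemma stab_self_ge e : 2^-1 * Se e v q - 2^-1 * V e v <= stab e v q v q.
Proof.
rewrite /stream_energy /visc_energy -(RintegralZl _ _ (ISe e rv))// -(RintegralZl _ _ (IVe e v))//.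
have I1 := IntZ (mE e) 2^-1 (ISe e rv); have I2 := IntZ (mE e) 2^-1 (IVe e v).
rewrite -RintegralB//; apply: le_Rintegral => //.
- exact: IntB.
- exact: (Int_dot (mE e) (vL2_residual e rv) (vL2_tau_elem (vL2_elem e Ls))).
move=> x Ex; rewrite residualE dotZr dotBl.
have t0 : 0 < tauM x by apply: htauM; exact: (@EO e).
have h : 0 < 2^-1 :> R by rewrite invr_gt0.
have := dot_young (vis e v x) (sl v q x) h.
have -> : (4 * 2^-1)^-1 = 2^-1 :> R by field.
by move: (dot _ _) (dot _ _) (dot _ _) => A B C; nra.
Qed.

(** The streamline and viscous parts of the residual of eta are each paired with the streamline
    field of (v, q) with Young weight 3; each pairing costs 1/12 of its energy, hence 1/6 in
    total. *)
Lemma stab_cross_le e : - stab e eta r v q <=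
  6^-1 * Se e v q + 3 * Se e eta r + 3 * V e eta.
Proof.
rewrite /stream_energy /visc_energy -(RintegralZl _ _ (ISe e rv))//
  -(RintegralZl _ _ (ISe e reta))//
  -(RintegralZl _ _ (IVe e eta))//.
have I1 := IntZ (mE e) 6^-1 (ISe e rv); have I2 := IntZ (mE e) 3 (ISe e reta).
have I3 := IntZ (mE e) 3 (IVe e eta).
have I4 := Int_dot (mE e) (vL2_residual e reta) (vL2_tau_elem (vL2_elem e Ls)).
rewrite /stab /vip -(RintegralN (mE e) I4) -(RintegralD (mE e) I1 I2).
rewrite -(RintegralD (mE e) (IntD (mE e) I1 I2) I3).
apply: (le_Rintegral (mE e) (IntN (mE e) I4) (IntD (mE e) (IntD (mE e) I1 I2) I3)).
move=> x Ex; rewrite residualE dotZr dotBl.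
have t0 : 0 < tauM x by apply: htauM; exact: (@EO e).
have h : 0 < 3 :> R by [].
have := dot_young (vis e eta x) (sl v q x) h.
have := dot_young (- sl eta r x) (sl v q x) h.
rewrite dotNl dotNl [dot _ (- _)]dotC dotNl opprK.
have -> : (4 * 3)^-1 = 12^-1 :> R by field.
move: (dot (vis e eta x) (sl v q x)) (dot (sl eta r x) (sl v q x)) (dot (sl v q x) (sl v q x))
  (dot (vis e eta x) (vis e eta x)) (dot (sl eta r x) (sl eta r x)) (tauM x) t0.
by move=> A B C D E t t0 h1 h2; nra.
Qed.

(** The bound on tauM in (ii) cancels both h^2 and [Cinv] in the inverse estimate and one factor nu.
    What remains is half the viscous energy on the element, whose density is 2 nu |symgrad v|^2. *)
Lemma visc_le e : V e v <= nu * \int[mu]_(x in elem e) ddot (symgrad Omega v x) (symgrad Omega v x).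
Proof.
pose h2 := diam (elem e) ^+ 2; have CN : 0 < Cinv e * nu by rewrite mulr_gt0.
(* The diameter is nonzero because tauM is positive at some point of the element and (ii) bounds it
   by a multiple of h^2. *)
have h20 : 0 < h2.
  have [x Ex] : elem (m := M) e !=set0 by case: hM => /(_ e)[].
  have := lt_le_trans (htauM (@EO e x Ex)) (htau Ex).
  by rewrite pmulr_lgt0 // invr_gt0.
have Lv := vL2_visc hM nu e v.
have IS' : Int (elem e) (fun x => ddot (symgrad Omega v x) (symgrad Omega v x)).
  by apply: (Int_elem hM); apply: Int_ddot => // i j; exact: L2_symgrad.
apply: (@le_trans _ _ (h2 / (Cinv e * nu) * vip (elem e) (vis e v) (vis e v))).
  rewrite /visc_energy /vip -(RintegralZl _ _ (Int_dot (mE e) Lv Lv))//.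
  apply: (le_Rintegral (mE e) (IVe e v) (IntZ (mE e) _ (Int_dot (mE e) Lv Lv))).
  by move=> x Ex; rewrite ler_wpM2r ?dot_ge0//; exact: htau.
apply: (@le_trans _ _ (h2 / (Cinv e * nu) * (Cinv e / h2 *
  mip (elem e) (fun x => nu *: symgrad Omega v x) (fun x => nu *: symgrad Omega v x)))).
  by rewrite ler_wpM2l ?hinv// divr_ge0// ltW.
have -> : mip (elem e) (fun x => nu *: symgrad Omega v x) (fun x => nu *: symgrad Omega v x) =
    nu ^+ 2 * \int[mu]_(x in elem e) ddot (symgrad Omega v x) (symgrad Omega v x).
  by rewrite -RintegralZl//; apply: eq_Rintegral => x _; rewrite ddotZ.
move: (\int[mu]_(x in elem e) _) => I.
rewrite le_eqVlt; apply/orP; left; apply/eqP.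
by field; rewrite !gt_eqF.
Qed.

Lemma visc_sum_le : \sum_e V e v <= 2^-1 * K v.
Proof.
apply: (le_trans (ler_sum _ (fun e _ => visc_le e))).
have I : Int Omega (fun x => ddot (symgrad Omega v x) (symgrad Omega v x)).
  by apply: Int_ddot => // i j; exact: L2_symgrad.
rewrite -mulr_sumr -(mesh_Rintegral hM I) /k_form RintegralZl//.
move: (\int[mu]_(x in Omega) _) => J.
rewrite le_eqVlt; apply/orP; left; apply/eqP; by field.
Qed.

Lemma sum_Se w p : regular w p -> \sum_(e < nel M) Se e w p = S w p.
Proof. by move=> rw; rewrite /stream_energy (mesh_Rintegral hM (IS rw)). Qed.

(** The hypothesis is the orthogonality of the error eta + (v, q) to its own discrete part, expanded
    by linearity in the first argument. *)
Lemma energy_core :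
  c_form Omega a eta v + k_form Omega nu eta v + \sum_e stab e eta r v q +
  (c_form Omega a v v + k_form Omega nu v v + \sum_e stab e v q v q) = 0 ->
  K v + S v q <= 12 * (K eta + S eta r + \sum_e V e eta + Z).
Proof.
have s1 : 2^-1 * S v q - 2^-1 * \sum_e V e v <= \sum_e stab e v q v q.
  rewrite -(sum_Se rv) !mulr_sumr -sumrB; apply: ler_sum => e _; exact: stab_self_ge.
have s2 : - \sum_e stab e eta r v q <= 6^-1 * S v q + 3 * S eta r + 3 * \sum_e V e eta.
  rewrite -(sum_Se rv) -(sum_Se reta) !mulr_sumr -!big_split/= -sumrN.
  by apply: ler_sum => e _; exact: stab_cross_le.
have := c_form_le; have := k_form_le; have := visc_sum_le; rewrite c_form_self.
have S0 : 0 <= S v q.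
  apply: Rintegral_ge0 => x Ox; rewrite mulr_ge0 ?dot_ge0//; exact/ltW/htauM.
have K0 w : 0 <= K w.
  by apply: Rintegral_ge0 => x Ox; rewrite mulr_ge0 ?ddot_ge0// mulr_ge0// ltW.
by move=> h1 h2 h3 h4; exact: (energy_arith s1 s2 S0 (K0 v) (K0 eta) h1 h2 h3 h4).
Qed.

End core.
End energy.

(** * Consistency of the stabilized form and Galerkin orthogonality *)

Section consistency.
Context {R : realType} {d : nat}.
Local Notation X := 'rV[R]_d.
Local Notation mu := (lebesgue_rV R d).
Variables (Omega : set X) (M : mesh R d).
Hypothesis hM : mesh_of Omega M.
Variables (nu : R) (a f u : X -> X) (p tauC tauM : X -> R) (Cinv : 'I_(nel M) -> R).
Hypotheses (ha : vH10 Omega a) (hf : vL2 Omega f).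
Hypotheses (mtauC : measurable_fun Omega tauC) (mtauM : measurable_fun Omega tauM).
Hypothesis htauM : forall x, Omega x -> 0 < tauM x.
Hypothesis htau : forall e x, elem e x -> tauM x <= diam (elem e) ^+ 2 / (Cinv e * nu).
Hypothesis hup : oseen_solution Omega nu a f u p.
Hypotheses (hu2 : vH2 Omega u) (hp1 : H1 Omega p).
Let oO : open Omega := mesh_open hM.
Let fO : (mu Omega < +oo)%E := mesh_lty hM.
Let mO : measurable Omega := mesh_measurable hM.
Let oE e : open (elem (m := M) e) := @elem_open _ _ _ _ hM e.
Let mE e : measurable (elem (m := M) e) := elem_measurable hM e.
Let EO e : elem (m := M) e `<=` Omega := @elem_sub _ _ _ _ hM e.
Let cE e : compact (closure (elem (m := M) e)) := @elem_compact _ _ _ _ hM e.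
Let hu : vH10 Omega u. Proof. by case: hup. Qed.
Let strong := oseen_strong oO fO ha hf hup hu2 hp1.

Lemma H1_symgrad_exact i j : H1 Omega (fun x => symgrad Omega u x i j).
Proof. exact: (H1_symgrad oO i j (fun k l => (hu2 k).2 l)). Qed.

(** Square integrability of a . grad u does not follow from u in H^2 and a in H^1_0 in arbitrary
    dimension; it is read off the strong equation, all of whose other terms are in L^2. *)
Lemma exact_regular : regular_pair Omega M a u p.
Proof.
split; [exact: vH10_vH1|exact: hp1| |]; last first.
  by move=> e i j; exact: (H1S oO (@oE e) (@EO e) (H1_symgrad_exact i j)).
have L1 := vL2B mO (vL2D mO hf (vL2_strong_visc oO nu u)) (vL2_grad oO p).
apply: (vL2_ae mO _ _ L1).
  by move=> i; apply: (measurable_advect oO); exact: vH1_vL2 (vH10_vH1 ha).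
apply: filterS strong => x h Ox; rewrite -(h Ox).
by rewrite [RHS]addrAC addrK subrK.
Qed.

Lemma exact_visc (e : 'I_(nel M)) :
  {ae mu, forall x, elem e x -> visc Omega nu e u x = strong_visc Omega nu u x}.
Proof.
have H (k : 'I_d * 'I_d) : {ae mu, forall x, elem e x ->
    wpartial (elem e) k.2 (fun y => ((2 * nu) *: symgrad Omega u y) k.1 k.2) x =
    wpartial Omega k.2 (fun y => ((2 * nu) *: symgrad Omega u y) k.1 k.2) x}.
  apply: (wpartialS oO (@oE e) (@EO e) (@cE e)).
  have := H1Z oO (2 * nu) (H1_symgrad_exact k.1 k.2).
  by congr H1; apply/funext => y; rewrite [RHS]mxE.
apply: filterS (ae_forall H) => x h Ex; apply/rowP => i.
rewrite viscE strong_viscE; apply: eq_bigr => j _; exact: (h (i, j) Ex).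
Qed.

(** On each element the viscous term agrees with its global version, since u is in H^2; the residual
    is then f almost everywhere, and the element integrals add up to one over the domain. *)
Lemma exact_stab v q : regular_pair Omega M a v q ->
  \sum_(e < nel M) stab Omega nu a tauM e u p v q =
  vip Omega f (fun x => tauM x *: streamline Omega a v q x).
Proof.
move=> rv; have Lt := vL2_tau hM mtauM htauM htau (vL2_streamline hM rv).
have I := Int_dot mO hf Lt.
rewrite [RHS](mesh_Rintegral hM I); apply: eq_bigr => e _.
have Lte := vL2_elem hM e Lt; have Lr := vL2_residual hM nu e exact_regular.
apply: (Rintegral_ae (mE e)).
- exact: Int_measurable (Int_dot (mE e) Lr Lte).
- exact: Int_measurable (Int_elem hM e I).
apply: filterS2 (ae_elem hM e strong) (exact_visc e) => x h1 h2 Ex.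
by congr (dot _ _); rewrite (h2 Ex); exact: h1 Ex.
Qed.

Lemma oseen_div_free v : vH10 Omega v -> {ae mu, forall x, Omega x -> div Omega v x = 0} ->
  c_form Omega a u v + k_form Omega nu u v = vip Omega f v.
Proof.
move=> hv dv; have [_ Lp /(_ v (fun=> 0) hv)] := hup.
have b0 w q : L2 Omega q -> {ae mu, forall x, Omega x -> div Omega w x * q x = 0} ->
    b_form Omega w q = 0.
  move=> hq h; apply: (Rintegral_ae0 mO) h.
  apply: measurable_funM; last exact: L2_measurable hq.
  exact: L2_measurable (L2_div oO w).
have L0 : L20 Omega (fun=> 0).
  by split; [exact: L2_0|rewrite Rintegral_cst ?mul0r].
move=> /(_ L0); rewrite (b0 v p Lp.1) ?(b0 u _ L0.1) ?addr0 ?subr0//.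
- by apply: aeW => x _; rewrite mulr0.
- by apply: filterS dv => x + Ox => ->; rewrite ?mul0r.
Qed.

(** [A_red] without the grad-div term, which vanishes when v is divergence free. As tauC carries no
    upper bound, leaving the term out spares its integrability when the form is split linearly in
    its first argument. *)
Definition stabilized_form w r v q : R :=
  c_form Omega a w v + k_form Omega nu w v + \sum_(e < nel M) stab Omega nu a tauM e w r v q.

Lemma stabilized_formB w r w' r' v q : discrete_velocity Omega M v ->
  regular_pair Omega M a w r -> regular_pair Omega M a w' r' -> regular_pair Omega M a v q ->
  stabilized_form (w - w') (r - r') v q = stabilized_form w r v q - stabilized_form w' r' v q.
Proof.
move=> hv rw rw' rv; have Es : \sum_(e < nel M) stab Omega nu a tauM e (w - w') (r - r') v q =
    \sum_(e < nel M) stab Omega nu a tauM e w r v q -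
    \sum_(e < nel M) stab Omega nu a tauM e w' r' v q.
  by rewrite -sumrB; apply: eq_bigr => e _; exact: (stabB hM ha mtauM htauM htau e rw rw' rv).
have aux (A B C A1 B1 C1 A2 B2 C2 : R) : A = A1 - A2 -> B = B1 - B2 -> C = C1 - C2 ->
    A + B + C = A1 + B1 + C1 - (A2 + B2 + C2).
  by move=> -> -> ->; rewrite !opprD [RHS]addrACA [X in _ = X + _]addrACA.
exact: aux (c_formB hM ha hv rw rw') (k_formB hM nu v rw rw') Es.
Qed.

(** Both sides equal the right-hand side of the discrete problem: the left by the weak equation,
    where the pressure drops out, together with the strong one in the stabilization, the right by
    the definition of the scheme. *)
Lemma galerkin_orthogonality uh pt v q : vH10 Omega v ->
  {ae mu, forall x, Omega x -> div Omega v x = 0} -> regular_pair Omega M a v q ->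
  A_red Omega nu a M tauC tauM uh pt v q =
    vip Omega f v + vip Omega f (fun x => tauM x *: streamline Omega a v q x) ->
  stabilized_form u p v q = stabilized_form uh pt v q.
Proof.
move=> hv dv rv E; apply: etrans (etrans (esym E) (A_red_div0 hM nu a tauM mtauC uh pt q dv)).
exact: (congr2 +%R (oseen_div_free hv dv) (exact_stab rv)).
Qed.

End consistency.

Lemma dot_sqrD_le (R : realType) (d : nat) (x y : 'rV[R]_d) :
  dot (x + y) (x + y) <= 2 * dot x x + 2 * dot y y.
Proof.
rewrite /dot !mulr_sumr -big_split/=; apply: ler_sum => i _; rewrite mxE.
have := sqr_ge0 (x 0 i - y 0 i).
by move: (x 0 i) (y 0 i) => s t; lra.
Qed.

Lemma ddot_sqrD_le (R : realType) (d : nat) (S T : 'M[R]_d) :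
  ddot (S + T) (S + T) <= 2 * ddot S S + 2 * ddot T T.
Proof.
rewrite /ddot !mulr_sumr -big_split/=; apply: ler_sum => i _.
rewrite !mulr_sumr -big_split/=; apply: ler_sum => j _; rewrite mxE.
have := sqr_ge0 (S i j - T i j).
by move: (S i j) (T i j) => s t; lra.
Qed.

Lemma findim_subspaceB (R : realType) (d : nat) (W : lmodType R) (U : set 'rV[R]_d)
    (Y S : set ('rV[R]_d -> W)) v w : (Y v -> Y w -> Y (v - w)) ->
  findim_subspace U Y S -> S v -> S w -> S (v - w).
Proof.
move=> hY [n [b [_ hS]]] /hS[Yv [c hc]] /hS[Yw [c' hc']]; apply/hS; split; first exact: hY.
exists (fun k => c k - c' k); apply: filterS2 hc hc' => x h h' Ux.
under eq_bigr do rewrite scalerBl.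
by rewrite sumrB -(h Ux) -(h' Ux).
Qed.

Lemma ae_le_Rintegral_double (R : realType) (d : nat) (U : set 'rV[R]_d) (f g h : 'rV[R]_d -> R)
    (mu := lebesgue_rV R d) : measurable U ->
  mu.-integrable U (EFin \o f) -> mu.-integrable U (EFin \o g) -> mu.-integrable U (EFin \o h) ->
  {ae mu, forall x, U x -> f x <= 2 * g x + 2 * h x} ->
  \int[mu]_(x in U) f x <= 2 * \int[mu]_(x in U) g x + 2 * \int[mu]_(x in U) h x.
Proof.
move=> mU If Ig Ih fgh; have I1 := IntZ mU 2 Ig; have I2 := IntZ mU 2 Ih.
rewrite -(RintegralZl _ mU Ig) -(RintegralZl _ mU Ih) -(RintegralD mU I1 I2).
exact: (ae_le_Rintegral mU If (IntD mU I1 I2) fgh).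
Qed.

Lemma ler_pM_double (R : realDomainType) (c x y z : R) : 0 <= c -> x <= 2 * y + 2 * z ->
  c * x <= 2 * (c * y) + 2 * (c * z).
Proof. by move=> c0 h; rewrite !(mulrCA 2 c) -mulrDr ler_wpM2l. Qed.

Lemma lerD_double (R : realDomainType) (x y z x' y' z' : R) :
  x <= 2 * y + 2 * z -> x' <= 2 * y' + 2 * z' -> x + x' <= 2 * (y + y') + 2 * (z + z').
Proof. by move=> h h'; lra. Qed.

(** * The error energy bounded by the energies of its two parts *)

Section triangle.
Context {R : realType} {d : nat}.
Local Notation X := 'rV[R]_d.
Local Notation mu := (lebesgue_rV R d).
Local Notation Int U f := (mu.-integrable U (EFin \o f)).
Variables (Omega : set X) (M : mesh R d).
Hypothesis hM : mesh_of Omega M.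
Variables (nu : R) (a : X -> X) (tauM : X -> R) (Cinv : 'I_(nel M) -> R).
Hypothesis hnu : 0 < nu.
Hypothesis mtauM : measurable_fun Omega tauM.
Hypothesis htauM : forall x, Omega x -> 0 < tauM x.
Hypothesis htau : forall e x, elem e x -> tauM x <= diam (elem e) ^+ 2 / (Cinv e * nu).
Let oO : open Omega := mesh_open hM.
Let mO : measurable Omega := mesh_measurable hM.
Let mE e : measurable (elem (m := M) e) := elem_measurable hM e.
Local Notation sl := (streamline Omega a).
Local Notation regular := (regular_pair Omega M a).
Local Notation Senergy := (stream_energy Omega a tauM Omega).

Let IK v : Int Omega (fun x => 2 * nu * ddot (symgrad Omega v x) (symgrad Omega v x)).
Proof. by apply: (IntZ mO); apply: (Int_ddot mO) => i j; exact: L2_symgrad. Qed.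

Let IS v q : regular v q -> Int Omega (fun x => tauM x * dot (sl v q x) (sl v q x)).
Proof. by move=> rv; apply: (Int_tau_dot hM mtauM htauM htau); exact: vL2_streamline rv. Qed.

Lemma integral_EFin (U : set X) (f : X -> R) : measurable U -> Int U f ->
  (\int[mu]_(x in U) (f x)%:E = (\int[mu]_(x in U) f x)%:E)%E.
Proof. by move=> mU hf; rewrite /Rintegral fineK//; exact: (integrable_fin_num mU hf). Qed.

Lemma energy_norm2E v q : regular v q ->
  energy_norm2 Omega nu a tauM v q = (k_form Omega nu v v + Senergy v q)%:E.
Proof. by move=> rv; rewrite /energy_norm2 (integral_EFin mO (IS rv)). Qed.

Lemma k_form_ge0 v : 0 <= k_form Omega nu v v.
Proof.
apply: Rintegral_ge0 => x Ox; have n0 := ltW hnu.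
by rewrite mulr_ge0 ?ddot_ge0// mulr_ge0.
Qed.

Lemma stream_energy_ge0 v q : 0 <= Senergy v q.
Proof. by apply: Rintegral_ge0 => x Ox; rewrite mulr_ge0 ?dot_ge0//; exact/ltW/htauM. Qed.

Variables (u w z : X -> X) (p r s : X -> R).
Hypotheses (ru : regular u p) (rw : regular w r) (rz : regular z s).
Hypotheses (ruw : regular (u - w) (p - r)) (rwz : regular (w - z) (r - s))
  (ruz : regular (u - z) (p - s)).

Lemma error_split : {ae mu, forall x, Omega x ->
  symgrad Omega (u - z) x = symgrad Omega (u - w) x + symgrad Omega (w - z) x /\
  sl (u - z) (p - s) x = sl (u - w) (p - r) x + sl (w - z) (r - s) x}.
Proof.
apply: filterS2 (regular_ae_sub hM ru rz)
  (filterI (regular_ae_sub hM ru rw) (regular_ae_sub hM rw rz)).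
move=> x h1 [h2 h3] Ox.
have [g1 s1] := h1 Ox; have [g2 s2] := h2 Ox; have [g3 s3] := h3 Ox.
rewrite (symgrad_of_vgrad g1) (symgrad_of_vgrad g2) (symgrad_of_vgrad g3) s1 s2 s3.
have aux (V : zmodType) (A B C : V) : A - C = (A - B) + (B - C) by rewrite addrA subrK.
by split; exact: aux.
Qed.

(** The pointwise bound |x + y|^2 <= 2 |x|^2 + 2 |y|^2 replaces the triangle inequality of the norm,
    so that only squares are integrated. *)
Lemma error_energy_le :
  k_form Omega nu (u - z) (u - z) + Senergy (u - z) (p - s) <=
  2 * (k_form Omega nu (u - w) (u - w) + Senergy (u - w) (p - r)) +
  2 * (k_form Omega nu (w - z) (w - z) + Senergy (w - z) (r - s)).
Proof.
have k : k_form Omega nu (u - z) (u - z) <=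
    2 * k_form Omega nu (u - w) (u - w) + 2 * k_form Omega nu (w - z) (w - z).
  apply: (ae_le_Rintegral_double mO (IK _) (IK _) (IK _)).
  apply: filterS error_split => x h Ox; rewrite (h Ox).1.
  by apply: ler_pM_double (ddot_sqrD_le _ _); rewrite mulr_ge0 ?(ltW hnu).
have t : Senergy (u - z) (p - s) <=
    2 * Senergy (u - w) (p - r) + 2 * Senergy (w - z) (r - s).
  apply: (ae_le_Rintegral_double mO (IS ruz) (IS ruw) (IS rwz)).
  apply: filterS error_split => x h Ox; rewrite (h Ox).2.
  exact: ler_pM_double (ltW (htauM Ox)) (dot_sqrD_le _ _).
exact: lerD_double k t.
Qed.

End triangle.

(** The coefficient obtained is 2 + 2 * 12 = 26; it is rounded up to the square 49 so that a square
    root can be taken. *)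
Lemma energy_combine (R : realFieldType) (E K S V Z K' S' : R) :
  0 <= K -> 0 <= S -> 0 <= V -> 0 <= Z ->
  E <= 2 * (K + S) + 2 * (K' + S') -> K' + S' <= 12 * (K + S + V + Z) ->
  E <= 49 * (K + S + V + Z).
Proof. by move=> *; lra. Qed.

Lemma measurable_inv_pos (R : realType) (d : nat) (U : set 'rV[R]_d) (g : 'rV[R]_d -> R) :
  measurable_fun U g -> (forall x, U x -> 0 < g x) -> measurable_fun U (fun x => (g x)^-1).
Proof.
move=> mg g0; apply: (@eq_measurable_fun _ _ _ _ U (fun x => g x `^ (-1))).
  by move=> x /set_mem Ux; rewrite powR_inv1// ltW// g0.
exact: measurableT_comp (measurable_powR (-1)) mg.
Qed.

Lemma sqrte_le_scale (R : realType) (E N : \bar R) (c : R) : 0 <= c -> (0 <= N)%E ->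
  (E <= (c ^+ 2)%:E * N)%E -> (sqrte E <= c%:E * sqrte N)%E.
Proof.
move=> c0 N0 EN; have -> : (c%:E = sqrte (c ^+ 2)%:E)%E.
  by rewrite /sqrte/= sqrtr_sqr ger0_norm.
rewrite -sqrteM ?lee_fin ?sqr_ge0// lee_sqrt//.
by rewrite mule_ge0// lee_fin sqr_ge0.
Qed.

(** * Passage from real energies to the extended-real norms *)

Section plus_norm.
Context {R : realType} {d : nat}.
Local Notation X := 'rV[R]_d.
Local Notation mu := (lebesgue_rV R d).
Local Notation Int U f := (mu.-integrable U (EFin \o f)).
Variables (Omega : set X) (M : mesh R d).
Hypothesis hM : mesh_of Omega M.
Variables (nu : R) (a : X -> X) (tauM : X -> R) (Cinv : 'I_(nel M) -> R).
Hypothesis hnu : 0 < nu.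
Hypothesis mtauM : measurable_fun Omega tauM.
Hypothesis htauM : forall x, Omega x -> 0 < tauM x.
Hypothesis htau : forall e x, elem e x -> tauM x <= diam (elem e) ^+ 2 / (Cinv e * nu).
Let mO : measurable Omega := mesh_measurable hM.
Let mE e : measurable (elem (m := M) e) := elem_measurable hM e.
Let EO e : elem (m := M) e `<=` Omega := @elem_sub _ _ _ _ hM e.
Local Notation regular := (regular_pair Omega M a).
Local Notation vis_en := (visc_energy Omega nu tauM).
Local Notation mass_en := (mass_energy Omega tauM).
Local Notation Senergy := (stream_energy Omega a tauM Omega).

Lemma visc_energy_ge0 (e : 'I_(nel M)) (v : X -> X) : 0 <= vis_en e v.
Proof.
apply: Rintegral_ge0 => x Ex; apply: mulr_ge0; last exact: dot_ge0.
exact/ltW/htauM/(EO Ex).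
Qed.

Lemma mass_integrand_ge0 (v : X -> X) x : Omega x -> 0 <= (tauM x)^-1 * dot (v x) (v x).
Proof. by move=> Ox; apply: mulr_ge0; [rewrite invr_ge0; exact/ltW/htauM|exact: dot_ge0]. Qed.

Lemma mass_energy_ge0 v : 0 <= mass_en v.
Proof. by apply: Rintegral_ge0 => x Ox; exact: mass_integrand_ge0. Qed.

Lemma sum_visc_energyE v :
  (\sum_(e < nel M) \int[mu]_(x in elem e)
     (tauM x * dot (visc Omega nu e v x) (visc Omega nu e v x))%:E =
   (\sum_(e < nel M) vis_en e v)%:E)%E.
Proof.
rewrite -sumEFin; apply: eq_bigr => e _; apply: (integral_EFin (mE e)).
by apply: (Int_tau_dot_elem hM mtauM htauM htau); exact: vL2_visc.
Qed.

Variables (eta err : X -> X) (r s : X -> R).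
Hypotheses (reta : regular eta r) (rerr : regular err s) (Leta : vL2 Omega eta).

(** The integrand is nonnegative and measurable, so the only obstruction to integrability is an
    infinite integral. *)
Lemma mass_integrable_or_infty :
  Int Omega (fun x => (tauM x)^-1 * dot (eta x) (eta x)) \/
  (\int[mu]_(x in Omega) ((tauM x)^-1 * dot (eta x) (eta x))%:E = +oo)%E.
Proof.
case: (leP +oo%E (\int[mu]_(x in Omega) ((tauM x)^-1 * dot (eta x) (eta x))%:E)%E) => [|lt].
  by rewrite leye_eq => /eqP ->; right.
left; apply/integrableP; split.
  apply/measurable_EFinP; apply: measurable_funM; first exact: measurable_inv_pos.
  exact: (Int_measurable (Int_dot mO Leta Leta)).
apply: le_lt_trans lt; rewrite le_eqVlt; apply/orP; left; apply/eqP.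
by apply: eq_integral => x /set_mem Ox; rewrite gee0_abs// lee_fin; exact: mass_integrand_ge0.
Qed.

(** If the term in tauM^-1 is infinite, so is the right-hand side. Otherwise every term is a real
    number, and the claim is the square root of the assumed inequality with 49 = 7^2. *)
Lemma energy_norm_le_plus :
  (Int Omega (fun x => (tauM x)^-1 * dot (eta x) (eta x)) ->
   k_form Omega nu err err + Senergy err s <=
   49 * (k_form Omega nu eta eta + Senergy eta r + \sum_(e < nel M) vis_en e eta + mass_en eta)) ->
  (energy_norm Omega nu a tauM err s <= 7%:E * energy_norm_plus Omega nu a M tauM eta r)%E.
Proof.
move=> H; have K0 := k_form_ge0 Omega hnu eta; have S0 := stream_energy_ge0 a htauM eta r.
have V0 : 0 <= \sum_(e < nel M) vis_en e eta by apply: sumr_ge0 => e _; exact: visc_energy_ge0.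
have Z0 := mass_energy_ge0 eta.
rewrite /energy_norm /energy_norm_plus.
rewrite (energy_norm2E hM mtauM htauM htau rerr).
rewrite (energy_norm2E hM mtauM htauM htau reta) sum_visc_energyE -EFinD.
apply: sqrte_le_scale => //.
  apply: adde_ge0; first by rewrite lee_fin !addr_ge0.
  by apply: integral_ge0 => x Ox; rewrite lee_fin; exact: mass_integrand_ge0.
case: mass_integrable_or_infty => [IZ|->].
  rewrite (integral_EFin mO IZ) -EFinD -EFinM lee_fin.
  by have -> : 7 ^+ 2 = 49 :> R; [ring|exact: H].
rewrite addey// gt0_muley ?leey// lte_fin exprn_gt0//.
Qed.

End plus_norm.

(** * Algebraic properties of the discrete spaces *)

Section discrete_spaces.
Context {R : realType} {d : nat}.
Local Notation X := 'rV[R]_d.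
Local Notation mu := (lebesgue_rV R d).
Variable U : set X.
Hypotheses (oU : open U) (fU : (mu U < +oo)%E).
Let mU : measurable U := open_measurable_rV oU.

Lemma findim_subspace_sub (W : lmodType R) (Y S : set (X -> W)) :
  findim_subspace U Y S -> S `<=` Y.
Proof. by move=> [n [b [_ hS]]] z /hS[]. Qed.

Lemma L20B (q r : X -> R) : L20 U q -> L20 U r -> L20 U (q - r).
Proof.
move=> [Lq q0] [Lr r0]; split; first exact: L2B.
by rewrite RintegralB ?q0 ?r0 ?subr0//; exact: L2_fin_Int.
Qed.

Lemma H1D (q r : X -> R) : H1 U q -> H1 U r -> H1 U (q + r).
Proof.
move=> hq hr; have h := H1B oU hq (H1Z oU (-1) hr).
by move: h; congr H1; apply/funext => x; rewrite mulN1r opprK.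
Qed.

Variables (Vh : set (X -> X)) (Qh Qfine : set (X -> R)).
Hypothesis hQh : @findim_subspace R d R^o U (L20 U `&` H1 U) Qh.
Hypothesis hQfine : @findim_subspace R d R^o U (H1 U) Qfine.

Lemma sum_space_H1 q : sum_space Qh Qfine q -> H1 U q.
Proof.
move=> [q1 /(findim_subspace_sub hQh)[_ h1] [q2 /(findim_subspace_sub hQfine) h2 <-]].
exact: H1D.
Qed.

Lemma sum_spaceB q r : sum_space Qh Qfine q -> sum_space Qh Qfine r ->
  sum_space Qh Qfine (q - r).
Proof.
move=> [q1 h1 [q2 h2 <-]] [r1 k1 [r2 k2 <-]]; exists (q1 - r1).
  apply: (findim_subspaceB _ hQh h1 k1) => -[Lq Hq] [Lr Hr].
  by split; [exact: L20B|exact: H1B].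
exists (q2 - r2); last by rewrite addrACA -opprD.
by apply: (findim_subspaceB _ hQfine h2 k2) => Hq Hr; exact: H1B.
Qed.

Hypothesis hVh : findim_subspace U (vH10 U) Vh.
Hypothesis hdivconf : forall v, Vh v -> Qh (div U v).

(** Divergence conformity makes div v itself an admissible pressure test function, so discretely
    divergence-free velocities are divergence free almost everywhere. *)
Lemma div_free_subspace_div v : div_free_subspace U Vh Qh v ->
  {ae mu, forall x, U x -> div U v x = 0}.
Proof.
move=> [Vv /(_ _ (hdivconf Vv)) b0]; have Ld := L2_div oU v.
apply: (Rintegral_sqr_eq0 mU Ld.2 _ Ld.1).
by rewrite -[RHS]b0; apply: eq_Rintegral => x _; rewrite expr2.
Qed.

(** Both fields are divergence free almost everywhere, so b(v - w, q) has a null integrand and no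
    linearity of b is required. *)
Lemma div_free_subspaceB v w : div_free_subspace U Vh Qh v -> div_free_subspace U Vh Qh w ->
  div_free_subspace U Vh Qh (v - w).
Proof.
move=> hv hw; have dv := div_free_subspace_div hv; have dw := div_free_subspace_div hw.
have Vv := findim_subspace_sub hVh hv.1; have Vw := findim_subspace_sub hVh hw.1.
split; first exact: findim_subspaceB (@vH10B _ _ _ oU fU v w) hVh hv.1 hw.1.
move=> q /(findim_subspace_sub hQh)[[Lq _] _]; apply: (Rintegral_ae0 mU).
  by apply: measurable_funM; [exact: L2_measurable (L2_div oU _)|exact: L2_measurable Lq].
apply: filterS2 (vgradB oU fU (vH10_vH1 Vv) (vH10_vH1 Vw)) (filterI dv dw) => x h [h1 h2] Ux.
by rewrite (div_of_vgrad (h Ux)) (h1 Ux) (h2 Ux) subrr mul0r.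
Qed.

End discrete_spaces.

Theorem theorem1 (R : realType) (d : nat) (hd : (0 < d)%N)
  (Omega : set 'rV[R]_d) (nu : R) (hnu : 0 < nu)
  (f : 'rV[R]_d -> 'rV[R]_d) (hf : vL2 Omega f)
  (a : 'rV[R]_d -> 'rV[R]_d) (ha : vH10 Omega a)
  (hdiva : {ae lebesgue_rV R d, forall x, Omega x -> div Omega a x = 0})
  (* mesh *)
  (M : mesh R d) (hM : mesh_of Omega M)
  (* discrete spaces *)
  (Vh : set ('rV[R]_d -> 'rV[R]_d)) (Qh Qfine : set ('rV[R]_d -> R))
  (hVh : findim_subspace Omega (vH10 Omega) Vh)
  (hQh : @findim_subspace R d R^o Omega (L20 Omega `&` H1 Omega) Qh)
  (hQfine : @findim_subspace R d R^o Omega (H1 Omega) Qfine)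
  (hVhpw : forall v, Vh v -> vmapped_pw_rational M v)
  (hQhpw : forall q, Qh q -> mapped_pw_rational M q)
  (hinfsup : inf_sup_stable Omega Vh Qh)
  (hQ : Qh `<=` Qfine)
  (* stabilization parameters *)
  (tauC tauM : 'rV[R]_d -> R)
  (mtauC : measurable_fun Omega tauC) (mtauM : measurable_fun Omega tauM)
  (htauC : forall x, Omega x -> 0 <= tauC x)
  (htauM : forall x, Omega x -> 0 < tauM x)
  (* (i) *)
  (Cinv : 'I_(nel M) -> R) (hCinv : forall e, 0 < Cinv e)
  (hinv : forall e v, Vh v ->
     vip (elem e) (visc Omega nu e v) (visc Omega nu e v) <=
     Cinv e / diam (elem e) ^+ 2 *
     mip (elem e) (fun x => nu *: symgrad Omega v x)
                  (fun x => nu *: symgrad Omega v x))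
  (* (ii) *)
  (htau : forall e x, elem e x ->
     tauM x <= diam (elem e) ^+ 2 / (Cinv e * nu))
  (* (iii) *)
  (hdivconf : forall v, Vh v -> Qh (div Omega v))
  (u : 'rV[R]_d -> 'rV[R]_d) (p : 'rV[R]_d -> R)
  (hup : oseen_solution Omega nu a f u p)
  (uh : 'rV[R]_d -> 'rV[R]_d) (pt : 'rV[R]_d -> R)
  (huhpt : reduced_solution Omega nu a f M tauC tauM
     (div_free_subspace Omega Vh Qh) (sum_space Qh Qfine) uh pt)
  (hu2 : vH2 Omega u) (hp1 : H1 Omega p) :
  (energy_norm Omega nu a tauM (u - uh)%R (p - pt)%R <=
   7%:E * ereal_inf
     [set energy_norm_plus Omega nu a M tauM (u - w)%R (p - r)%R
      | w in div_free_subspace Omega Vh Qh & r in sum_space Qh Qfine])%E.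
Proof.
have oO := mesh_open hM; have fO := mesh_lty hM.
have hu : vH10 Omega u by case: hup.
have ru := exact_regular hM ha hf hup hu2 hp1.
have du := oseen_div0 oO fO hup hp1.
have DV v : div_free_subspace Omega Vh Qh v -> discrete_velocity Omega M v.
  move=> hv; apply: (pw_rational_discrete hM); last exact: hVhpw hv.1.
  exact: findim_subspace_sub hVh _ hv.1.
have dV v := div_free_subspace_div oO hdivconf (v := v).
have hH1 := sum_space_H1 oO hQh hQfine.
case: huhpt => [huh hpt discrete].
have rh := discrete_regular hM ha (DV _ huh) (hH1 _ hpt).
(* With the positive factor 7 inside the infimum, it remains to bound the error by each competitor
   (w, r) separately. Then eta = (u - w, p - r), and xi = (w - uh, r - pt) is discrete. *)
rewrite -ereal_inf_pZl//; apply/ereal_infP => _ [_ [w hw [r hr <-]] <-].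
have rw := discrete_regular hM ha (DV _ hw) (hH1 _ hr).
have hv := div_free_subspaceB oO fO hQh hVh hdivconf hw huh.
have hq := sum_spaceB oO fO hQh hQfine hr hpt.
have rv := discrete_regular hM ha (DV _ hv) (hH1 _ hq).
have reta := regular_pairB hM ha ru rw; have rerr := regular_pairB hM ha ru rh.
have heta : vH10 Omega (u - w) := vH10B oO fO hu (DV _ hw).1.
have deta : {ae lebesgue_rV R d, forall x, Omega x -> div Omega (u - w) x = 0}.
  apply: filterS2 (vgradB oO fO (vH10_vH1 hu) (vH10_vH1 (DV _ hw).1)) (filterI du (dV _ hw)).
  by move=> x h [h1 h2] Ox; rewrite (div_of_vgrad (h Ox)) (h1 Ox) (h2 Ox) subrr.
apply: (energy_norm_le_plus hM hnu mtauM htauM htau reta rerr (vH1_vL2 (vH10_vH1 heta))) => IZ.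
have G := galerkin_orthogonality hM ha hf mtauC mtauM htauM htau hup hu2 hp1
  (DV _ hv).1 (dV _ hv) rv (discrete _ _ hv hq).
have T := error_energy_le hM hnu mtauM htauM htau ru rw rh reta rv rerr.
have C := energy_core hM hnu ha hdiva mtauM htauM hCinv htau reta heta deta (DV _ hv)
  (hH1 _ hq) (fun e => hinv e _ hv.1) IZ.
apply: (energy_combine _ _ _ _ T) (C _).
- exact: k_form_ge0.
- exact: stream_energy_ge0.
- by apply: sumr_ge0 => e _; exact: (visc_energy_ge0 hM nu htauM).
- exact: mass_energy_ge0.
have F := fun w1 r1 w2 r2 h1 h2 => stabilized_formB hM ha mtauM htauM htau
  (w := w1) (r := r1) (w' := w2) (r' := r2) (DV _ hv) h1 h2 rv.
(* The forms at eta and at xi telescope to the form at (u, p) minus the form at (uh, pt), which is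
   zero by orthogonality. *)
apply: etrans (congr2 +%R (F _ _ _ _ ru rw) (F _ _ _ _ rw rh)) _.
by rewrite addrA subrK G subrr.
Qed.
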